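(* Let $q\in(0,1]$ be fixed and let $p=p_n$, $R=R_n$, $\tau=\tau_n$ be sequences; put $$\tilde\tau=\min\{c_UR^{2/q},\tau\},\qquad \tilde R=\min\{p^{1-q/2}c_L^{-q/2}\tau^{q/2},R\}.$$ Assume $\tilde R(1+\tilde\tau)^{-q/2}\big(\frac{\log p}{n}\big)^{1-q/2}=o(1)$ and $p^{-\delta}\lesssim\tilde R\big(\frac{\log p}{n}\big)^{1-q/2}\max\{\tilde\tau^{-q/2},\tilde\tau^{-1}\}$ for some constant $\delta>0$. Let $\lambda\asymp\sqrt{\frac{(1+\tilde\tau)\log p}{n}}$ and $\gamma\asymp\sqrt{\tilde\tau}$ with sufficiently large constants (in the sense specified in the context), and let $$\tilde\alpha\in\operatorname*{argmin}_{\|\beta\|_2\le\gamma}\ \tfrac12\beta^T\hat\Sigma\beta-\beta^T\hat\mu+\lambda\|\beta\|_1,\qquad \tilde\theta=2\hat\mu^T\tilde\alpha-\tilde\alpha^T\hat\Sigma\tilde\alpha.$$ Then $$\sup_{(\mu,\Sigma)\in\mathcal H_q(R,\tau)}\mathbb E\|\tilde\alpha-\alpha\|_2^2\lesssim(1+\tilde\tau)^{1-\frac q2}\tilde R\Big(\frac{\log p}{n}\Big)^{1-\frac q2},$$ $$\sup_{(\mu,\Sigma)\in\mathcal H_q(R,\tau)}\mathbb E|\tilde\theta-\theta|\lesssim(1+\tilde\tau)^{1-\frac q2}\tilde R\Big(\frac{\log p}{n}\Big)^{1-\frac q2}+\frac{\tilde\tau+\sqrt{\tilde\tau}}{\sqrt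 n}.$$
   Context: Model: $x_1,\dots,x_n\in\mathbb R^p$ are i.i.d. copies of $x=\Sigma^{1/2}y+\mu$, where $\mu\in\mathbb R^p$, $\Sigma$ is a symmetric positive definite $p\times p$ matrix, and $y\in\mathbb R^p$ is zero-mean and isotropic ($\mathbb E yy^T=I_p$) and satisfies $\mathbb P(|b^Ty|\ge t)\le 2\exp(-t^2/\nu^2)$ for all $t\ge0$ and all $\|b\|_2=1$, with $\nu>0$ a fixed constant. Put $\alpha=\Sigma^{-1}\mu$, $\theta=\mu^T\Sigma^{-1}\mu$, $\hat\mu=\frac1n\sum_i x_i$, $\hat\Sigma=\frac1n\sum_i(x_i-\hat\mu)(x_i-\hat\mu)^T$. The suprema may be read as also being over all such distributions of $y$. Parameter space: with fixed constants $0<c_L<c_U$ and $R,\tau>0$, $$\mathcal H_q(R,\tau)=\{(\mu,\Sigma):\|\Sigma^{-1}\mu\|_q^q\le R,\ \mu^T\Sigma^{-1}\mu\le\tau,\ c_L\le\lambda_{\min}(\Sigma)\le\delta_\Sigma\le c_U\},$$ with $\|a\|_q=(\sum_i|a_i|^q)^{1/q}$ and $\delta_\Sigma=\max_i\Sigma_{ii}$. Asymptotic notation: $f(n)\lesssim g(n)$ means there is a constant $C>0$ independent of $n$ with $f(n)\le Cg(n)$ for all $n$. ''$\lambda\asymp a$ with sufficiently large constants'' means: there is a threshold $K_0$ depending only on the fixed constants ($\nu,c_L,c_U,\delta,q$) such that the statement holds whenever $K_0a\le\lambda\le Ka$ for some fixed $K\ge K_0$ (constants in the conclusion may depend on $K$);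 similarly for $\gamma$. *)

(* Defs.v *)
From HB Require Import structures.
From mathcomp Require Import all_boot all_order all_algebra.
From mathcomp Require Import all_classical all_reals all_analysis.
Set Implicit Arguments.
Unset Strict Implicit.
Unset Printing Implicit Defensive.
Import Order.TTheory GRing.Theory Num.Theory.
Import numFieldNormedType.Exports.
Local Open Scope classical_set_scope.
Local Open Scope ring_scope.

Section Vectors.
Context {R : realType} {p : nat}.
Implicit Types (a b : 'cV[R]_p) (S M : 'M[R]_p) (q : R).

Definition dotv a b : R := (a^T *m b) 0 0.

Definition quadf M a : R := (a^T *m M *m a) 0 0.

(* Only a quasi-norm when q < 1. *)
Definition lnorm q a : R := (\sum_(i < p) `|a i 0| `^ q) `^ q^-1.

Definition symmx M : Prop := M^T = M.

Definition psdmx M : Prop := symmx M /\ forall a, 0 <= quadf M a.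

Definition pdmx M : Prop := symmx M /\ forall a, a != 0 -> 0 < quadf M a.

(* S is the principal square root of M: a positive semidefinite matrix has
   exactly one positive semidefinite square root. *)
Definition is_sqrtmx M S : Prop := psdmx S /\ S *m S = M.

(* The spectrum of a symmetric real matrix of positive size is finite and
   nonempty, so that the infimum is a minimum. *)
Definition lambda_min M : R := inf [set l : R | eigenvalue M l].

(* The default value 0 is harmless: positive definite matrices have a positive
   diagonal. *)
Definition max_diag M : R := \big[Num.max/0]_(i < p) M i i.

End Vectors.

(* H_q(r, t), restricted to the symmetric positive definite matrices allowed by
   the model; quadf (invmx Sigma) mu is mu^T Sigma^-1 mu. *)
Definition param_space {R : realType} {p : nat} (q cL cU r t : R)
    (mu : 'cV[R]_p) (Sigma : 'M[R]_p) : Prop :=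
  [/\ pdmx Sigma,
      lnorm q (invmx Sigma *m mu) `^ q <= r,
      quadf (invmx Sigma) mu <= t,
      cL <= lambda_min Sigma <= max_diag Sigma &
      max_diag Sigma <= cU].

Section RandomVectors.
Context {R : realType} {p : nat}.

Definition borel_cV : measurableType _ :=
  g_sigma_algebraType (@open 'cV[R]_p).

Definition random_vector {d} {T : measurableType d} (X : T -> 'cV[R]_p) : Prop :=
  measurable_fun [set: T] (X : T -> borel_cV).

Definition same_law {d d'} {T : measurableType d} {T' : measurableType d'}
    (P : probability T R) (X : T -> 'cV[R]_p)
    (P' : probability T' R) (Y : T' -> 'cV[R]_p) : Prop :=
  forall B : set borel_cV, measurable B -> P (X @^-1` B) = P' (Y @^-1` B).

Definition mutually_independent {d} {T : measurableType d}
    (P : probability T R) {n : nat} (X : 'I_n -> T -> 'cV[R]_p) : Prop :=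
  forall (J : {set 'I_n}) (B : 'I_n -> set borel_cV),
    (forall i, measurable (B i)) ->
    P (\bigcap_(i in [set` J]) (X i @^-1` B i))
      = (\prod_(i in J) P (X i @^-1` B i))%E.

Definition iid_copies {d d'} {T : measurableType d} {T' : measurableType d'}
    (P : probability T R) {n : nat} (X : 'I_n -> T -> 'cV[R]_p)
    (P' : probability T' R) (Y : T' -> 'cV[R]_p) : Prop :=
  [/\ forall i, random_vector (X i),
      mutually_independent P X &
      forall i, same_law P (X i) P' Y].

Definition isotropic_subgaussian {d} {T : measurableType d}
    (P : probability T R) (nu : R) (y : T -> 'cV[R]_p) : Prop :=
  [/\ random_vector y,
      forall j, ('E_P[(fun w => y w j 0)%R] = 0)%E,
      forall j k, ('E_P[(fun w => (y w *m (y w)^T) j k)%R]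
        = ((1%:M : 'M[R]_p) j k)%:E)%E &
      forall (b : 'cV[R]_p) (t : R), lnorm 2 b = 1 -> 0 <= t ->
        (P [set w | (t <= `|dotv b (y w)|)%R]
          <= (2 * expR (- (t ^+ 2 / nu ^+ 2)))%:E)%E].

End RandomVectors.

Section Estimator.
Context {R : realType} {p n : nat}.
Implicit Types (x : 'I_n -> 'cV[R]_p) (b : 'cV[R]_p).

Definition sample_mean x : 'cV[R]_p := n%:R^-1 *: \sum_(i < n) x i.

Definition sample_cov x : 'M[R]_p :=
  n%:R^-1 *: \sum_(i < n) ((x i - sample_mean x) *m (x i - sample_mean x)^T).

Definition lasso_obj (lam : R) x b : R :=
  2^-1 * quadf (sample_cov x) b - dotv b (sample_mean x) + lam * lnorm 1 b.

Definition lasso_argmin (lam gam : R) x : set 'cV[R]_p :=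
  [set a | lnorm 2 a <= gam /\
     forall b, lnorm 2 b <= gam -> lasso_obj lam x a <= lasso_obj lam x b].

Definition theta_est x (a : 'cV[R]_p) : R :=
  2 * dotv (sample_mean x) a - quadf (sample_cov x) a.

End Estimator.

Section Rates.
Context {R : realType}.

Definition tau_tilde (q cU r t : R) : R := Num.min (cU * r `^ (2 / q)) t.

Definition R_tilde (q cL r t : R) (p : nat) : R :=
  Num.min (p%:R `^ (1 - q / 2) * cL `^ (- (q / 2)) * t `^ (q / 2)) r.

Definition log_ratio (p n : nat) : R := ln p%:R / n%:R.

End Rates.

(* Main.v *)
(** Write [Delta] for the error of the estimator and [L = ln p / n].

    When [L] is larger than a constant, [lam] dominates every coordinate of the
    sample mean with high probability, so the estimator vanishes, and the trivial
    error [alpha] is already of the order of the rate.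

    When [L] is small, exponential moments of products of independent factors give
    Bernstein bounds for linear and quadratic statistics of the sample. A union bound
    makes [sample_cov] dominate half of [Sigma] on all sums of [s ~ n / ln p] signed
    basis vectors; averaging over random such sums (Maurey's empirical method, in
    Oliveira's transfer form) extends this to
    [quadf sample_cov v >= cL / 2 |v|_2^2 - C L |v|_1^2] for every [v], without nets.
    The basic inequality of the lasso, split at the threshold [sqrt ((1 + tau) L)]
    of the weakly sparse [alpha], then bounds [Delta].

    Off the good event, the constraint [|beta|_2 <= gam] bounds [Delta], and
    [0 <= theta_est <= 2 mean . alpha_est]; the polynomially small probability of that
    event is absorbed by the lower bound on the rate. Finitely many [n] are handled
    by declaring everything bad. *)
Require Import Defs.
From HB Require Import structures.
From mathcomp Require Import all_boot all_order all_algebra.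
From mathcomp Require Import all_classical all_reals all_analysis.
From mathcomp Require Import measurable_realfun.
From mathcomp Require Import ring lra.
Set Implicit Arguments.
Unset Strict Implicit.
Unset Printing Implicit Defensive.
Import Order.TTheory GRing.Theory Num.Theory.
Import numFieldNormedType.Exports.
Local Open Scope classical_set_scope.
Local Open Scope ring_scope.

(** * Euclidean and quadratic forms *)

(** The hypotheses do not force [L] to be small: [R_tilde] may vanish and alone make the effective
    sparsity [R_tilde (1 + tau)^(-q/2) L^(1-q/2)] negligible. Hence the two regimes; where [L] is
    bounded below, the trivial error is affordable because [(tau_tilde / cU)^(q/2) <= R_tilde].

    Up to the penalty, [theta_est] is minus twice the minimised objective. Moving from [alpha] to
    the estimator therefore changes it by the very terms that control the squared error, not by
    their square root. What remains, [theta_est] at [alpha] minus [theta], is a combination of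
    centred averages and a square; it is integrated over the whole space and yields the [n^(-1/2)]
    term.

    The delicate point is the bad event: the bound on [theta_est] there involves [mu . mu], which
    may be of order [p tau]. The events are therefore built with probability of order
    [p^(-(delta+1))]: one power of [p] pays for this factor, and [tau p^(-delta)] is at most a
    constant times the rate.

    [K0] has to be fixed before the sequences and before [K], so every threshold depends on [nu],
    [cL], [cU], [delta], [q] only. *)

Section EuclideanForms.
Context {R : realType} {p : nat}.
Implicit Types (a b c : 'cV[R]_p) (M S : 'M[R]_p).

Lemma dotvE a b : dotv a b = \sum_i a i 0 * b i 0.
Proof. by rewrite /dotv mxE; apply: eq_bigr => i _; rewrite mxE. Qed.

Lemma dotvC a b : dotv a b = dotv b a.
Proof. by rewrite !dotvE; apply: eq_bigr => i _; rewrite mulrC. Qed.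

Lemma dotvDr a b c : dotv a (b + c) = dotv a b + dotv a c.
Proof. by rewrite /dotv mulmxDr mxE. Qed.

Lemma dotvDl a b c : dotv (b + c) a = dotv b a + dotv c a.
Proof. by rewrite dotvC dotvDr !(dotvC a). Qed.

Lemma dotvZr k a b : dotv a (k *: b) = k * dotv a b.
Proof. by rewrite /dotv -scalemxAr mxE. Qed.

Lemma dotvZl k a b : dotv (k *: a) b = k * dotv a b.
Proof. by rewrite dotvC dotvZr dotvC. Qed.

Lemma dotvNr a b : dotv a (- b) = - dotv a b.
Proof. by rewrite -scaleN1r dotvZr mulN1r. Qed.

Lemma dotvNl a b : dotv (- a) b = - dotv a b.
Proof. by rewrite dotvC dotvNr dotvC. Qed.

Lemma dotvBr a b c : dotv a (b - c) = dotv a b - dotv a c.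
Proof. by rewrite dotvDr dotvNr. Qed.

Lemma dotvBl a b c : dotv (b - c) a = dotv b a - dotv c a.
Proof. by rewrite dotvDl dotvNl. Qed.

Lemma dotv0r a : dotv a 0 = 0. Proof. by rewrite -(subrr 0) dotvBr subrr. Qed.

Lemma dotv0l a : dotv 0 a = 0. Proof. by rewrite dotvC dotv0r. Qed.

Lemma dotv_sumr (I : Type) (r : seq I) (P : pred I) (F : I -> 'cV[R]_p) a :
  dotv a (\sum_(i <- r | P i) F i) = \sum_(i <- r | P i) dotv a (F i).
Proof.
by apply: (big_morph (dotv a)) => [b c|]; [exact: dotvDr | exact: dotv0r].
Qed.

Lemma dotv_suml (I : Type) (r : seq I) (P : pred I) (F : I -> 'cV[R]_p) a :
  dotv (\sum_(i <- r | P i) F i) a = \sum_(i <- r | P i) dotv (F i) a.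
Proof. by rewrite dotvC dotv_sumr; apply: eq_bigr => i _; rewrite dotvC. Qed.

Lemma dotv_ge0 a : 0 <= dotv a a.
Proof. by rewrite dotvE sumr_ge0// => i _; rewrite -expr2 sqr_ge0. Qed.

Lemma dotv_eq0 a : (dotv a a == 0) = (a == 0).
Proof.
apply/idP/eqP => [|->]; last by rewrite dotv0l.
rewrite dotvE psumr_eq0 => [/allP h|i _]; last by rewrite -expr2 sqr_ge0.
apply/matrixP => i j; rewrite ord1 mxE.
by have := h i (mem_index_enum _); rewrite /= mulf_eq0 orbb => /eqP.
Qed.

Lemma dotv_delta (j : 'I_p) a : dotv (delta_mx j 0) a = a j 0.
Proof.
rewrite dotvE (bigD1 j)//= mxE !eqxx mul1r big1 ?addr0// => i ij.
by rewrite mxE (negbTE ij) mul0r.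
Qed.

Lemma dotv_mulmx M a b : dotv a (M *m b) = dotv (M^T *m a) b.
Proof. by rewrite /dotv trmx_mul trmxK mulmxA. Qed.

Lemma quadfE M a : quadf M a = dotv a (M *m a).
Proof. by rewrite /quadf /dotv mulmxA. Qed.

Lemma quadf_scale M k a : quadf M (k *: a) = k ^+ 2 * quadf M a.
Proof. by rewrite !quadfE -scalemxAr dotvZl dotvZr mulrA expr2. Qed.

Lemma quadf_delta M (j : 'I_p) : quadf M (delta_mx j 0) = M j j.
Proof. by rewrite quadfE dotv_delta -colE mxE. Qed.

Lemma quadf0 M : quadf M 0 = 0.
Proof. by rewrite quadfE dotv0l. Qed.

Lemma quadfD M a b : symmx M ->
  quadf M (a + b) = quadf M a + 2 * dotv a (M *m b) + quadf M b.
Proof.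
move=> sM; rewrite !quadfE mulmxDr !dotvDl !dotvDr.
have -> : dotv b (M *m a) = dotv a (M *m b) by rewrite dotv_mulmx sM dotvC.
by ring.
Qed.

Lemma quadf_sqrt M S a : is_sqrtmx M S -> quadf M a = dotv (S *m a) (S *m a).
Proof.
by move=> [[sS _] <-]; rewrite quadfE -mulmxA dotv_mulmx sS.
Qed.

Lemma dotv_sqrt M S a b : is_sqrtmx M S -> dotv (S *m a) (S *m b) = dotv a (M *m b).
Proof.
by move=> [[sS _] <-]; rewrite -mulmxA [RHS]dotv_mulmx sS.
Qed.

Lemma lnorm2E a : lnorm 2 a = Num.sqrt (dotv a a).
Proof.
rewrite /lnorm powR12_sqrt; last by apply: sumr_ge0 => i _; exact: powR_ge0.
congr Num.sqrt; rewrite dotvE; apply: eq_bigr => i _.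
by rewrite powR_mulrn// real_normK ?num_real// expr2.
Qed.

Lemma lnorm2_sqr a : lnorm 2 a ^+ 2 = dotv a a.
Proof. by rewrite lnorm2E sqr_sqrtr// dotv_ge0. Qed.

Lemma lnorm_ge0 q a : 0 <= lnorm q a.
Proof. exact: powR_ge0. Qed.

Lemma lnorm1E a : lnorm 1 a = \sum_i `|a i 0|.
Proof.
rewrite /lnorm invr1 powRr1; last by apply: sumr_ge0 => i _; exact: powR_ge0.
by apply: eq_bigr => i _; rewrite powRr1.
Qed.

Lemma lnorm_powR q a : 0 < q -> lnorm q a `^ q = \sum_i `|a i 0| `^ q.
Proof.
move=> q0; rewrite /lnorm -powRrM mulVf ?gt_eqF// powRr1//.
by apply: sumr_ge0 => i _; exact: powR_ge0.
Qed.

End EuclideanForms.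

(** * Sampling sparse vectors; sample moments *)

Section EmpiricalMethod.
Context {R : realType} {p : nat}.
Variables (Q : 'M[R]_p) (C : R).
Hypothesis Q_sym : symmx Q.
Hypothesis Q_diag : forall j, Q j j <= C.

(** Sign and index form one finite type with [2 p] elements, so that sums of [s] steps can be
    counted in a union bound. *)
Definition signed_basis (e : bool * 'I_p) : 'cV[R]_p := (-1) ^+ e.1 *: delta_mx e.2 0.

Let step (v : 'cV[R]_p) (j : 'I_p) := signed_basis (v j 0 < 0, j).

Lemma sum_step (v : 'cV[R]_p) : \sum_j `|v j 0| *: step v j = v.
Proof.
apply/matrixP => i k; rewrite ord1 summxE (bigD1 i)//= big1 => [|j ji].
  rewrite /step /signed_basis !mxE !eqxx mulr1 addr0 /=.
  by case: ltP => h; [rewrite expr1 ltr0_norm//; ring|rewrite expr0 mulr1 ger0_norm].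
by rewrite !mxE eq_sym (negbTE ji) !mulr0.
Qed.

(* [m (m - 1) / W^2 Q(v) + m D / W] is the mean of [Q] over [m] independent
   steps drawn with weights [|v_j| / W], and a mean of nonnegative numbers is
   nonnegative; the induction reveals the steps one at a time. *)
Lemma quadf_sampling (v : 'cV[R]_p) (m : nat) (u : 'cV[R]_p) :
  let W := \sum_j `|v j 0| in W != 0 ->
  (forall l : seq (bool * 'I_p), size l = m ->
     0 <= quadf Q (u + \sum_(e <- l) signed_basis e)) ->
  0 <= quadf Q u + 2 * m%:R / W * dotv u (Q *m v)
       + m%:R * (m%:R - 1) / W ^+ 2 * quadf Q v
       + m%:R / W * \sum_j `|v j 0| * Q j j.
Proof.
move=> W W0; elim: m u => [|m IH] u hl.
  have := hl [::] erefl; rewrite big_nil addr0 => h.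
  by rewrite mulr0 !mul0r !addr0.
set Dg := \sum_j _.
pose Phi z := quadf Q z + 2 * m%:R / W * dotv z (Q *m v)
       + m%:R * (m%:R - 1) / W ^+ 2 * quadf Q v + m%:R / W * Dg.
have Phi0 j : 0 <= Phi (u + step v j).
  apply: IH => l lm; have := hl ((v j 0 < 0, j) :: l).
  by rewrite big_cons /= addrA => -> //; rewrite lm.
have Wgt : 0 < W by rewrite lt_neqAle eq_sym W0 sumr_ge0.
(* Average over the first step. Expanding [quadf Q (u + step)] produces [Q j j], since signs square
   to one; every other new term is linear in the step, whose mean is [v / W]. *)
have : 0 <= W^-1 * \sum_j `|v j 0| * Phi (u + step v j).
  by rewrite mulr_ge0 ?invr_ge0 ?(ltW Wgt)// sumr_ge0// => j _; rewrite mulr_ge0.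
suff -> : \sum_j `|v j 0| * Phi (u + step v j)
   = W * (quadf Q u + 2 * m%:R / W * dotv u (Q *m v)
       + m%:R * (m%:R - 1) / W ^+ 2 * quadf Q v + m%:R / W * Dg)
     + 2 * dotv u (Q *m v) + Dg + 2 * m%:R / W * quadf Q v.
  move=> h; apply: le_trans h _; rewrite le_eqVlt; apply/orP; left; apply/eqP.
  by rewrite -natr1; field.
rewrite (eq_bigr (fun j => `|v j 0| * (quadf Q u + 2 * m%:R / W * dotv u (Q *m v)
       + m%:R * (m%:R - 1) / W ^+ 2 * quadf Q v + m%:R / W * Dg)
     + 2 * (`|v j 0| * dotv u (Q *m step v j)) + `|v j 0| * Q j j
     + 2 * m%:R / W * (`|v j 0| * dotv (step v j) (Q *m v)))) => [|j _]; last first.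
  rewrite /Phi quadfD// dotvDl.
  have -> : quadf Q (step v j) = Q j j.
    by rewrite /step /signed_basis quadf_scale quadf_delta sqrr_sign mul1r.
  by ring.
rewrite !big_split /= -!mulr_sumr -mulr_suml.
have -> : \sum_j `|v j 0| * dotv u (Q *m step v j) = dotv u (Q *m v).
  rewrite -[X in _ = dotv u (Q *m X)]sum_step mulmx_sumr dotv_sumr.
  by apply: eq_bigr => j _; rewrite -[in RHS]scalemxAr dotvZr.
have -> : \sum_j `|v j 0| * dotv (step v j) (Q *m v) = quadf Q v.
  rewrite quadfE -[X in _ = dotv X _]sum_step dotv_suml.
  by apply: eq_bigr => j _; rewrite [in RHS]dotvZl.
by rewrite -/W -/Dg; ring.
Qed.

(** The sampling bound at [u = 0] and [m = s], multiplied by [W^2 / (s (s - 1))]; the diagonal term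
    is at most [C W]. The loss decreases like [1 / s], so [s] should be as large as the union bound
    permits. *)
Lemma quadf_ge_of_sparse (s : nat) (v : 'cV[R]_p) : (2 <= s)%N ->
  (forall l : seq (bool * 'I_p), size l = s ->
     0 <= quadf Q (\sum_(e <- l) signed_basis e)) ->
  - (C / (s%:R - 1)) * lnorm 1 v ^+ 2 <= quadf Q v.
Proof.
move=> s2 hl; rewrite lnorm1E.
have [W0|W0] := eqVneq (\sum_j `|v j 0|) 0.
  have v0 : v = 0.
    apply/matrixP => i k; rewrite ord1 mxE; apply/eqP; rewrite -normr_eq0.
    by move/eqP: W0; rewrite psumr_eq0// => /allP /(_ i (mem_index_enum _)).
  by rewrite W0 expr0n mulr0 v0 quadf0.
have := @quadf_sampling v s 0 W0; rewrite quadf0 dotv0l mulr0 !add0r.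
move=> /(_ _)/wrap[l ls|h]; first by rewrite add0r; exact: hl.
set W := \sum_j `|v j 0| in W0 h *.
have Wgt : 0 < W by rewrite lt_neqAle eq_sym W0 sumr_ge0.
have D : \sum_j `|v j 0| * Q j j <= W * C.
  by rewrite mulr_suml; apply: ler_sum => j _; apply: ler_wpM2l.
have s1 : 0 < s%:R - 1 :> R by rewrite subr_gt0 ltr1n.
have s0 : 0 < s%:R :> R by rewrite ltr0n (leq_trans _ s2).
have k0 : 0 <= s%:R / W by rewrite divr_ge0 ?(ltW Wgt)// ltW.
have h2 := le_trans h (lerD (lexx _) (ler_wpM2l k0 D)).
have : 0 <= W ^+ 2 / (s%:R * (s%:R - 1)) *
   (s%:R * (s%:R - 1) / W ^+ 2 * quadf Q v + s%:R / W * (W * C)).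
  by apply: mulr_ge0 => //; rewrite divr_ge0 ?sqr_ge0// mulr_ge0// ltW.
have -> : W ^+ 2 / (s%:R * (s%:R - 1)) *
   (s%:R * (s%:R - 1) / W ^+ 2 * quadf Q v + s%:R / W * (W * C))
   = quadf Q v + C / (s%:R - 1) * W ^+ 2.
  by field; rewrite !gt_eqF.
by lra.
Qed.

End EmpiricalMethod.

(** * Sample mean and covariance as averages around a fixed centre *)

Section SampleMoments.
Context {R : realType} {p n : nat}.
Variables (x : 'I_n -> 'cV[R]_p) (mu : 'cV[R]_p).
Hypothesis n_gt0 : (0 < n)%N.

Let nR0 : n%:R != 0 :> R. Proof. by rewrite pnatr_eq0 -lt0n. Qed.

Lemma dotv_sample_mean u :
  dotv u (sample_mean x - mu) = n%:R^-1 * \sum_i dotv u (x i - mu).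
Proof.
rewrite dotvBr /sample_mean dotvZr dotv_sumr.
rewrite [in RHS](eq_bigr (fun i => dotv u (x i) - dotv u mu)) => [|i _]; last by rewrite dotvBr.
by rewrite sumrB sumr_const card_ord -mulr_natl; field.
Qed.

Lemma sample_cov_sym : symmx (sample_cov x).
Proof.
rewrite /symmx /sample_cov linearZ /=; congr (_ *: _).
by rewrite linear_sum /=; apply: eq_bigr => i _; rewrite trmx_mul trmxK.
Qed.

Lemma dotv_sample_cov_raw u v : dotv u (sample_cov x *m v)
  = n%:R^-1 * \sum_i dotv u (x i - sample_mean x) * dotv v (x i - sample_mean x).
Proof.
rewrite /sample_cov -scalemxAl dotvZr; congr (_ * _).
rewrite mulmx_suml dotv_sumr; apply: eq_bigr => i _.
rewrite -mulmxA; set z := x i - _.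
have -> : z^T *m v = (dotv v z)%:M.
  by rewrite [z^T *m v]mx11_scalar -/(dotv z v) dotvC.
by rewrite mul_mx_scalar dotvZr mulrC.
Qed.

(** Centring at a deterministic [mu] gives an average of i.i.d. terms, to which exponential bounds
    apply. The price is a rank-one correction, carried explicitly from here on. *)
Lemma dotv_sample_cov u v : dotv u (sample_cov x *m v)
  = n%:R^-1 * (\sum_i dotv u (x i - mu) * dotv v (x i - mu))
    - dotv u (sample_mean x - mu) * dotv v (sample_mean x - mu).
Proof.
rewrite dotv_sample_cov_raw.
set m := sample_mean x - mu.
have zE i w : dotv w (x i - sample_mean x) = dotv w (x i - mu) - dotv w m.
  by rewrite -dotvBr /m; congr dotv; rewrite opprB addrA subrK.
rewrite (eq_bigr (fun i => dotv u (x i - mu) * dotv v (x i - mu)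
   - dotv u m * dotv v (x i - mu) - dotv v m * dotv u (x i - mu) + dotv u m * dotv v m)) => [|i _]; last first.
  by rewrite !zE; ring.
rewrite big_split /= !sumrB -!mulr_sumr sumr_const card_ord -mulr_natl.
have su w : \sum_i dotv w (x i - mu) = n%:R * dotv w m.
  by rewrite dotv_sample_mean; field.
by rewrite !su; field.
Qed.

Lemma quadf_sample_cov_ge0 v : 0 <= quadf (sample_cov x) v.
Proof.
rewrite quadfE dotv_sample_cov_raw mulr_ge0 ?invr_ge0// sumr_ge0// => i _.
by rewrite -expr2 sqr_ge0.
Qed.

End SampleMoments.

(** * The smallest eigenvalue; power sums *)

Section SpectralBound.
Context {R : realType} {p : nat}.
Implicit Types (M N : 'M[R]_p) (u v : 'cV[R]_p).

Lemma psdmx_CauchySchwarz N u v : psdmx N ->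
  dotv u (N *m v) ^+ 2 <= quadf N u * quadf N v.
Proof.
move=> [sN N0]; set B := dotv u (N *m v); set A := quadf N v; set D := quadf N u.
have exp k l : quadf N (k *: u + l *: v) = k ^+ 2 * D + 2 * (k * l * B) + l ^+ 2 * A.
  by rewrite quadfD// !quadf_scale -scalemxAr dotvZl dotvZr /A /B /D; ring.
have A0 : 0 <= A := N0 v.
have [A1|A1] := eqVneq A 0; last first.
  have Agt : 0 < A by rewrite lt_neqAle eq_sym A1.
  have := N0 (A *: u + (- B) *: v); rewrite exp.
  have -> : A ^+ 2 * D + 2 * (A * - B * B) + (- B) ^+ 2 * A = A * (D * A - B ^+ 2) by ring.
  by rewrite pmulr_rge0// subr_ge0.
have [->|B0] := eqVneq B 0; first by rewrite expr0n A1 mulr0.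
(* With [A = 0] the form is affine in the multiple of [v]; this multiple brings it down to [-1]. *)
have := N0 (1 *: u + (- (D + 1) / (2 * B)) *: v); rewrite exp A1.
have -> : 1 ^+ 2 * D + 2 * (1 * (- (D + 1) / (2 * B)) * B) + (- (D + 1) / (2 * B)) ^+ 2 * 0 = - 1.
  by field.
by rewrite ler0N1.
Qed.

Lemma psd1mx : psdmx (1%:M : 'M[R]_p).
Proof.
split; first by rewrite /symmx trmx1.
by move=> u; rewrite quadfE mul1mx dotv_ge0.
Qed.

Lemma dotv_CauchySchwarz u v : dotv u v ^+ 2 <= dotv u u * dotv v v.
Proof. by have := psdmx_CauchySchwarz u v psd1mx; rewrite !quadfE !mul1mx. Qed.

Lemma pdmx_psdmx M : pdmx M -> psdmx M.
Proof.
move=> [sM M0]; split=> // u; have [->|/M0/ltW//] := eqVneq u 0.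
by rewrite quadf0.
Qed.

Lemma pdmx_unitmx M : pdmx M -> M \in unitmx.
Proof.
move=> [sM M0]; rewrite -row_free_unit -kermx_eq0; apply/eqP/row_matrixP => i.
rewrite row0; apply/eqP; apply: contraT => k0.
have /M0 : (row i (kermx M))^T != 0 by rewrite -(inj_eq trmx_inj) trmxK trmx0.
by rewrite /quadf trmxK -row_mul mulmx_ker row0 mul0mx mxE ltxx.
Qed.

Lemma dotv_mulmx_bound M u : dotv u (M *m u) <= (\sum_i \sum_j `|M i j|) * dotv u u.
Proof.
rewrite dotvE mulr_suml; apply: ler_sum => i _.
rewrite mxE mulr_sumr mulr_suml; apply: ler_sum => j _.
have coord k : u k 0 ^+ 2 <= dotv u u.
  rewrite dotvE (bigD1 k)//= expr2 lerDl sumr_ge0// => l _.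
  by rewrite -expr2 sqr_ge0.
apply: le_trans (ler_norm _) _; rewrite normrM mulrC normrM -mulrA.
apply: ler_wpM2l => //.
have := sqr_ge0 (`|u i 0| - `|u j 0|).
have := coord i; have := coord j.
rewrite -(real_normK (num_real (u i 0))) -(real_normK (num_real (u j 0))).
by nra.
Qed.

(** Cauchy-Schwarz for [N] at [u] and [N^-1 u] reads [(u . u)^2 <= N(u) (u . N^-1 u)], and the last
    factor is at most [K (u . u)] with [K] the entrywise sum of the inverse; the added [1] makes [K]
    positive. *)
Lemma psdmx_unit_coercive N : psdmx N -> N \in unitmx ->
  exists2 e : R, 0 < e & forall u, e * dotv u u <= quadf N u.
Proof.
move=> psdN uN; pose K := 1 + \sum_i \sum_j `|invmx N i j|.
have K0 : 0 < K by rewrite ltr_pwDl// sumr_ge0// => i _; exact: sumr_ge0.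
exists K^-1; first by rewrite invr_gt0.
move=> u; rewrite ler_pdivrMl//.
have [->|u0] := eqVneq u 0; first by rewrite quadf0 dotv0l mulr0.
have uu : 0 < dotv u u by rewrite lt_neqAle dotv_ge0 eq_sym dotv_eq0 u0.
have := psdmx_CauchySchwarz u (invmx N *m u) psdN.
rewrite mulKVmx// [quadf N (_ *m _)]quadfE mulKVmx// [dotv (_ *m _) _]dotvC => h.
have h2 : dotv u (invmx N *m u) <= K * dotv u u.
  apply: le_trans (dotv_mulmx_bound _ _) _.
  by rewrite ler_wpM2r ?dotv_ge0// lerDr.
have qN : 0 <= quadf N u by case: psdN.
have := le_trans h (ler_wpM2l qN h2).
by rewrite mulrA expr2 ler_pM2r// mulrC.
Qed.

(* The largest [m] with [M - m I] positive semidefinite is an eigenvalue,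
   since otherwise [M - m I] would be coercive and [m] could be increased. *)
Lemma lambda_min_le_quadf M u : (0 < p)%N -> pdmx M ->
  lambda_min M * dotv u u <= quadf M u.
Proof.
move=> p0 pdM; have [sM M0] := pdM.
pose A := [set m : R | forall v, m * dotv v v <= quadf M v].
have quadB m v : quadf (M - m%:M) v = quadf M v - m * dotv v v.
  by rewrite !quadfE mulmxBl mul_scalar_mx dotvBr dotvZr.
have A0 : A 0 by move=> v; rewrite mul0r; case: (pdmx_psdmx pdM).
have A_ub : has_ubound A.
  exists (M (Ordinal p0) (Ordinal p0)) => m /(_ (delta_mx (Ordinal p0) 0)).
  by rewrite quadf_delta dotv_delta mxE !eqxx mulr1.
have supA : has_sup A by split; [exists 0 | exact: A_ub].
set m0 := sup A.
have Am0 : A m0.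
  move=> v; have [->|v0] := eqVneq v 0; first by rewrite quadf0 dotv0l mulr0.
  have vv : 0 < dotv v v by rewrite lt_neqAle dotv_ge0 eq_sym dotv_eq0 v0.
  rewrite -ler_pdivlMr//; apply: ge_sup; first by exists 0.
  by move=> m Am; rewrite ler_pdivlMr.
have psdN : psdmx (M - m0%:M).
  split; last by move=> v; rewrite quadB subr_ge0.
  by rewrite /symmx linearB /= tr_scalar_mx sM.
have eig : eigenvalue M m0.
  rewrite /eigenvalue /eigenspace kermx_eq0 row_free_unit; apply/negP => uN.
  have [e e0 he] := psdmx_unit_coercive psdN uN.
  have : m0 + e <= m0.
    apply: ub_le_sup => // v; have := he v; rewrite quadB; lra.
  by rewrite gerDl leNgt e0.
apply: le_trans (Am0 u); apply: ler_wpM2r; first exact: dotv_ge0.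
(* [inf] is a lower bound only for sets that have one; positive definiteness provides [0]. *)
apply: ge_inf => //; exists 0 => l /eigenvalueP [v vM v0].
have v0' : v^T != 0 by rewrite -(inj_eq trmx_inj) trmxK trmx0.
have := M0 _ v0'; rewrite /quadf trmxK vM -scalemxAl mxE.
have vv : 0 < dotv v^T v^T by rewrite lt_neqAle dotv_ge0 eq_sym dotv_eq0 v0'.
have -> : (v *m v^T) 0 0 = dotv v^T v^T by rewrite /dotv trmxK.
by rewrite pmulr_lgt0// => /ltW.
Qed.

End SpectralBound.

(** * Comparison of power sums *)

Section PowerSums.
Context {R : realType}.

(** Concavity of the power. With [l = ln x], both [x] and [1] factor through [x^t], with cofactors
    [exp ((1 - t) l)] and [exp (- t l)]; the linear parts of these exponentials cancel under the
    weights [t] and [1 - t]. *)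
Lemma powR_le_tangent (x t : R) : 0 <= x -> 0 < t -> t <= 1 -> x `^ t <= 1 + t * (x - 1).
Proof.
move=> x0 t0 t1; have [->|xn] := eqVneq x 0.
  by rewrite powR0 ?gt_eqF//; lra.
have xgt : 0 < x by rewrite lt_neqAle eq_sym xn.
rewrite /powR (negbTE xn); set l := ln x.
have xE : x = expR (t * l) * expR ((1 - t) * l).
  by rewrite -expRD -mulrDl addrC subrK mul1r lnK.
have oE : 1 = expR (t * l) * expR (- (t * l)) by rewrite expRxMexpNx_1.
have h1 := expR_ge1Dx ((1 - t) * l); have h2 := expR_ge1Dx (- (t * l)).
have g0 := expR_ge0 (t * l).
have k1 : t * (1 + (1 - t) * l) <= t * expR ((1 - t) * l) by apply: ler_wpM2l => //; exact: ltW.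
have k2 : (1 - t) * (1 - t * l) <= (1 - t) * expR (- (t * l)) by apply: ler_wpM2l => //; lra.
have k3 : 1 <= t * expR ((1 - t) * l) + (1 - t) * expR (- (t * l)) by lra.
have := ler_wpM2l g0 k3; rewrite mulr1 mulrDr.
rewrite [expR (t * l) * (t * _)]mulrCA -xE [expR (t * l) * ((1 - t) * _)]mulrCA -oE.
by lra.
Qed.

Variables (p : nat) (q : R) (a : 'I_p -> R).
Hypothesis (q_gt0 : 0 < q) (q_le1 : q <= 1).

(** [|a_i| = |a_i|^q |a_i|^(1-q)], and no [|a_i|^q] exceeds the whole sum [s]. *)
Lemma sum_norm_le_powR : \sum_i `|a i| <= (\sum_i `|a i| `^ q) `^ q^-1.
Proof.
set s := \sum_i `|a i| `^ q.
have s0 : 0 <= s by apply: sumr_ge0 => i _; exact: powR_ge0.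
have ai_s i : `|a i| `^ q <= s.
  by rewrite /s (bigD1 i)//= lerDl sumr_ge0// => j _; exact: powR_ge0.
have [sz|sz] := eqVneq s 0.
  rewrite big1 ?powR_ge0// => i _; apply/eqP; rewrite normr_eq0 -normr_eq0.
  have : `|a i| `^ q = 0 by apply/eqP; rewrite eq_le powR_ge0 -sz ai_s.
  by move/powR_eq0_eq0 => ->.
have aiE i : `|a i| <= `|a i| `^ q * s `^ (q^-1 - 1).
  have [->|a0] := eqVneq (a i) 0; first by rewrite normr0 mulr_ge0 ?powR_ge0.
  have ap : 0 < `|a i| by rewrite normr_gt0.
  rewrite -[leLHS](powRr1 (normr_ge0 _)) -{1}(subrK q 1) addrC powRD; last first.
    by apply/implyP => _; rewrite gt_eqF.
  apply: ler_wpM2l; first exact: powR_ge0.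
  have -> : 1 - q = q * (q^-1 - 1) by rewrite mulrBr mulfV ?gt_eqF// mulr1.
  rewrite powRrM; apply: ge0_ler_powR; rewrite ?nnegrE ?powR_ge0//.
  by rewrite subr_ge0 invf_ge1.
apply: le_trans (ler_sum _ (fun i _ => aiE i)) _.
rewrite -mulr_suml -/s -[X in X * _](powRr1 s0) -powRD ?sz ?implybT//.
by rewrite addrC subrK.
Qed.

(** Jensen for the power [q / 2], in tangent form at [m = B / p], which bounds the mean of the
    squares. This is the origin of the factor [p^(1 - q/2)] in [R_tilde]. *)
Lemma sum_powR_le_sq (B : R) : (0 < p)%N -> \sum_i a i ^+ 2 <= B ->
  \sum_i `|a i| `^ q <= p%:R `^ (1 - q / 2) * B `^ (q / 2).
Proof.
move=> p0 aB; have pR : 0 < p%:R :> R by rewrite ltr0n.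
have B0 : 0 <= B by apply: le_trans aB; apply: sumr_ge0 => i _; exact: sqr_ge0.
have q2 : 0 < q / 2 by rewrite divr_gt0.
have aE i : `|a i| `^ q = (a i ^+ 2) `^ (q / 2).
  rewrite -(real_normK (num_real (a i))) -powR_mulrn// -powRrM.
  by congr (_ `^ _); field.
have [Bz|Bn] := eqVneq B 0.
  rewrite big1 ?mulr_ge0 ?powR_ge0// => i _; rewrite aE.
  have : a i ^+ 2 = 0.
    apply/eqP; rewrite eq_le sqr_ge0 andbT -Bz; apply: le_trans aB.
    by rewrite (bigD1 i)//= lerDl sumr_ge0// => j _; exact: sqr_ge0.
  by move=> ->; rewrite powR0// gt_eqF.
have Bgt : 0 < B by rewrite lt_neqAle eq_sym Bn.
pose m := B / p%:R; have m0 : 0 < m by rewrite divr_gt0.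
have aiE i : `|a i| `^ q <= m `^ (q / 2) * (1 + q / 2 * (a i ^+ 2 / m - 1)).
  have am : 0 <= a i ^+ 2 / m by rewrite divr_ge0 ?sqr_ge0// ltW.
  rewrite aE; have {1}-> : a i ^+ 2 = m * (a i ^+ 2 / m) by field; rewrite gt_eqF.
  rewrite powRM ?(ltW m0)//; apply: ler_wpM2l; first exact: powR_ge0.
  by apply: powR_le_tangent => //; have := q_le1; lra.
apply: le_trans (ler_sum _ (fun i _ => aiE i)) _.
rewrite -mulr_sumr big_split /= -mulr_sumr sumrB -mulr_suml !sumr_const card_ord.
have -> : p%:R `^ (1 - q / 2) * B `^ (q / 2) = m `^ (q / 2) * p%:R.
  rewrite /m powRM ?invr_ge0 ?ltW// powRB; last by apply/implyP => _; rewrite gt_eqF.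
  have -> : p%:R^-1 `^ (q / 2) = (p%:R `^ (q / 2))^-1 :> R.
    by rewrite -powR_inv1// -powRrM mulN1r powRN.
  by rewrite powRr1//; ring.
apply: ler_wpM2l; first exact: powR_ge0.
rewrite gerDl mulr_ge0_le0 ?(ltW q2)//.
suff : (\sum_i a i ^+ 2) / m <= p%:R by lra.
by rewrite ler_pdivrMr// /m mulrC divfK ?gt_eqF.
Qed.

End PowerSums.

(** * Parameter space and deterministic lasso bounds *)

Section ParameterSpace.
Context {R : realType} {p : nat}.
Variables (q cL cU r t : R) (mu : 'cV[R]_p) (Sigma : 'M[R]_p).
Hypothesis (p_gt0 : (0 < p)%N) (q_gt0 : 0 < q) (q_le1 : q <= 1) (cL_gt0 : 0 < cL).
Hypothesis par : param_space q cL cU r t mu Sigma.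

Let alpha := invmx Sigma *m mu.

Lemma param_pd : pdmx Sigma. Proof. by case: par. Qed.

Lemma param_mulmx : Sigma *m alpha = mu.
Proof. by rewrite /alpha mulKVmx//; exact: pdmx_unitmx param_pd. Qed.

Lemma param_theta : quadf (invmx Sigma) mu = quadf Sigma alpha.
Proof. by rewrite !quadfE param_mulmx dotvC. Qed.

Lemma param_coercive v : cL * dotv v v <= quadf Sigma v.
Proof.
apply: le_trans (lambda_min_le_quadf v p_gt0 param_pd).
by apply: ler_wpM2r; [exact: dotv_ge0|case: par => _ _ _ /andP[]].
Qed.

Lemma param_diag j : Sigma j j <= cU.
Proof.
case: par => _ _ _ _; apply: le_trans.
exact: (le_bigmax_cond _ (fun i => Sigma i i)).
Qed.

(** The first term of [tau_tilde]: by Cauchy-Schwarz all entries of [Sigma] are at most [cU], so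
    [alpha . Sigma alpha <= cU |alpha|_1^2], and [|alpha|_1 <= r^(1/q)]. *)
Lemma param_theta_le : quadf Sigma alpha <= tau_tilde q cU r t.
Proof.
have [pd hr ht _ _] := par.
rewrite /tau_tilde le_min -{2}param_theta ht andbT.
have psd := pdmx_psdmx pd.
have diag0 j : 0 <= Sigma j j by rewrite -quadf_delta; case: psd.
have cU0 : 0 <= cU by apply: le_trans (diag0 (Ordinal p_gt0)) (param_diag _).
have entry i j : `|Sigma i j| <= cU.
  rewrite -(ler_pXn2r (_ : 0 < 2)%N) ?nnegrE// real_normK ?num_real//.
  have := psdmx_CauchySchwarz (delta_mx i 0) (delta_mx j 0) psd.
  rewrite !quadf_delta dotv_delta -colE mxE => /le_trans; apply.
  by rewrite expr2 ler_pM// param_diag.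
have l1 : \sum_i `|alpha i 0| <= r `^ q^-1.
  apply: le_trans (sum_norm_le_powR (fun i => alpha i 0) q_gt0 q_le1) _.
  move: hr; rewrite lnorm_powR// -/alpha => hr.
  have r0 : 0 <= r by apply: le_trans hr; apply: sumr_ge0 => i _; exact: powR_ge0.
  apply: ge0_ler_powR; rewrite ?nnegrE ?invr_ge0 ?(ltW q_gt0)//.
  by apply: sumr_ge0 => i _; exact: powR_ge0.
apply: (@le_trans _ _ (cU * (\sum_i `|alpha i 0|) ^+ 2)); last first.
  apply: ler_wpM2l => //.
  have -> : r `^ (2 / q) = (r `^ q^-1) ^+ 2.
    by rewrite -powR_mulrn ?powR_ge0// -powRrM mulrC.
  by rewrite ler_pXn2r ?nnegrE ?powR_ge0// sumr_ge0.
rewrite quadfE dotvE expr2 mulrA mulr_sumr; apply: ler_sum => i _.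
have -> : (Sigma *m alpha) i 0 = \sum_j Sigma i j * alpha j 0 by rewrite [LHS]mxE.
rewrite [leLHS]mulr_sumr mulr_sumr mulr_suml; apply: ler_sum => j _.
apply: le_trans (ler_norm _) _; rewrite !normrM mulrCA mulrAC -!mulrA.
by apply: ler_wpM2r => //; rewrite mulr_ge0.
Qed.

(** The first term of [R_tilde]: coercivity turns the bound on [theta] into [|alpha|_2^2 <= t / cL],
    which the power mean inequality converts into a bound on the [q]-sum. *)
Lemma param_sum_powR_le : \sum_i `|alpha i 0| `^ q <= R_tilde q cL r t p.
Proof.
have [pd hr ht _ _] := par.
rewrite /R_tilde le_min -lnorm_powR// hr andbT lnorm_powR//.
have t0 : 0 <= t.
  by apply: le_trans ht; rewrite param_theta; case: (pdmx_psdmx pd).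
have hB : \sum_i alpha i 0 ^+ 2 <= cL^-1 * t.
  rewrite ler_pdivlMl//.
  have -> : \sum_i alpha i 0 ^+ 2 = dotv alpha alpha.
    by rewrite dotvE; apply: eq_bigr => i _; rewrite expr2.
  by apply: le_trans (param_coercive _) _; rewrite -param_theta.
apply: le_trans (sum_powR_le_sq q_gt0 q_le1 p_gt0 hB) _.
rewrite powRM ?invr_ge0 ?(ltW cL_gt0)// mulrA.
by rewrite -[cL^-1]powR_inv1 ?(ltW cL_gt0)// -powRrM mulN1r.
Qed.

(** [mu_j] is the [Sigma]-product of the basis vector [j] with [alpha]; Cauchy-Schwarz for
    [Sigma]. *)
Lemma param_mu_sq_le j : mu j 0 ^+ 2 <= cU * tau_tilde q cU r t.
Proof.
have psd := pdmx_psdmx param_pd.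
have := psdmx_CauchySchwarz (delta_mx j 0) alpha psd.
rewrite param_mulmx dotv_delta quadf_delta => /le_trans; apply.
apply: ler_pM; rewrite ?param_diag ?param_theta_le//.
  by rewrite -quadf_delta; case: psd.
by case: psd.
Qed.

End ParameterSpace.

(** * Comparison inequalities for the minimiser *)

Section LassoBasic.
Context {R : realType} {p n : nat}.
Variables (lam gam : R) (x : 'I_n -> 'cV[R]_p) (a b : 'cV[R]_p).
Hypothesis n_gt0 : (0 < n)%N.
Hypothesis (gam_ge0 : 0 <= gam) (lam_ge0 : 0 <= lam).
Hypothesis a_min : lasso_argmin lam gam x a.

(** The objective at [a] equals [- theta_est / 2 + lam |a|_1], and it is at most its value [0] at
    the origin. *)
Lemma theta_est_ge0 : 0 <= theta_est x a.
Proof.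
case: a_min => _ /(_ 0); rewrite !lnorm2E dotv0l sqrtr0 => /(_ gam_ge0).
rewrite /lasso_obj quadf0 dotv0l mulr0 subr0 add0r.
have -> : lnorm 1 (0 : 'cV[R]_p) = 0.
  by rewrite lnorm1E big1// => i _; rewrite mxE normr0.
rewrite mulr0 /theta_est [dotv (sample_mean x) a]dotvC => h.
by have := mulr_ge0 lam_ge0 (lnorm_ge0 1 a); lra.
Qed.

Lemma theta_est_le : theta_est x a <= 2 * dotv (sample_mean x) a.
Proof. by rewrite /theta_est gerBl quadf_sample_cov_ge0. Qed.

(** Comparison with the origin, with the nonnegative quadratic term dropped, leaves
    [(lam - M) |a|_1 <= 0]. *)
Lemma lasso_eq0 M : 0 < lam ->
  (forall j, `|sample_mean x j 0| <= M) -> M < lam -> a = 0.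
Proof.
move=> lam0 hM Mlam.
have h0 := theta_est_ge0.
case: a_min => _ /(_ 0); rewrite !lnorm2E dotv0l sqrtr0 => /(_ gam_ge0).
rewrite /lasso_obj quadf0 dotv0l mulr0 subr0 add0r.
have -> : lnorm 1 (0 : 'cV[R]_p) = 0.
  by rewrite lnorm1E big1// => i _; rewrite mxE normr0.
rewrite mulr0 => h.
have q0 := @quadf_sample_cov_ge0 _ _ _ x a.
have : dotv a (sample_mean x) <= M * lnorm 1 a.
  rewrite dotvE lnorm1E mulr_sumr; apply: ler_sum => j _.
  by apply: le_trans (ler_norm _) _; rewrite normrM mulrC ler_wpM2r.
move=> h2.
have n0 : lnorm 1 a <= 0.
  have : (lam - M) * lnorm 1 a <= 0 by lra.
  by rewrite pmulr_rle0// subr_gt0.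
apply/matrixP => i j; rewrite ord1 mxE; apply/eqP; rewrite -normr_le0.
by apply: le_trans n0; rewrite lnorm1E (bigD1 i)//= lerDl sumr_ge0.
Qed.

(** Comparison with [b], doubled. The vector [sample_mean - sample_cov b] is minus the gradient of
    the smooth part at [b]; at [b = alpha] it is pure noise because [Sigma alpha = mu]. *)
Lemma lasso_basic : lnorm 2 b <= gam ->
  quadf (sample_cov x) (a - b)
    <= 2 * dotv (sample_mean x - sample_cov x *m b) (a - b)
       + 2 * lam * (lnorm 1 b - lnorm 1 a).
Proof.
case: a_min => _ /[apply]; rewrite /lasso_obj.
have sS := @sample_cov_sym _ _ _ x.
have aE : quadf (sample_cov x) a = quadf (sample_cov x) b
    + 2 * dotv (a - b) (sample_cov x *m b) + quadf (sample_cov x) (a - b).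
  have abE : a = b + (a - b) by rewrite addrC subrK.
  by rewrite {1}abE quadfD// [dotv b _]dotv_mulmx sS [dotv (_ *m b) _]dotvC.
rewrite aE [dotv (_ - _) (a - b)]dotvC !dotvBr !dotvBl; lra.
Qed.

(** The exact second-order expansion at [b]. Both terms already occur in the basic inequality, so
    the bound on the quadratic error also bounds this difference. *)
Lemma theta_est_sub : theta_est x a - theta_est x b
  = 2 * dotv (sample_mean x - sample_cov x *m b) (a - b)
    - quadf (sample_cov x) (a - b).
Proof.
have sS := @sample_cov_sym _ _ _ x.
have aE : quadf (sample_cov x) a = quadf (sample_cov x) b
    + 2 * dotv (a - b) (sample_cov x *m b) + quadf (sample_cov x) (a - b).
  have abE : a = b + (a - b) by rewrite addrC subrK.
  by rewrite {1}abE quadfD// [dotv b _]dotv_mulmx sS [dotv (_ *m b) _]dotvC.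
rewrite /theta_est aE [dotv (_ - _) (a - b)]dotvC !dotvBr !dotvBl.
by rewrite [dotv (sample_mean x) a]dotvC [dotv (sample_mean x) b]dotvC; ring.
Qed.

End LassoBasic.

(** * Splitting a weakly sparse vector at a threshold *)

Section WeakSparsity.
Context {R : realType} {p : nat}.
Variables (q rho eta : R) (b D : 'cV[R]_p).
Hypothesis (q_gt0 : 0 < q) (q_le1 : q <= 1) (eta_gt0 : 0 < eta).
Hypothesis b_weak : \sum_i `|b i 0| `^ q <= rho.

(** These coordinates replace the support of an exactly sparse vector; the light part of [b] becomes
    an approximation error. With [eta] of the order of the noise level both contributions
    balance. *)
Definition heavy (i : 'I_p) : bool := eta < `|b i 0|.

Lemma card_heavy_le : #|heavy|%:R * eta `^ q <= rho.
Proof.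
apply: le_trans b_weak; rewrite (bigID heavy) /=.
have -> : #|heavy|%:R * eta `^ q = \sum_(i | heavy i) eta `^ q.
  by rewrite sumr_const mulr_natl.
rewrite -[leLHS]addr0 lerD//; last by apply: sumr_ge0 => i _; exact: powR_ge0.
apply: ler_sum => i hi; apply: ge0_ler_powR; rewrite ?nnegrE ?(ltW q_gt0) ?(ltW eta_gt0)//.
exact: ltW.
Qed.

Lemma sum_light_le : \sum_(i | ~~ heavy i) `|b i 0| <= rho * eta `^ (1 - q).
Proof.
have rE : \sum_(i | ~~ heavy i) `|b i 0| `^ q <= rho.
  apply: le_trans b_weak; rewrite [leRHS](bigID heavy) /= lerDr.
  by apply: sumr_ge0 => i _; exact: powR_ge0.
apply: le_trans (ler_wpM2r (powR_ge0 _ _) rE).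
rewrite mulr_suml; apply: ler_sum => i; rewrite /heavy -leNgt => bi.
have [->|b0] := eqVneq (b i 0) 0; first by rewrite normr0 mulr_ge0 ?powR_ge0.
have bp : 0 < `|b i 0| by rewrite normr_gt0.
rewrite -[leLHS](powRr1 (normr_ge0 _)) -{1}(subrK q 1) addrC powRD; last first.
  by apply/implyP => _; rewrite gt_eqF.
apply: ler_wpM2l; first exact: powR_ge0.
by apply: ge0_ler_powR; rewrite ?nnegrE ?subr_ge0// ltW.
Qed.

Lemma sum_heavy_sq_le :
  (\sum_(i | heavy i) `|D i 0|) ^+ 2 <= #|heavy|%:R * dotv D D.
Proof.
pose u : 'cV[R]_p := \col_i (heavy i)%:R.
pose v : 'cV[R]_p := \col_i `|D i 0|.
have -> : \sum_(i | heavy i) `|D i 0| = dotv u v.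
  rewrite dotvE big_mkcond; apply: eq_bigr => i _; rewrite !mxE.
  by case: (heavy i); rewrite ?mul1r ?mul0r.
have -> : #|heavy|%:R = dotv u u.
  rewrite dotvE -sum1_card natr_sum big_mkcond; apply: eq_bigr => i _; rewrite !mxE.
  by rewrite unfold_in -/(heavy i); case: (heavy i); rewrite /= ?mulr1 ?mulr0.
have -> : dotv D D = dotv v v.
  rewrite !dotvE; apply: eq_bigr => i _; rewrite !mxE.
  by rewrite -!expr2 real_normK ?num_real.
exact: dotv_CauchySchwarz.
Qed.

Lemma lnorm1_sub_le :
  lnorm 1 b - lnorm 1 (b + D) <= \sum_(i | heavy i) `|D i 0|
    - \sum_(i | ~~ heavy i) `|D i 0| + 2 * \sum_(i | ~~ heavy i) `|b i 0|.
Proof.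
rewrite !lnorm1E (bigID heavy) /= [\sum_i `|(b + D) i 0|](bigID heavy) /=.
have h1 : \sum_(i | heavy i) `|b i 0|
    <= \sum_(i | heavy i) `|(b + D) i 0| + \sum_(i | heavy i) `|D i 0|.
  rewrite -big_split; apply: ler_sum => i _ /=; rewrite mxE.
  by have := ler_normB (b i 0 + D i 0) (D i 0); rewrite addrK.
have h2 : \sum_(i | ~~ heavy i) `|D i 0|
    <= \sum_(i | ~~ heavy i) `|(b + D) i 0| + \sum_(i | ~~ heavy i) `|b i 0|.
  rewrite -big_split; apply: ler_sum => i _ /=; rewrite mxE.
  by have := ler_normB (b i 0 + D i 0) (b i 0); rewrite addrAC subrr add0r.
by lra.
Qed.

End WeakSparsity.

(** * Error bound under noise and curvature conditions *)

Section LassoRate.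
Context {R : realType}.
Variables (kap K : R).

Definition lasso_sq_const : R := 2 / kap * (9 * K ^+ 2 / kap + 4 * K + kap / 4).
Definition lasso_val_const : R := 21 * K ^+ 2 / kap + kap * lasso_sq_const + 8 * K.

(** Here [d] is the squared error, [Q] its empirical form, [hS] and [hL] its l1 mass on heavy and
    light coordinates, [bl] the light mass of [b], and [X] a bound on the number of heavy
    coordinates. Noise below [lam / 2] gives the cone condition [hL <= 3 hS + 4 bl]; the smallness
    of [Gam X] then lets [kap d] absorb the l1 loss. *)
Lemma lasso_arith (Gam X eta lam hS hL bl dot Q lb la d : R) :
  0 < kap -> 0 <= Gam -> 0 < eta -> 0 < X -> 0 < lam -> lam <= K * eta ->
  0 <= hS -> 0 <= hL -> 0 <= bl -> 0 <= Q -> 0 <= d ->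
  bl <= X * eta -> hS ^+ 2 <= X * d ->
  `|dot| <= lam / 2 * (hS + hL) ->
  Q <= 2 * dot + 2 * lam * (lb - la) ->
  lb - la <= hS - hL + 2 * bl ->
  kap * d - Gam * (hS + hL) ^+ 2 <= Q ->
  32 * Gam * X <= kap / 4 ->
  d <= lasso_sq_const * (X * eta ^+ 2) /\
  `|2 * dot - Q| <= lasso_val_const * (X * eta ^+ 2).
Proof.
move=> kap0 Gam0 eta0 X0 lam0 lamK hS0 hL0 bl0 Q0 d0 bl_le hS2 dot_le basic l1 re small.
set r0 := X * eta ^+ 2.
have dotN : dot <= lam / 2 * (hS + hL) by apply: le_trans (ler_norm _) dot_le.
have Q_le : Q <= lam * (3 * hS - hL + 4 * bl).
  have l1' := ler_wpM2l (ltW lam0) l1.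
  by clear - basic dotN l1'; lra.
have hL_le : hL <= 3 * hS + 4 * bl.
  have : 0 <= lam * (3 * hS - hL + 4 * bl) by apply: le_trans Q_le.
  by rewrite pmulr_rge0// => h; clear - h; lra.
have lhL : 0 <= lam * hL by rewrite mulr_ge0// ltW.
have r00 : 0 < r0 by rewrite mulr_gt0// exprn_gt0.
have K0 : 0 <= K by rewrite -(pmulr_lge0 _ eta0); apply: le_trans lamK; exact: ltW.
have lam2X : lam ^+ 2 * X <= K ^+ 2 * r0.
  have : lam ^+ 2 <= (K * eta) ^+ 2.
    by rewrite ler_pXn2r ?nnegrE ?(ltW lam0)// mulr_ge0// ltW.
  move/(ler_wpM2r (ltW X0)) => /le_trans; apply.
  by rewrite /r0 le_eqVlt; apply/orP; left; apply/eqP; ring.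
have lbl : lam * bl <= K * r0.
  apply: le_trans (ler_pM (ltW lam0) bl0 lamK bl_le) _.
  by rewrite /r0 le_eqVlt; apply/orP; left; apply/eqP; ring.
(* AM-GM: [12 x h <= 36 x^2 + h^2] with [x = lam X], [h = kap hS] *)
have lhS : lam * hS <= 3 * K ^+ 2 / kap * r0 + kap * d / 12.
  have sq : 0 <= (6 * lam * X - kap * hS) ^+ 2 by exact: sqr_ge0.
  have hh : (kap * hS) ^+ 2 <= kap ^+ 2 * (X * d).
    by rewrite exprMn ler_wpM2l// sqr_ge0.
  have : 12 * X * (kap * (lam * hS)) <= 12 * X * (3 * (lam ^+ 2 * X) + kap ^+ 2 * d / 12).
    by clear - sq hh; lra.
  rewrite ler_pM2l ?mulr_gt0// => h3.
  have : kap * (lam * hS) <= kap * (3 * K ^+ 2 / kap * r0 + kap * d / 12).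
    apply: le_trans h3 _.
    have -> : kap * (3 * K ^+ 2 / kap * r0 + kap * d / 12) = 3 * (K ^+ 2 * r0) + kap ^+ 2 * d / 12.
      by field; rewrite gt_eqF.
    by rewrite lerD2r ler_wpM2l.
  by rewrite ler_pM2l.
have GN : Gam * (hS + hL) ^+ 2 <= kap / 4 * d + kap / 4 * r0.
  (* The cone condition and [(4 x + 4 y)^2 <= 32 x^2 + 32 y^2]: the source of the factor [32] in the
     smallness hypothesis. *)
  have N2 : (hS + hL) ^+ 2 <= 32 * (X * d) + 32 * bl ^+ 2.
    have : (hS + hL) ^+ 2 <= (4 * hS + 4 * bl) ^+ 2.
      by rewrite ler_pXn2r ?nnegrE ?addr_ge0 ?mulr_ge0//; clear - hL_le; lra.
    move=> /le_trans; apply.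
    have h := sqr_ge0 (hS - bl).
    by clear - h hS2; lra.
  apply: le_trans (ler_wpM2l Gam0 N2) _.
  have bl2 : bl ^+ 2 <= (X * eta) ^+ 2.
    by rewrite ler_pXn2r ?nnegrE// mulr_ge0// ltW.
  have s1 := ler_wpM2r d0 small.
  have s2 := ler_wpM2r (ltW r00) small.
  have s3 := ler_wpM2l Gam0 bl2.
  have E : (X * eta) ^+ 2 = X * r0 by rewrite /r0; ring.
  by rewrite E in s3; clear - s1 s2 s3; lra.
(* A quarter of [kap d] is lost to the l1 term and another quarter to [3 lam hS]; the remaining half
   gives the factor [2 / kap] of the constant. *)
have dle : d <= lasso_sq_const * r0.
  have -> : lasso_sq_const * r0 = 2 / kap * (9 * K ^+ 2 / kap * r0 + 4 * (K * r0) + kap / 4 * r0).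
    by rewrite /lasso_sq_const; ring.
  have -> : d = 2 / kap * (kap / 2 * d) by field; rewrite gt_eqF.
  apply: ler_wpM2l; first by rewrite divr_ge0// ltW.
  have E : 9 * K ^+ 2 / kap * r0 = 3 * (3 * K ^+ 2 / kap * r0) by ring.
  by rewrite E; clear - re GN Q_le lhS lbl lhL; lra.
split => //.
apply: le_trans (ler_normB _ _) _.
rewrite normrM (ger0_norm Q0) ger0_norm//.
have kd : kap * d <= kap * (lasso_sq_const * r0) by apply: ler_wpM2l => //; exact: ltW.
have kd0 : 0 <= kap * d by rewrite mulr_ge0// ltW.
have -> : lasso_val_const * r0
    = 7 * (3 * K ^+ 2 / kap * r0) + kap * (lasso_sq_const * r0) + 8 * (K * r0).
  by rewrite /lasso_val_const; ring.
have lhLS : lam * hL <= 3 * (lam * hS) + 4 * (lam * bl).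
  by have := ler_wpM2l (ltW lam0) hL_le; rewrite mulrDr mulrCA [lam * (4 * _)]mulrCA.
by clear - kd kd0 dot_le Q_le lhS lbl lhL lhLS; lra.
Qed.

Context {p n : nat}.
Variables (q Gam eta rho lam gam : R) (x : 'I_n -> 'cV[R]_p) (a b : 'cV[R]_p).

(** The case [X = rho eta^(-q)]. The last hypothesis is where the vanishing effective sparsity will
    enter. *)
Lemma lasso_rate :
  0 < q -> q <= 1 -> 0 < kap -> 0 <= Gam -> 0 < eta -> 0 < rho -> 0 < lam ->
  lam <= K * eta ->
  \sum_i `|b i 0| `^ q <= rho ->
  lasso_argmin lam gam x a -> lnorm 2 b <= gam ->
  (forall j, `|(sample_mean x - sample_cov x *m b) j 0| <= lam / 2) ->
  (forall v, kap * dotv v v - Gam * lnorm 1 v ^+ 2 <= quadf (sample_cov x) v) ->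
  32 * Gam * (rho * eta `^ (- q)) <= kap / 4 ->
  let r0 := rho * eta `^ (- q) * eta ^+ 2 in
  dotv (a - b) (a - b) <= lasso_sq_const * r0 /\
  `|theta_est x a - theta_est x b| <= lasso_val_const * r0.
Proof.
move=> q0 q1 kap0 Gam0 eta0 rho0 lam0 lamK bw amin bgam noise re small r0.
pose D := a - b; pose e := eta `^ (- q).
have e0 : 0 < e by exact: powR_gt0.
have N_E : lnorm 1 D = \sum_(i | heavy eta b i) `|D i 0| + \sum_(i | ~~ heavy eta b i) `|D i 0|.
  by rewrite lnorm1E (bigID (heavy eta b)).
have k_le : #|heavy eta b|%:R <= rho * e.
  rewrite /e powRN ler_pdivlMr ?powR_gt0//.
  exact: card_heavy_le.
rewrite (theta_est_sub x a b) -/D.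
apply: (lasso_arith (Gam := Gam) (lam := lam)
  (hS := \sum_(i | heavy eta b i) `|D i 0|) (hL := \sum_(i | ~~ heavy eta b i) `|D i 0|)
  (bl := \sum_(i | ~~ heavy eta b i) `|b i 0|) (lb := lnorm 1 b) (la := lnorm 1 a)) => //.
- exact: mulr_gt0.
- exact: sumr_ge0.
- exact: sumr_ge0.
- exact: sumr_ge0.
- exact: quadf_sample_cov_ge0.
- exact: dotv_ge0.
- rewrite -mulrA; have -> : eta `^ (- q) * eta = eta `^ (1 - q).
    rewrite addrC powRD ?powRr1 ?(ltW eta0)//.
    by apply/implyP => _; rewrite gt_eqF.
  exact: sum_light_le.
- by apply: le_trans (sum_heavy_sq_le eta b D) _; apply: ler_wpM2r => //; exact: dotv_ge0.
- rewrite -N_E dotvE lnorm1E mulr_sumr; apply: le_trans (ler_norm_sum _ _ _) _.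
  by apply: ler_sum => j _; rewrite normrM ler_wpM2r.
- exact: lasso_basic amin bgam.
- by have := lnorm1_sub_le eta b D; rewrite /D [b + _]addrC subrK.
- by rewrite -N_E; exact: re.
Qed.

End LassoRate.

(** * Independence and exponential moments *)

Lemma ge0_le_integral_EFin {d} {T : measurableType d} {R : realType}
    (P : {measure set T -> \bar R}) (f g : T -> R) :
  measurable_fun [set: T] f -> measurable_fun [set: T] g ->
  (forall w, 0 <= f w) -> (forall w, f w <= g w) ->
  (\int[P]_w (f w)%:E <= \int[P]_w (g w)%:E)%E.
Proof.
move=> mf mg f0 fg; apply: ge0_le_integral => //.
- by move=> w _; rewrite lee_fin.
- exact/measurable_EFinP.
- exact/measurable_EFinP.
- by move=> w _; rewrite lee_fin.
Qed.

Section IndependentFactor.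
Context {d d'} {T : measurableType d} {V : measurableType d'} {R : realType}.
Variable P : probability T R.
Local Open Scope ereal_scope.

Import HBNNSimple.

(** From indicators to nonnegative functions of [X], by simple functions and monotone convergence.
    [G] stands for the product of all other factors, so this is the inductive step for a product
    over independent variables. *)
Lemma integral_indep_mul (G : T -> R) (X : T -> V) (f : V -> R) :
  measurable_fun [set: T] G -> (forall w, 0 <= G w)%R ->
  \int[P]_w (G w)%:E \is a fin_num ->
  measurable_fun [set: T] X ->
  measurable_fun [set: V] f -> (forall v, 0 <= f v)%R ->
  (forall B, measurable B -> \int[P]_w (G w * \1_B (X w))%:E
     = \int[P]_w (G w)%:E * P (X @^-1` B)) ->
  \int[P]_w (G w * f (X w))%:E = \int[P]_w (G w)%:E * \int[P]_w (f (X w))%:E.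
Proof.
move=> mG G0 finG mX mf f0 GX.
have mfE : measurable_fun [set: V] (fun v => (f v)%:E) by exact/measurable_EFinP.
pose h := nnsfun_approx measurableT mfE.
have hcvg v : EFin \o h^~ v @ \oo --> (f v)%:E.
  by apply: (cvg_nnsfun_approx measurableT mfE) => // x _; rewrite lee_fin.
have hnd v m n : (m <= n)%N -> (h m v <= h n v)%R.
  by move=> mn; exact/lefP/nd_nnsfun_approx.
have mhX n : measurable_fun [set: T] (fun w => h n (X w)).
  exact: measurableT_comp.
have -> : \int[P]_w (f (X w))%:E = limn (fun n => \int[P]_w (h n (X w))%:E).
  rewrite -monotone_convergence//.
  - by apply: eq_integral => w _; apply/esym/cvg_lim => //; exact: hcvg.
  - by move=> n; exact/measurable_EFinP.
  - by move=> n w _; rewrite lee_fin.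
  - by move=> w _ m n mn; rewrite lee_fin hnd.
have -> : \int[P]_w (G w * f (X w))%:E
    = limn (fun n => \int[P]_w (G w * h n (X w))%:E).
  rewrite -monotone_convergence//.
  - apply: eq_integral => w _; apply/esym/cvg_lim => //.
    under eq_fun do rewrite EFinM.
    by rewrite EFinM; apply: cvgeZl => //; exact: hcvg.
  - by move=> n; apply/measurable_EFinP/measurable_funM.
  - by move=> n w _; rewrite lee_fin mulr_ge0.
  - by move=> w _ m n mn; rewrite lee_fin ler_wpM2l// hnd.
rewrite -limeMl//; last first.
  apply: ereal_nondecreasing_is_cvgn => m n mn.
  by apply: ge0_le_integral_EFin => // w; exact: hnd.
congr (limn _); apply/funext => n.
have mI r : measurable_fun [set: T] (fun w => \1_(h n @^-1` [set r]) (X w) : R).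
  by apply: (measurableT_comp _ mX); exact: measurable_indic.
transitivity (\sum_(y \in range (h n)) \int[P]_w (G w * (y * \1_(h n @^-1` [set y]) (X w)))%:E).
  rewrite -ge0_integral_fsum//.
  - apply: eq_integral => w _; rewrite fsumEFin//; congr (_%:E).
    by rewrite (fimfunE (h n) (X w)) mulr_fsumr.
  - by move=> y; apply/measurable_EFinP/measurable_funM => //; exact: measurable_funM.
  - move=> y w _; rewrite lee_fin mulr_ge0//.
    by have := nnfun_muleindic_ge0 (h n) y (X w); rewrite lee_fin.
have -> : \int[P]_w (h n (X w))%:E
   = \sum_(y \in range (h n)) \int[P]_w (y * \1_(h n @^-1` [set y]) (X w))%:E.
  rewrite -ge0_integral_fsum//.
  - by apply: eq_integral => w _; rewrite fsumEFin// -fimfunE.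
  - by move=> y; apply/measurable_EFinP/measurable_funM.
  - by move=> y w _; exact: nnfun_muleindic_ge0.
rewrite ge0_mule_fsumr; last first.
  by move=> y; apply: integral_ge0 => w _; exact: nnfun_muleindic_ge0.
apply: eq_fsbigr => y _.
(* The sum ranges over all [y] in the range of [h n]; negative levels have empty preimages and
   contribute zero, which leaves a nonnegative constant to pull out. *)
have [y0|y0] := leP 0%R y; last first.
  rewrite preimage_nnfun0// indic0.
  under eq_integral do rewrite /= !mulr0.
  rewrite [X in _ = _ * X](eq_integral (cst 0%:E)); last by move=> w _; rewrite /= mulr0.
  by rewrite !integral0 mule0.
under eq_integral do rewrite mulrCA EFinM.
rewrite [X in _ = _ * X](eq_integral (fun w => y%:E * (\1_(h n @^-1` [set y]) (X w))%:E)); last by move=> w _; rewrite EFinM.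
rewrite !ge0_integralZl//.
- rewrite GX; last exact: measurable_sfunP.
  have -> : \int[P]_x (\1_(h n @^-1` [set y]) (X x))%:E = P (X @^-1` (h n @^-1` [set y])).
    transitivity (\int[P]_w (\1_(X @^-1` (h n @^-1` [set y])) w)%:E) => //.
    rewrite integral_indic ?setIT//.
    by rewrite -[X in measurable X]setTI; exact: mX.
  by rewrite muleCA.
- exact/measurable_EFinP.
- exact/measurable_EFinP/measurable_funM.
- by move=> w _; rewrite lee_fin mulr_ge0.
Qed.

End IndependentFactor.

Lemma integral_prod_indep {d d'} {T : measurableType d} {V : measurableType d'}
    {R : realType} (P : probability T R) (n : nat)
    (X : 'I_n -> T -> V) (f : 'I_n -> V -> R) :
  (forall i, measurable_fun [set: T] (X i)) ->
  (forall (J : {set 'I_n}) (B : 'I_n -> set V), (forall i, measurable (B i)) ->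
    P (\bigcap_(i in [set` J]) (X i @^-1` B i))
      = (\prod_(i in J) P (X i @^-1` B i))%E) ->
  (forall i, measurable_fun [set: V] (f i)) ->
  (forall i v, 0 <= f i v) ->
  (forall i, (\int[P]_w (f i (X i w))%:E)%E \is a fin_num) ->
  (\int[P]_w (\prod_i f i (X i w))%:E = \prod_i \int[P]_w (f i (X i w))%:E)%E.
Proof.
move=> mX indX mf f0 ffin.
have mXB i B : measurable B -> measurable (X i @^-1` B).
  by move=> mB; rewrite -[Y in measurable Y]setTI; exact: mX.
(* The indicators of [B] are replaced by the [f i] one index at a time. *)
pose g k (B : 'I_n -> set V) (i : 'I_n) : V -> R :=
  if (i < k)%N then f i else \1_(B i).
have mg k B i : (forall i, measurable (B i)) -> measurable_fun [set: V] (g k B i).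
  by move=> mB; rewrite /g; case: ifP => // _; exact: measurable_indic.
have g0 k B i v : 0 <= g k B i v by rewrite /g; case: ifP.
have iI i B : measurable B -> (\int[P]_w (\1_B (X i w))%:E = P (X i @^-1` B))%E.
  move=> mB; transitivity (\int[P]_w (\1_(X i @^-1` B) w)%:E)%E => //.
  by rewrite integral_indic ?setIT//; exact: mXB.
have gfin k B i : (forall i, measurable (B i)) ->
    (\int[P]_w (g k B i (X i w))%:E)%E \is a fin_num.
  by move=> mB; rewrite /g; case: ifP => // _; rewrite iI// fin_num_measure//; exact: mXB.
suff main k : (k <= n)%N -> forall B, (forall i, measurable (B i)) ->
    (\int[P]_w (\prod_i g k B i (X i w))%:E = \prod_i \int[P]_w (g k B i (X i w))%:E)%E.
  have := main n (leqnn n) (fun=> setT) (fun=> measurableT).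
  rewrite (eq_bigr (fun i => \int[P]_w (f i (X i w))%:E)%E) => [<-|i _].
    by apply: eq_integral => w _; congr _%:E; apply: eq_bigr => i _; rewrite /g ltn_ord.
  by apply: eq_integral => w _; rewrite /g ltn_ord.
elim: k => [_ B mB|k IH kn B mB].
  rewrite (eq_bigr (fun i => P (X i @^-1` B i))) => [|i _]; last by rewrite /g /= iI.
  transitivity (\prod_(i in [set: 'I_n]%SET) P (X i @^-1` B i))%E; last first.
    by apply: eq_bigl => i; rewrite inE.
  rewrite -indX//.
  transitivity (\int[P]_w (\1_(\bigcap_(i in [set` [set: 'I_n]%SET]) (X i @^-1` B i)) w)%:E)%E; last first.
    rewrite integral_indic ?setIT//.
    by apply: fin_bigcap_measurable => // i _; exact: mXB.
  apply: eq_integral => w _; congr _%:E; rewrite indicE.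
  have [/[!inE] wB|/negP wB] := boolP (w \in _).
    rewrite big1// => i _; rewrite /g /= indicE mem_set//.
    by apply: wB => /=; rewrite inE.
  have /existsNP[i /not_implyP[_ wBi]] : ~ (forall i, (fun i => True) i -> (X i w) \in B i).
    by move=> h; apply: wB; rewrite inE => i _ /=; have /[!inE] := h i I.
  by rewrite (bigD1 i)//= /g /= indicE (negbTE (introN idP wBi)) mul0r.
pose i0 := Ordinal kn.
pose G w := \prod_(i | i != i0) g k.+1 B i (X i w).
have mG : measurable_fun [set: T] G.
  rewrite /G.
  under eq_fun do rewrite -big_filter.
  by apply: measurable_prod => i _; apply: (measurableT_comp _ (mX i)); exact: mg.
have G0 w : 0 <= G w by apply: prodr_ge0 => i _; exact: g0.
pose m := (\prod_(i | i != i0) \int[P]_w (g k.+1 B i (X i w))%:E)%E.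
have mfin : m \is a fin_num by apply: prode_fin_num => i _; exact: gfin.
have key B' : measurable B' ->
    (\int[P]_w (G w * \1_B' (X i0 w))%:E = m * P (X i0 @^-1` B'))%E.
  (* The induction hypothesis holds for every family of sets and still has an indicator at index
     [k]. Putting [B'] there shows that the other factors are independent of [X k]. *)
  move=> mB'; pose B2 i := if i == i0 then B' else B i.
  have mB2 i : measurable (B2 i) by rewrite /B2; case: ifP.
  have gE i : i != i0 -> g k B2 i = g k.+1 B i.
    move=> ii0; rewrite /g /B2 (negbTE ii0) ltnS [(i <= k)%N]leq_eqVlt.
    by have /negbTE-> : (i : nat) != k by move: ii0; rewrite -val_eqE.
  have gE0 : g k B2 i0 = \1_B' by rewrite /g /B2 eqxx /= ltnn.
  have := IH (ltnW kn) B2 mB2.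
  rewrite [RHS](bigD1 i0)//= gE0 iI// muleC.
  rewrite (eq_bigr (fun i => \int[P]_w (g k.+1 B i (X i w))%:E)%E) => [<-|i ii0].
    apply: eq_integral => w _; congr _%:E; rewrite [RHS](bigD1 i0)//= gE0 mulrC.
    by congr (_ * _); apply: eq_bigr => i ii0; rewrite gE.
  by rewrite gE.
have intG : (\int[P]_w (G w)%:E = m)%E.
  have := key setT measurableT; rewrite preimage_setT probability_setT mule1 => <-.
  by apply: eq_integral => w _; rewrite indicT mulr1.
rewrite [RHS](bigD1 i0)//= -/m muleC -intG -integral_indep_mul//.
- apply: eq_integral => w _; congr _%:E.
  by rewrite (bigD1 i0)//= mulrC.
- by rewrite intG.
- exact: mg.
- by move=> C mC; rewrite key// intG.
Qed.

Section ExponentialMoments.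
Context {d} {T : measurableType d} {R : realType} (P : probability T R).

(** The linear term is kept exact so that it disappears in expectation for a centred variable. *)
Lemma expR_le1DxD2 (x : R) : expR x <= 1 + x + x ^+ 2 * expR `|x|.
Proof.
have h : expR x - 1 <= x * expR x.
  have := expR_ge1Dx (- x); rewrite expRN => h.
  have e0 := expR_gt0 x.
  have : (1 - x) * expR x <= 1 by rewrite -ler_pdivlMr// mul1r.
  by lra.
have ge1 := expR_ge1Dx x.
have [x0|x0] := leP 0 x.
  rewrite ger0_norm//.
  have : x * (expR x - 1) <= x * (x * expR x) by apply: ler_wpM2l.
  by rewrite expr2; nra.
rewrite ltr0_norm//.
have h2 : 1 <= expR (- x) by have := expR_ge1Dx (- x); lra.
have : (- x) * (1 - expR x) <= (- x) * (- x) by apply: ler_wpM2l; lra.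
have : (- x) * (- x) * 1 <= (- x) * (- x) * expR (- x) by apply: ler_wpM2l => //; nra.
by rewrite expr2; nra.
Qed.

Lemma measurable_expR_scale (X : T -> R) (c : R) :
  measurable_fun [set: T] X -> measurable_fun [set: T] (fun w => expR (c * X w)).
Proof. by move=> mX; apply: measurableT_comp => //; exact: measurable_funM. Qed.

(** The rate is half that of the tail: layer [k] has height [e^(k+1)] and probability at most
    [2 e^(-2k)], so its contribution is at most [2 e 2^(-k)]. These sum to [4 e]. *)
Lemma subgaussian_square_exp_moment (Y : T -> R) (nu : R) :
  0 < nu -> measurable_fun [set: T] Y ->
  (forall t : R, 0 <= t ->
     (P [set w | (t <= `|Y w|)%R] <= (2 * expR (- (t ^+ 2 / nu ^+ 2)))%:E)%E) ->
  (\int[P]_w (expR ((2 * nu ^+ 2)^-1 * Y w ^+ 2))%:E <= (1 + 4 * expR 1)%:E)%E.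
Proof.
move=> nu0 mY tailY.
(* Peel [Z] at the levels [expR k]; the tail bound at [s k] is [2 expR (- 2 k)]. *)
pose s k : R := nu * Num.sqrt (2 * k%:R).
have s0 k : 0 <= s k by rewrite mulr_ge0// ?sqrtr_ge0// ltW.
pose A k := [set w | s k <= `|Y w|].
have mA k : measurable (A k).
  rewrite -[A k]setTI; apply: (measurable_fun_ler (measurable_cst (s k))) => //.
  exact: measurableT_comp.
pose Z w := expR ((2 * nu ^+ 2)^-1 * Y w ^+ 2).
have AE k w : (expR k%:R <= Z w) = (s k <= `|Y w|).
  rewrite /Z ler_expR mulrC ler_pdivlMr ?mulr_gt0 ?exprn_gt0//.
  rewrite -[in RHS](ler_pXn2r (_ : 0 < 2)%N) ?nnegrE// real_normK ?num_real//.
  by rewrite exprMn sqr_sqrtr ?mulr_ge0//; congr (_ <= _); ring.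
have e2 : 2 <= expR 1 :> R by have := expR_ge1Dx (1 : R); lra.
(* The truncation allows an induction on the number of layers; at each point it has no effect once
   [N] is large. *)
have trunc N w : Num.min (Z w) (expR N%:R)
    <= 1 + \sum_(0 <= k < N) expR 1 * expR k%:R * \1_(A k) w.
  elim: N => [|N IH]; first by rewrite big_geq// expR0 addr0 ge_min lexx orbT.
  rewrite big_nat_recr//= addrA.
  apply: le_trans (lerD IH (lexx _)).
  rewrite indicE; case: (boolP (w \in A N)) => [|wA].
    rewrite inE /A /= -AE => ZN.
    rewrite (min_idPr ZN) mulr1 -natr1 expRD.
    by rewrite ge_min; apply/orP; right; rewrite mulrC; have := expR_gt0 (N%:R : R); lra.
  have ZN : Z w <= expR N%:R.
    by rewrite leNgt; apply: contra wA => /ltW h; rewrite inE /A /= -AE.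
  by rewrite (min_idPl ZN) mulr0 addr0 ge_min lexx.
have Zle w : ((Z w)%:E <= 1 + \sum_(0 <= k <oo) (expR 1 * expR k%:R * \1_(A k) w)%:E)%E.
  have [N ZN] : exists N : nat, Z w <= expR N%:R.
    exists (Num.bound ((2 * nu ^+ 2)^-1 * Y w ^+ 2)).
    rewrite ler_expR ltW//; apply: archi_boundP.
    by rewrite mulr_ge0// ?sqr_ge0// invr_ge0 mulr_ge0// sqr_ge0.
  apply: (@le_trans _ _ (1 + \sum_(0 <= k < N) (expR 1 * expR k%:R * \1_(A k) w)%:E)%E).
    rewrite sumEFin -EFinD lee_fin.
    by have := trunc N w; rewrite (min_idPl ZN).
  rewrite leeD2l//; apply: nneseries_lim_ge => k _ _.
  by rewrite lee_fin !mulr_ge0// expR_ge0.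
have mI k : measurable_fun [set: T] (fun w => (expR 1 * expR k%:R * \1_(A k) w)%:E).
  by apply/measurable_EFinP/measurable_funM => //; exact: measurable_indic.
have I0 k w : (0 <= (expR 1 * expR k%:R * \1_(A k) w : R)%:E)%E.
  by rewrite lee_fin !mulr_ge0// expR_ge0.
apply: (@le_trans _ _ (\int[P]_w (1 + \sum_(0 <= k <oo) (expR 1 * expR k%:R * \1_(A k) w)%:E))%E).
  apply: ge0_le_integral => //.
  - apply/measurable_EFinP; apply: measurableT_comp => //.
    by apply: measurable_funM => //; exact: measurable_funX.
  - apply: emeasurable_funD => //; apply: ge0_emeasurable_sum => //.
  - by move=> w _; exact: Zle.
rewrite (@ge0_integralD _ _ _ P setT measurableT (cst 1%E)
  (fun w => \sum_(0 <= k <oo) (expR 1 * expR k%:R * \1_(A k) w)%:E)%E)//; last 2 first.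
  - by move=> w _; exact: nneseries_ge0.
  - exact: ge0_emeasurable_sum.
rewrite integral_cst//= probability_setT mul1e EFinD leeD2l//.
rewrite integral_nneseries//.
have tail k : (\int[P]_w (expR 1 * expR k%:R * \1_(A k) w)%:E
    <= (2 * expR 1 * (2^-1) ^+ k)%:E)%E.
  under eq_integral do rewrite EFinM.
  rewrite ge0_integralZl//; last exact/measurable_EFinP/measurable_indic.
  rewrite integral_indic// setIT.
  apply: le_trans (lee_wpmul2l _ (tailY (s k) (s0 k))) _.
    by rewrite lee_fin mulr_ge0// expR_ge0.
  rewrite -EFinM lee_fin.
  have -> : - (s k ^+ 2 / nu ^+ 2) = - (k%:R + k%:R).
    rewrite /s exprMn sqr_sqrtr ?mulr_ge0//; field.
    by rewrite gt_eqF.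
  rewrite opprD expRD.
  have -> : expR 1 * expR k%:R * (2 * (expR (- k%:R) * expR (- k%:R)))
     = 2 * expR 1 * expR (- k%:R) * (expR k%:R * expR (- k%:R)) :> R by ring.
  rewrite expRxMexpNx_1 mulr1 ler_wpM2l ?mulr_ge0 ?expR_ge0//.
  have -> : - k%:R = k%:R * (- 1) :> R by ring.
  rewrite expRM_natl lerXn2r ?nnegrE ?expR_ge0// ?invr_ge0//.
  by rewrite expRN lef_pV2 ?posrE// expR_gt0.
apply: le_trans (lee_nneseries _ (fun k _ => tail k)) _ => //.
  by move=> *; apply: integral_ge0 => w _; exact: I0.
apply: lime_le.
  by apply: is_cvg_nneseries => k _; rewrite lee_fin !mulr_ge0// ?expR_ge0// exprn_ge0.
apply: nearW => N; rewrite sumEFin lee_fin.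
suff -> : \sum_(0 <= k < N) 2 * expR 1 * 2^-1 ^+ k = 4 * expR 1 * (1 - 2^-1 ^+ N) :> R.
  have h : 0 <= 2^-1 ^+ N :> R by rewrite exprn_ge0// invr_ge0.
  by have := expR_gt0 (1 : R); nra.
elim: N => [|N IH]; first by rewrite big_geq// expr0 subrr mulr0.
by rewrite big_nat_recr//= IH exprS; lra.
Qed.

End ExponentialMoments.

Section MomentGeneratingFunction.
Context {d} {T : measurableType d} {R : realType} (P : probability T R).

(** Bernstein's bound. Half of the exponent [c |X|] dominates [exp |a X|], the other half dominates
    [X^2] through [y^2 / 2 <= e^y] at [y = c |X| / 2]; hence [8 / c^2]. *)
Lemma mgf_le (X : T -> R) (c B a : R) :
  0 < c -> measurable_fun [set: T] X -> ('E_P[X] = 0)%E ->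
  (\int[P]_w (expR (c * `|X w|))%:E <= B%:E)%E ->
  0 <= a -> a <= c / 2 ->
  (\int[P]_w (expR (a * X w))%:E <= (expR (8 * B / c ^+ 2 * a ^+ 2))%:E)%E.
Proof.
move=> c0 mX EX0 XB a0 ac.
have mN : measurable_fun [set: T] (fun w => `|X w|) by exact: measurableT_comp.
have mh := measurable_expR_scale c mN.
have hint : P.-integrable [set: T] (EFin \o (fun w => expR (c * `|X w|))).
  apply/integrableP; split; first exact/measurable_EFinP.
  under eq_integral do rewrite /= ger0_norm ?expR_ge0//.
  exact: le_lt_trans XB (ltry _).
have Xint : P.-integrable [set: T] (EFin \o X).
  apply: (le_integrable measurableT _ _ (integrableZl measurableT c^-1 hint)).
    exact/measurable_EFinP.
  move=> w _ /=; rewrite lee_fin [leRHS]ger0_norm; last first.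
    by rewrite mulr_ge0 ?expR_ge0// invr_ge0 ltW.
  rewrite [leRHS]mulrC ler_pdivlMr// mulrC.
  by have := expR_ge1Dx (c * `|X w|); lra.
set h := fun w => expR (c * `|X w|).
have pw w : expR (a * X w) <= 1 + a * X w + 8 * a ^+ 2 / c ^+ 2 * h w.
  apply: le_trans (expR_le1DxD2 _) _; rewrite lerD2l.
  have -> : 8 * a ^+ 2 / c ^+ 2 * h w
    = a ^+ 2 * (8 / c ^+ 2 * expR (c / 2 * `|X w|)) * expR (c / 2 * `|X w|).
    have -> : h w = expR (c / 2 * `|X w|) * expR (c / 2 * `|X w|).
      by rewrite -expRD; congr expR; lra.
    by ring.
  rewrite exprMn; apply: ler_pM.
  - by rewrite mulr_ge0 ?sqr_ge0.
  - exact: expR_ge0.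
  - apply: ler_wpM2l; first exact: sqr_ge0.
    have cX : 0 <= c / 2 * `|X w| by rewrite mulr_ge0// divr_ge0// ltW.
    have := @expR_ge1Dxn R (c / 2 * `|X w|) 1 cX.
    rewrite (_ : 2`! = 2)%N// exprMn real_normK ?num_real// => h2.
    rewrite mulrAC ler_pdivlMr ?exprn_gt0//.
    by rewrite expr2 in h2 *; have := sqr_ge0 (X w); lra.
  - rewrite ler_expR normrM (ger0_norm a0).
    exact: ler_wpM2r.
have mp : measurable_fun [set: T] (fun w => 1 + a * X w + 8 * a ^+ 2 / c ^+ 2 * h w).
  by apply: measurable_funD; [apply: measurable_funD => //|]; exact: measurable_funM.
apply: (@le_trans _ _ (\int[P]_w (1 + a * X w + 8 * a ^+ 2 / c ^+ 2 * h w)%:E)%E).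
  apply: ge0_le_integral_EFin => //.
  exact: measurable_expR_scale.
have i1 : P.-integrable [set: T] (fun w => (1 : R)%:E).
  by apply: finite_measure_integrable_cst.
have i2 : P.-integrable [set: T] (fun w => (a * X w)%:E).
  by under eq_fun do rewrite EFinM; exact: integrableZl.
have i3 : P.-integrable [set: T] (fun w => (8 * a ^+ 2 / c ^+ 2 * h w)%:E).
  by under eq_fun do rewrite EFinM; exact: integrableZl.
under eq_integral do rewrite EFinD EFinD.
rewrite integralD//; last exact: integrableD.
rewrite integralD//.
under [X in (_ + X + _)%E]eq_integral do rewrite EFinM.
under [X in (_ + _ + X)%E]eq_integral do rewrite EFinM.
rewrite !integralZl//.
move: EX0; rewrite unlock => ->; rewrite mule0 adde0.
rewrite integral_cst//= probability_setT mul1e.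
apply: (@le_trans _ _ (1%:E + (8 * a ^+ 2 / c ^+ 2)%:E * B%:E)%E).
  rewrite leeD2l// lee_wpmul2l// lee_fin divr_ge0 ?sqr_ge0//.
  by rewrite mulr_ge0 ?sqr_ge0.
rewrite -EFinM -EFinD lee_fin.
apply: le_trans (expR_ge1Dx _); rewrite lerD2l le_eqVlt; apply/orP; left.
by apply/eqP; ring.
Qed.

End MomentGeneratingFunction.

Section LawTransfer.
Context {R : realType} {p : nat}.
Context {d d'} {T : measurableType d} {T' : measurableType d'}.

(** Both sides are transported along the real statistic [h]. On the side of [Y] this asks for
    measurability of [h] after [Y], which for an affine image of [y] reduces to dot products with
    [y]. *)
Lemma same_law_integral (P : probability T R) (X : T -> 'cV[R]_p)
    (P' : probability T' R) (Y : T' -> 'cV[R]_p)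
    (h : @borel_cV R p -> R) (g : R -> R) :
  same_law P X P' Y -> random_vector X ->
  measurable_fun [set: @borel_cV R p] h ->
  measurable_fun [set: T'] (fun w => h (Y w)) ->
  measurable_fun [set: R] g -> (forall r, 0 <= g r) ->
  (\int[P]_w (g (h (X w)))%:E = \int[P']_w (g (h (Y w)))%:E)%E.
Proof.
move=> XY mX mh mhY mg g0.
have mhX : measurable_fun [set: T] (fun w => h (X w)) by exact: measurableT_comp mX.
have mgE : measurable_fun [set: R] (EFin \o g) by exact/measurable_EFinP.
transitivity (\int[pushforward P (fun w => h (X w))]_r (g r)%:E)%E.
  rewrite (ge0_integral_pushforward mhX)//.
  by move=> r _; rewrite lee_fin.
transitivity (\int[pushforward P' (fun w => h (Y w))]_r (g r)%:E)%E.
  apply: eq_measure_integral => A mA _; rewrite /pushforward.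
  apply: (XY (h @^-1` A)).
  by rewrite -[Y in measurable Y]setTI; exact: mh.
by rewrite (ge0_integral_pushforward mhY)// => r _; rewrite lee_fin.
Qed.

Lemma measurable_coord (j : 'I_p) :
  measurable_fun [set: @borel_cV R p] (fun v : @borel_cV R p => (v : 'cV[R]_p) j 0).
Proof.
apply: (measurability _ (RGenOpens.measurableE R)).
move=> _ [_ [a [b ->] <-]]; rewrite setTI; apply: sub_sigma_algebra.
have /continuousP := @coord_continuous R p 1 j 0.
by apply; exact: interval_open.
Qed.

End LawTransfer.

(** * Moments of linear and bilinear forms of an isotropic sub-Gaussian vector *)

Section SubgaussianVector.
Context {R : realType} {p : nat} {d} {T : measurableType d}.
Variables (P : probability T R) (nu : R) (y : T -> 'cV[R]_p).
Hypothesis nu_gt0 : 0 < nu.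
Hypothesis y_iso : isotropic_subgaussian P nu y.

Definition sqmgf_bound : R := 1 + 4 * expR 1.
Definition sqmgf_rate : R := (2 * nu ^+ 2)^-1.

Let B := sqmgf_bound.
Let c := sqmgf_rate.

Lemma sqmgf_bound_ge1 : 1 <= B.
Proof. by rewrite lerDl mulr_ge0// expR_ge0. Qed.

Lemma sqmgf_rate_gt0 : 0 < c.
Proof. by rewrite invr_gt0 mulr_gt0// exprn_gt0. Qed.

Lemma measurable_dotv (b : 'cV[R]_p) :
  measurable_fun [set: @borel_cV R p] (fun v : @borel_cV R p => dotv b (v : 'cV[R]_p)).
Proof.
under eq_fun do rewrite dotvE.
apply: measurable_sum => i; apply: measurable_funM => //.
exact: measurable_coord.
Qed.

Lemma measurable_random_dotv d1 (T1 : measurableType d1) (z : T1 -> 'cV[R]_p) b :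
  random_vector z -> measurable_fun [set: T1] (fun w => dotv b (z w)).
Proof. by move=> mz; exact: (measurableT_comp (measurable_dotv b) mz). Qed.

Let my : random_vector y. Proof. by case: y_iso. Qed.
Let md b : measurable_fun [set: T] (fun w => dotv b (y w)).
Proof. exact: measurable_random_dotv. Qed.

(** Normalising a nonzero [b] of norm at most one only enlarges the integrand, and the tail
    hypothesis concerns unit vectors. *)
Lemma expR_sq_dotv_le b : dotv b b <= 1 ->
  (\int[P]_w (expR (c * dotv b (y w) ^+ 2))%:E <= B%:E)%E.
Proof.
move=> b1; have [->|b0] := eqVneq b 0.
  under eq_integral do rewrite dotv0l expr0n mulr0 expR0.
  by rewrite integral_cst//= probability_setT mul1e lee_fin sqmgf_bound_ge1.
pose k := lnorm 2 b.
have k0 : 0 < k by rewrite /k lnorm2E sqrtr_gt0 lt_neqAle dotv_ge0 eq_sym dotv_eq0 b0.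
have k1 : k <= 1 by rewrite /k lnorm2E -[leRHS]sqrtr1 ler_wsqrtr.
pose b' := k^-1 *: b.
have nb' : lnorm 2 b' = 1.
  rewrite lnorm2E /b' dotvZl dotvZr mulrA -invfM -expr2.
  by rewrite -lnorm2_sqr mulVf ?sqrtr1// expf_neq0// gt_eqF.
apply: le_trans (subgaussian_square_exp_moment nu_gt0 (md b') _); last first.
  by move=> t t0; case: y_iso => _ _ _; exact.
apply: ge0_le_integral_EFin.
- apply: measurable_expR_scale; exact: measurable_funX.
- apply: measurable_expR_scale; exact: measurable_funX.
- by move=> w; exact: expR_ge0.
move=> w; rewrite ler_expR; apply: ler_wpM2l; first exact/ltW/sqmgf_rate_gt0.
rewrite /b' dotvZl exprMn ler_peMl ?sqr_ge0// exprVn invf_ge1 ?exprn_gt0//.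
by rewrite exprn_ile1 // ltW.
Qed.

(** The moments in [isotropic_subgaussian] are bare integrals. Extending them to dot products by
    linearity needs integrability, obtained by domination. *)
Lemma integrable_of_sq_bound (X : T -> R) b b' K : 0 <= K ->
  dotv b b <= 1 -> dotv b' b' <= 1 -> measurable_fun [set: T] X ->
  (forall w, `|X w| <= K * (expR (c * dotv b (y w) ^+ 2) + expR (c * dotv b' (y w) ^+ 2))) ->
  P.-integrable [set: T] (EFin \o X).
Proof.
move=> K0 b1 b1' mX XK.
have i1 a : dotv a a <= 1 ->
    P.-integrable [set: T] (fun w => (expR (c * dotv a (y w) ^+ 2))%:E).
  move=> a1; apply/integrableP; split.
    by apply/measurable_EFinP/measurable_expR_scale; exact: measurable_funX.
  under eq_integral do rewrite /= ger0_norm ?expR_ge0//.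
  by apply: le_lt_trans (expR_sq_dotv_le a1) _; exact: ltry.
apply: (le_integrable measurableT _ _
  (integrableZl measurableT K (integrableD measurableT (i1 _ b1) (i1 _ b1')))).
  exact/measurable_EFinP.
move=> w _ /=; rewrite lee_fin.
by apply: le_trans (XK w) _; exact: ler_norm.
Qed.

Lemma abs_mul_le_exp (u v : R) : `|u * v| <= c^-1 * (expR (c * u ^+ 2) + expR (c * v ^+ 2)).
Proof.
have c0 := sqmgf_rate_gt0.
rewrite ler_pdivlMl//.
have := expR_ge1Dx (c * u ^+ 2); have := expR_ge1Dx (c * v ^+ 2).
rewrite normrM.
have : `|u| * `|v| <= u ^+ 2 + v ^+ 2.
  rewrite -(real_normK (num_real u)) -(real_normK (num_real v)).
  by have := sqr_ge0 (`|u| - `|v|); have := sqr_ge0 `|u|; have := sqr_ge0 `|v|; nra.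
by move=> h; have := ler_wpM2l (ltW c0) h; rewrite mulrDr; lra.
Qed.

Lemma integrable_coord j : P.-integrable [set: T] (fun w => (y w j 0)%:E).
Proof.
have d1 : dotv (delta_mx j 0 : 'cV[R]_p) (delta_mx j 0) <= 1.
  by rewrite dotv_delta mxE !eqxx.
apply: (@integrable_of_sq_bound _ _ _ (c^-1 + 1) _ d1 d1).
- by rewrite addr_ge0// invr_ge0 ltW// sqmgf_rate_gt0.
- by under eq_fun do rewrite -dotv_delta; exact: md.
move=> w; rewrite dotv_delta; set u := y w j 0.
have h : `|u| <= `|u * u| + 1.
  by rewrite normrM; have := sqr_ge0 (`|u| - 1); have := sqr_ge0 `|u|; nra.
apply: le_trans h _; rewrite mulrDl mul1r lerD ?abs_mul_le_exp//.
have e1 : 1 <= expR (c * u ^+ 2).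
  by rewrite -expR0 ler_expR mulr_ge0 ?sqr_ge0// ltW// sqmgf_rate_gt0.
by lra.
Qed.

Lemma integrable_coord_mul j k :
  P.-integrable [set: T] (fun w => (y w j 0 * y w k 0)%:E).
Proof.
have d1 i : dotv (delta_mx i 0 : 'cV[R]_p) (delta_mx i 0) <= 1.
  by rewrite dotv_delta mxE !eqxx.
apply: (@integrable_of_sq_bound _ _ _ c^-1 _ (d1 j) (d1 k)).
- by rewrite invr_ge0 ltW// sqmgf_rate_gt0.
- under eq_fun do rewrite -!dotv_delta; exact: measurable_funM.
by move=> w; rewrite !dotv_delta; exact: abs_mul_le_exp.
Qed.

Lemma expectation_dotv b : ('E_P[fun w => dotv b (y w)] = 0)%E.
Proof.
rewrite unlock.
under eq_integral do rewrite dotvE -sumEFin.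
rewrite integral_sum//; last first.
  by move=> j; under eq_fun do rewrite EFinM; exact/integrableZl/integrable_coord.
rewrite big1// => j _; under eq_integral do rewrite EFinM.
rewrite integralZl//; last exact: integrable_coord.
by case: y_iso => _ /(_ j); rewrite unlock => -> _ _; rewrite mule0.
Qed.

Lemma expectation_dotv_mul a b :
  ('E_P[fun w => (dotv a (y w) * dotv b (y w))%R] = (dotv a b)%:E)%E.
Proof.
rewrite unlock.
have intE j k : (\int[P]_w (y w j 0 * y w k 0)%:E = ((j == k)%:R)%:E)%E.
  case: y_iso => _ _ /(_ j k); rewrite unlock mxE => <- _.
  apply: eq_integral => w _; congr _%:E.
  by rewrite mxE big_ord1 mxE.
have iab j k : P.-integrable [set: T] (fun w => (a j 0 * b k 0 * (y w j 0 * y w k 0))%:E).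
  by under eq_fun do rewrite EFinM; exact/integrableZl/integrable_coord_mul.
transitivity (\int[P]_w (\sum_j \sum_k (a j 0 * b k 0 * (y w j 0 * y w k 0))%:E))%E.
  apply: eq_integral => w _; under eq_bigr do rewrite sumEFin.
  rewrite sumEFin; congr _%:E; rewrite !dotvE mulr_suml.
  by apply: eq_bigr => j _; rewrite mulr_sumr; apply: eq_bigr => k _; ring.
rewrite integral_sum//; last first.
  by move=> j; exact: integrable_sum.
under eq_bigr => j _ do rewrite integral_sum//.
rewrite (eq_bigr (fun j => (a j 0 * b j 0)%:E)) ?sumEFin ?dotvE// => j _.
rewrite (bigD1 j)//= big1 ?adde0 => [|k kj]; last first.
  under eq_integral do rewrite EFinM.
  rewrite integralZl//; last exact: integrable_coord_mul.
  by rewrite intE eq_sym (negbTE kj) mule0.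
under eq_integral do rewrite EFinM.
by rewrite integralZl ?intE ?eqxx ?mule1//; exact: integrable_coord_mul.
Qed.

(** The first summand serves [a <= c / 2]. For larger [a], Young's inequality
    [a u <= a^2 / (4 c) + c u^2] gives the last one, and the middle one absorbs the moment bound
    [B], since then [c^2 <= 4 a^2]. *)
Definition mgf_lin_const : R := 8 * (expR (c / 4) * B) / c ^+ 2 + 4 * B / c ^+ 2 + (4 * c)^-1.
Definition mgf_quad_const : R := 8 * (expR c * B) / c ^+ 2.

Lemma mgf_dotv_le b a : dotv b b <= 1 -> 0 <= a ->
  (\int[P]_w (expR (a * dotv b (y w)))%:E <= (expR (mgf_lin_const * a ^+ 2))%:E)%E.
Proof.
move=> b1 a0; have c0 := sqmgf_rate_gt0; have B1 := sqmgf_bound_ge1.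
have B0 : 0 <= B by apply: le_trans B1.
have msq := measurable_expR_scale c (measurable_funX 2 (md b)).
have t1 : 0 <= 8 * (expR (c / 4) * B) / c ^+ 2.
  by rewrite divr_ge0 ?sqr_ge0// !mulr_ge0// expR_ge0.
have t2 : 0 <= 4 * B / c ^+ 2 by rewrite divr_ge0 ?sqr_ge0// mulr_ge0.
have t3 : 0 <= (4 * c)^-1 by rewrite invr_ge0 mulr_ge0// ltW.
have [ac|ca] := leP a (c / 2).
  apply: (@le_trans _ _ (expR (8 * (expR (c / 4) * B) / c ^+ 2 * a ^+ 2))%:E); last first.
    rewrite lee_fin ler_expR ler_wpM2r ?sqr_ge0//.
    by rewrite /mgf_lin_const; lra.
  apply: mgf_le => //; first exact: expectation_dotv.
  apply: (@le_trans _ _ (\int[P]_w (expR (c / 4) * expR (c * dotv b (y w) ^+ 2))%:E)%E).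
    apply: ge0_le_integral_EFin => //.
    - by apply: measurable_expR_scale; exact: measurableT_comp.
    - exact: measurable_funM.
    move=> w; rewrite -expRD ler_expR; set u := dotv b (y w).
    have : `|u| <= 4^-1 + u ^+ 2.
      by rewrite -(real_normK (num_real u)); have := sqr_ge0 (`|u| - 2^-1); nra.
    by move=> h; have := ler_wpM2l (ltW c0) h; lra.
  under eq_integral do rewrite EFinM.
  rewrite ge0_integralZl//; last exact/measurable_EFinP.
  by rewrite EFinM lee_wpmul2l ?lee_fin ?expR_ge0//; exact: expR_sq_dotv_le.
apply: (@le_trans _ _ (\int[P]_w (expR ((4 * c)^-1 * a ^+ 2) * expR (c * dotv b (y w) ^+ 2))%:E)%E).
  apply: ge0_le_integral_EFin => //.
  - exact: measurable_expR_scale.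
  - exact: measurable_funM.
  move=> w; rewrite -expRD ler_expR; set u := dotv b (y w).
  have -> : (4 * c)^-1 * a ^+ 2 + c * u ^+ 2
      = a * u + c * (u - a / (2 * c)) ^+ 2 by field; rewrite gt_eqF.
  by rewrite lerDl mulr_ge0 ?sqr_ge0// ltW.
under eq_integral do rewrite EFinM.
rewrite ge0_integralZl//; last exact/measurable_EFinP.
apply: le_trans (lee_wpmul2l _ (expR_sq_dotv_le b1)) _.
  by rewrite lee_fin expR_ge0.
rewrite -EFinM lee_fin.
apply: (@le_trans _ _ (expR ((4 * c)^-1 * a ^+ 2) * expR B)).
  rewrite ler_wpM2l ?expR_ge0//; apply: le_trans (expR_ge1Dx _).
  by rewrite lerDr.
rewrite -expRD ler_expR.
have ca2 : c ^+ 2 <= 4 * a ^+ 2.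
  have -> : 4 * a ^+ 2 = (2 * a) ^+ 2 by ring.
  by rewrite ler_pXn2r ?nnegrE ?mulr_ge0// ?ltW//; lra.
have : B <= 4 * B / c ^+ 2 * a ^+ 2.
  by rewrite mulrAC ler_pdivlMr ?exprn_gt0//; have := ler_wpM2l B0 ca2; lra.
have : 0 <= 8 * (expR (c / 4) * B) / c ^+ 2 * a ^+ 2 by rewrite mulr_ge0 ?sqr_ge0.
by rewrite /mgf_lin_const; lra.
Qed.

(** The product is dominated by half the sum of the squares, and convexity of [exp] separates the
    two. Products have only exponential tails, hence the restriction on [a]. *)
Lemma mgf_dotv_mul_le b b' a : dotv b b <= 1 -> dotv b' b' <= 1 ->
  `|dotv b b'| <= 1 -> 0 <= a -> a <= c / 2 ->
  (\int[P]_w (expR (a * (dotv b (y w) * dotv b' (y w) - dotv b b')))%:E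
    <= (expR (mgf_quad_const * a ^+ 2))%:E)%E.
Proof.
move=> b1 b1' bb a0 ac; have c0 := sqmgf_rate_gt0.
have mX : measurable_fun [set: T] (fun w => dotv b (y w) * dotv b' (y w) - dotv b b').
  by apply: measurable_funB => //; exact: measurable_funM.
have msq e := measurable_expR_scale c (measurable_funX 2 (md e)).
apply: mgf_le => //.
  rewrite unlock; under eq_integral do rewrite EFinB.
  rewrite integralB//.
  - have := expectation_dotv_mul b b'; rewrite unlock => ->.
    by rewrite integral_cst//= probability_setT mule1 subee.
  - apply: (integrable_of_sq_bound _ b1 b1'); last by move=> w; exact: abs_mul_le_exp.
      by rewrite invr_ge0 ltW.
    exact: measurable_funM.
  - exact: finite_measure_integrable_cst.
apply: (@le_trans _ _ (\int[P]_w (expR c / 2 * (expR (c * dotv b (y w) ^+ 2)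
    + expR (c * dotv b' (y w) ^+ 2)))%:E)%E).
  apply: ge0_le_integral_EFin => //.
  - by apply: measurable_expR_scale; exact: measurableT_comp.
  - by apply: measurable_funM => //; exact: measurable_funD.
  move=> w; set u := dotv b (y w); set v := dotv b' (y w).
  apply: (@le_trans _ _ (expR (c + (c * u ^+ 2 / 2 + c * v ^+ 2 / 2)))).
    rewrite ler_expR.
    have : `|u * v - dotv b b'| <= 1 + (u ^+ 2 / 2 + v ^+ 2 / 2).
      apply: le_trans (ler_normB _ _) _; rewrite addrC lerD// normrM.
      rewrite -(real_normK (num_real u)) -(real_normK (num_real v)).
      by have := sqr_ge0 (`|u| - `|v|); nra.
    by move=> h; have := ler_wpM2l (ltW c0) h; lra.
  rewrite expRD -[leRHS]mulrA ler_wpM2l ?expR_ge0// expRD.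
  have -> : expR (c * u ^+ 2) = expR (c * u ^+ 2 / 2) ^+ 2.
    by rewrite [RHS]expr2 -expRD; congr expR; lra.
  have -> : expR (c * v ^+ 2) = expR (c * v ^+ 2 / 2) ^+ 2.
    by rewrite [RHS]expr2 -expRD; congr expR; lra.
  by have := sqr_ge0 (expR (c * u ^+ 2 / 2) - expR (c * v ^+ 2 / 2)); nra.
have ec0 : 0 <= expR c / 2 by rewrite divr_ge0// expR_ge0.
under eq_integral do rewrite EFinM EFinD.
rewrite ge0_integralZl//; last 2 first.
- by apply: emeasurable_funD; exact/measurable_EFinP.
- by move=> w _; rewrite adde_ge0// lee_fin expR_ge0.
rewrite ge0_integralD//; [|exact/measurable_EFinP|exact/measurable_EFinP].
apply: le_trans (lee_wpmul2l _ (leeD (expR_sq_dotv_le b1) (expR_sq_dotv_le b1'))) _.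
  by rewrite lee_fin.
by rewrite -EFinD -EFinM lee_fin; lra.
Qed.

End SubgaussianVector.

(** * Concentration of sample averages *)

Section SampleAverages.
Context {R : realType} {p n : nat} {d d'} {T : measurableType d} {T' : measurableType d'}.
Variables (P : probability T R) (P' : probability T' R).
Variables (x : 'I_n -> T -> 'cV[R]_p) (Y : T' -> 'cV[R]_p).
Hypothesis n_gt0 : (0 < n)%N.
Hypothesis x_iid : iid_copies P x P' Y.

Definition avg (h : 'cV[R]_p -> R) (w : T) : R := n%:R^-1 * \sum_i h (x i w).

Variable h : @borel_cV R p -> R.
Hypothesis mh : measurable_fun [set: @borel_cV R p] h.
Hypothesis mhY : measurable_fun [set: T'] (fun w => h (Y w)).

Let nR0 : 0 < n%:R :> R. Proof. by rewrite ltr0n. Qed.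

Let mx i : random_vector (x i). Proof. by case: x_iid. Qed.

Lemma measurable_stat i : measurable_fun [set: T] (fun w => h (x i w)).
Proof. exact: (measurableT_comp mh (mx i)). Qed.

Lemma measurable_avg : measurable_fun [set: T] (avg h).
Proof.
by apply: measurable_funM => //; apply: measurable_sum => i; exact: measurable_stat.
Qed.

Lemma mgf_avg_le (K a : R) :
  (\int[P']_w (expR (a * h (Y w)))%:E <= (expR (K * a ^+ 2))%:E)%E ->
  (\int[P]_w (expR (n%:R * a * avg h w))%:E <= (expR (n%:R * (K * a ^+ 2)))%:E)%E.
Proof.
move=> hK; case: x_iid => _ indx lawx.
pose f := fun v : @borel_cV R p => expR (a * h v).
have mf : measurable_fun [set: @borel_cV R p] f by exact: measurable_expR_scale.
have lawE i : (\int[P]_w (f (x i w))%:E = \int[P']_w (expR (a * h (Y w)))%:E)%E.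
  apply: (@same_law_integral _ _ _ _ _ _ _ _ _ _ h (fun r => expR (a * r))) => //.
  exact: measurable_expR_scale.
have fin : (\int[P']_w (expR (a * h (Y w)))%:E)%E \is a fin_num.
  rewrite ge0_fin_numE; last by apply: integral_ge0 => w _; rewrite lee_fin expR_ge0.
  exact: le_lt_trans hK (ltry _).
under eq_integral => w _.
  have -> : expR (n%:R * a * avg h w) = \prod_i f (x i w).
    rewrite /f -expR_sum; congr expR; rewrite /avg -mulr_sumr.
    by field; rewrite gt_eqF.
  over.
have ffin i : (\int[P]_w (f (x i w))%:E)%E \is a fin_num by rewrite lawE.
have f0 (i : 'I_n) v : 0 <= f v by exact: expR_ge0.
rewrite (@integral_prod_indep _ _ T (@borel_cV R p) R P n x (fun=> f) mx indx (fun=> mf) f0 ffin).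
rewrite (eq_bigr (fun=> (fine (\int[P']_w (expR (a * h (Y w)))%:E))%:E)) => [|i _]; last first.
  by rewrite lawE fineK.
rewrite prodEFin lee_fin prodr_const card_ord expRM_natl.
apply: lerXn2r; rewrite ?nnegrE ?expR_ge0//.
  by apply: fine_ge0; apply: integral_ge0 => w _; rewrite lee_fin expR_ge0.
by rewrite -lee_fin fineK.
Qed.

(** Chernoff's bound with [a] left free: coordinatewise deviations will use [a] of order [sqrt L],
    the union over sparse vectors a constant [a]. *)
Lemma tail_avg_le (K a t : R) : 0 <= a ->
  (\int[P']_w (expR (a * h (Y w)))%:E <= (expR (K * a ^+ 2))%:E)%E ->
  (P [set w | (t <= avg h w)%R] <= (expR (n%:R * (K * a ^+ 2 - t * a)))%:E)%E.
Proof.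
move=> a0 hK; set A := [set w | _].
have mA : measurable A.
  rewrite -[A]setTI; apply: (measurable_fun_ler (measurable_cst t)) => //.
  exact: measurable_avg.
have -> : P A = (\int[P]_w (\1_A w)%:E)%E by rewrite integral_indic// setIT.
apply: (@le_trans _ _ (\int[P]_w (expR (- (n%:R * (t * a))) * expR (n%:R * a * avg h w))%:E)%E).
  apply: ge0_le_integral_EFin => //.
  - apply: measurable_funM => //; apply: measurable_expR_scale; exact: measurable_avg.
  move=> w; rewrite indicE; case: (boolP (w \in A)) => [|_]; last first.
    by rewrite mulr_ge0 ?expR_ge0.
  rewrite inE /A /= => tw; rewrite -expRD.
  apply: (@le_trans _ _ (expR 0)); first by rewrite expR0.
  rewrite ler_expR.
  by have := ler_wpM2l (mulr_ge0 (ltW nR0) a0) tw; lra.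
under eq_integral do rewrite EFinM.
rewrite ge0_integralZl//; last first.
  by apply/measurable_EFinP/measurable_expR_scale/measurable_avg.
apply: le_trans (lee_wpmul2l _ (mgf_avg_le hK)) _; first by rewrite lee_fin expR_ge0.
by rewrite -EFinM -expRD lee_fin ler_expR; lra.
Qed.

Lemma second_moment_avg_le (K a1 : R) : 0 < a1 ->
  (forall a, 0 <= a -> a <= a1 ->
     (\int[P']_w (expR (a * h (Y w)))%:E <= (expR (K * a ^+ 2))%:E)%E) ->
  (forall a, 0 <= a -> a <= a1 ->
     (\int[P']_w (expR (- a * h (Y w)))%:E <= (expR (K * a ^+ 2))%:E)%E) ->
  (\int[P]_w (avg h w ^+ 2)%:E <= (4 * expR (K * a1 ^+ 2) / a1 ^+ 2 / n%:R)%:E)%E.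
Proof.
move=> a10 hK hKN.
(* [z ^+ 2 <= 2 (expR z + expR (- z))] at [z = n a (avg h)] with [a ~ n^(-1/2)] *)
pose a := a1 / Num.sqrt n%:R.
have s0 : 0 < Num.sqrt n%:R :> R by rewrite sqrtr_gt0.
have a0 : 0 < a by rewrite divr_gt0.
have aa1 : a <= a1.
  rewrite ler_pdivrMr// ler_peMr ?(ltW a10)// -[leLHS]sqrtr1 ler_wsqrtr//.
  by rewrite ler1n n_gt0.
have a2 : a ^+ 2 = a1 ^+ 2 / n%:R by rewrite /a exprMn exprVn sqr_sqrtr.
have m1 := mgf_avg_le (hK a (ltW a0) aa1).
have m2 := mgf_avg_le (K := K) (a := - a).
rewrite sqrrN in m2; have {}m2 := m2 (hKN a (ltW a0) aa1).
have e1 : n%:R * (K * a ^+ 2) = K * a1 ^+ 2 by rewrite a2; field; rewrite gt_eqF.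
rewrite e1 in m1 m2.
have mA b : measurable_fun [set: T] (fun w => expR (n%:R * b * avg h w)).
  by apply: measurable_expR_scale; exact: measurable_avg.
pose k := 2 / (n%:R * a) ^+ 2.
have k0 : 0 <= k by rewrite divr_ge0 ?sqr_ge0.
apply: (@le_trans _ _ (\int[P]_w (k * (expR (n%:R * a * avg h w) + expR (n%:R * - a * avg h w)))%:E)%E).
  apply: ge0_le_integral_EFin => //.
  - by apply: measurable_funX; exact: measurable_avg.
  - by apply: measurable_funM => //; exact: measurable_funD.
  - by move=> w; exact: sqr_ge0.
  move=> w; set v := avg h w; set b := n%:R * a.
  have b0 : 0 < b by rewrite mulr_gt0.
  have -> : n%:R * - a * v = - (b * v) by rewrite /b; ring.
  have : (b * v) ^+ 2 <= 2 * (expR (b * v) + expR (- (b * v))).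
    have := @expR_ge1Dxn R `|b * v| 1 (normr_ge0 _).
    rewrite (_ : 2`! = 2)%N// real_normK ?num_real// => h2.
    have : expR `|b * v| <= expR (b * v) + expR (- (b * v)).
      have := expR_ge0 (b * v); have := expR_ge0 (- (b * v)).
      by case: (leP 0 (b * v)) => ?; [rewrite ger0_norm//; lra|rewrite ltr0_norm//; lra].
    by lra.
  by rewrite exprMn mulrC -ler_pdivlMr ?exprn_gt0// /k => /le_trans; apply; rewrite mulrAC.
under eq_integral do rewrite EFinM EFinD.
rewrite ge0_integralZl//; last 2 first.
- by apply: emeasurable_funD; exact/measurable_EFinP.
- by move=> w _; rewrite adde_ge0// lee_fin expR_ge0.
rewrite ge0_integralD//; [|exact/measurable_EFinP|exact/measurable_EFinP].
apply: le_trans (lee_wpmul2l _ (leeD m1 m2)) _; first by rewrite lee_fin.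
rewrite -EFinD -EFinM lee_fin /k exprMn a2 le_eqVlt; apply/orP; left; apply/eqP.
by field; rewrite !gt_eqF.
Qed.

End SampleAverages.

Section SubgaussianSample.
Context {R : realType} {p n : nat} {d d'} {T : measurableType d} {T' : measurableType d'}.
Variables (P : probability T R) (P' : probability T' R) (nu : R).
Variables (y : T' -> 'cV[R]_p) (x : 'I_n -> T -> 'cV[R]_p).
Variables (mu : 'cV[R]_p) (Sigma Sh : 'M[R]_p).
Hypothesis n_gt0 : (0 < n)%N.
Hypothesis nu_gt0 : 0 < nu.
Hypothesis Sh_sqrt : is_sqrtmx Sigma Sh.
Hypothesis y_iso : isotropic_subgaussian P' nu y.
Hypothesis x_iid : iid_copies P x P' (fun w => Sh *m y w + mu).

(** At [Sh y + mu] this is the dot product of [y] with [Sh u], whose squared norm is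
    [quadf Sigma u]; hence the normalisation [quadf Sigma u <= 1] below. *)
Definition linear_stat (u : 'cV[R]_p) : @borel_cV R p -> R :=
  fun v => dotv u ((v : 'cV[R]_p) - mu).
Definition product_stat (u u' : 'cV[R]_p) : @borel_cV R p -> R :=
  fun v => dotv u ((v : 'cV[R]_p) - mu) * dotv u' ((v : 'cV[R]_p) - mu) - dotv u (Sigma *m u').

Let c := sqmgf_rate nu.
Let c0 : 0 < c. Proof. exact: sqmgf_rate_gt0. Qed.
Let Y := fun w => Sh *m y w + mu.

Let my : random_vector y. Proof. by case: y_iso. Qed.

Lemma measurable_linear_stat u : measurable_fun [set: @borel_cV R p] (linear_stat u).
Proof.
rewrite /linear_stat; under eq_fun do rewrite dotvBr.
by apply: measurable_funB => //; exact: measurable_dotv.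
Qed.

Lemma measurable_product_stat u u' :
  measurable_fun [set: @borel_cV R p] (product_stat u u').
Proof.
apply: measurable_funB => //; apply: measurable_funM; exact: measurable_linear_stat.
Qed.

Let dotY u w : dotv u (Y w - mu) = dotv (Sh *m u) (y w).
Proof. by rewrite /Y addrK dotv_mulmx; case: Sh_sqrt => -[-> _] _. Qed.

Let linE u w : linear_stat u (Y w) = dotv (Sh *m u) (y w).
Proof. exact: dotY. Qed.

Let prodE u u' w : product_stat u u' (Y w)
  = dotv (Sh *m u) (y w) * dotv (Sh *m u') (y w) - dotv (Sh *m u) (Sh *m u').
Proof. by rewrite /product_stat !dotY (dotv_sqrt _ _ Sh_sqrt). Qed.

Let mlinY u : measurable_fun [set: T'] (fun w => linear_stat u (Y w)).
Proof. by under eq_fun do rewrite linE; exact: measurable_random_dotv. Qed.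

Let mprodY u u' : measurable_fun [set: T'] (fun w => product_stat u u' (Y w)).
Proof.
under eq_fun do rewrite prodE.
by apply: measurable_funB => //; apply: measurable_funM; exact: measurable_random_dotv.
Qed.

Let unit_le u : quadf Sigma u <= 1 -> dotv (Sh *m u) (Sh *m u) <= 1.
Proof. by rewrite (quadf_sqrt _ Sh_sqrt). Qed.

Let cross_le u u' : quadf Sigma u <= 1 -> quadf Sigma u' <= 1 ->
  `|dotv (Sh *m u) (Sh *m u')| <= 1.
Proof.
move=> /unit_le u1 /unit_le u1'.
rewrite -(ler_pXn2r (_ : 0 < 2)%N) ?nnegrE// real_normK ?num_real//.
apply: le_trans (dotv_CauchySchwarz _ _) _; rewrite expr1n.
by rewrite -[leRHS]mulr1; apply: ler_pM => //; exact: dotv_ge0.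
Qed.

Let mgf_lin u a : quadf Sigma u <= 1 -> 0 <= a ->
  (\int[P']_w (expR (a * linear_stat u (Y w)))%:E <= (expR (mgf_lin_const nu * a ^+ 2))%:E)%E.
Proof.
move=> /unit_le u1 a0; under eq_integral do rewrite linE.
exact: (mgf_dotv_le nu_gt0 y_iso u1 a0).
Qed.

Let mgf_prod u u' a : quadf Sigma u <= 1 -> quadf Sigma u' <= 1 -> 0 <= a -> a <= c / 2 ->
  (\int[P']_w (expR (a * product_stat u u' (Y w)))%:E <= (expR (mgf_quad_const nu * a ^+ 2))%:E)%E.
Proof.
move=> u1 u1' a0 ac; under eq_integral do rewrite prodE.
apply: (mgf_dotv_mul_le nu_gt0 y_iso) => //; [exact: unit_le|exact: unit_le|exact: cross_le].
Qed.

Let quadfN u : quadf Sigma (- u) = quadf Sigma u.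
Proof. by rewrite -scaleN1r quadf_scale sqrrN expr1n mul1r. Qed.

Lemma tail_linear_stat u t a : quadf Sigma u <= 1 -> 0 <= a ->
  (P [set w | (t <= avg x (linear_stat u) w)%R]
     <= (expR (n%:R * (mgf_lin_const nu * a ^+ 2 - t * a)))%:E)%E.
Proof.
move=> u1 a0; apply: (tail_avg_le n_gt0 x_iid (measurable_linear_stat u) (mlinY u) t a0).
exact: mgf_lin.
Qed.

Lemma tail_product_stat u u' t a : quadf Sigma u <= 1 -> quadf Sigma u' <= 1 ->
  0 <= a -> a <= c / 2 ->
  (P [set w | (t <= avg x (product_stat u u') w)%R]
     <= (expR (n%:R * (mgf_quad_const nu * a ^+ 2 - t * a)))%:E)%E.
Proof.
move=> u1 u1' a0 ac.
apply: (tail_avg_le n_gt0 x_iid (measurable_product_stat u u') (mprodY u u') t a0).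
exact: mgf_prod.
Qed.

Definition linear_sq_const : R := 4 * expR (mgf_lin_const nu * (c / 2) ^+ 2) / (c / 2) ^+ 2.
Definition product_sq_const : R := 4 * expR (mgf_quad_const nu * (c / 2) ^+ 2) / (c / 2) ^+ 2.

Lemma second_moment_linear_stat u : quadf Sigma u <= 1 ->
  (\int[P]_w (avg x (linear_stat u) w ^+ 2)%:E <= (linear_sq_const / n%:R)%:E)%E.
Proof.
move=> u1.
apply: (second_moment_avg_le n_gt0 x_iid (measurable_linear_stat u) (mlinY u)).
- by rewrite divr_gt0.
- by move=> a a0 _; exact: mgf_lin.
(* Negative exponents reduce to positive ones by replacing [u] with [- u]. *)
move=> a a0 _; have uN : quadf Sigma (- u) <= 1 by rewrite quadfN.
have := mgf_lin uN a0; rewrite /linear_stat.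
by under eq_integral do rewrite dotvNl mulrN -mulNr.
Qed.

Lemma second_moment_product_stat u u' : quadf Sigma u <= 1 -> quadf Sigma u' <= 1 ->
  (\int[P]_w (avg x (product_stat u u') w ^+ 2)%:E <= (product_sq_const / n%:R)%:E)%E.
Proof.
move=> u1 u1'.
apply: (second_moment_avg_le n_gt0 x_iid (measurable_product_stat u u') (mprodY u u')).
- by rewrite divr_gt0.
- by move=> a a0 ac; exact: mgf_prod.
move=> a a0 ac; have uN : quadf Sigma (- u) <= 1 by rewrite quadfN.
have := mgf_prod uN u1' a0 ac; rewrite /product_stat.
by under eq_integral do rewrite !dotvNl mulNr -opprD mulrN -mulNr.
Qed.

End SubgaussianSample.

(** * Good events *)

(** Returns one measurable exceptional set, so that events of different kinds can be united
    later. *)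
Lemma finite_union_bound {d} {T : measurableType d} {R : realType}
    (P : probability T R) (I : finType) (h : I -> T -> R) (t : I -> R) (B : R) :
  (forall i, measurable_fun [set: T] (h i)) ->
  (forall i, (P [set w | (t i <= h i w)%R] <= B%:E)%E) ->
  exists E : set T, [/\ measurable E, (P E <= (#|I|%:R * B)%:E)%E &
    forall w, ~ E w -> forall i, h i w < t i].
Proof.
move=> mh hB; pose A i := [set w | t i <= h i w].
have mA i : measurable (A i).
  by rewrite -[A i]setTI; exact: (measurable_fun_ler (measurable_cst (t i)) (mh i)).
pose E s := \big[setU/set0]_(i <- s) A i.
have Es (s : seq I) : [/\ measurable (E s), (P (E s) <= ((size s)%:R * B)%:E)%E &
    forall w, ~ E s w -> forall i, i \in s -> h i w < t i].
  elim: s => [|i s [mE PE hE]].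
    by rewrite /E big_nil; split => //; rewrite measure0 mul0r.
  have -> : E (i :: s) = A i `|` E s by rewrite /E big_cons.
  split; first exact: measurableU.
    apply: le_trans (measureU2 P (mA i) mE) _.
    have -> : ((size (i :: s))%:R * B)%:E = (B%:E + ((size s)%:R * B)%:E)%E.
      by rewrite /= -natr1 mulrDl mul1r addrC EFinD.
    by apply: leeD => //; exact: hB.
  move=> w nEw j; rewrite inE => /predU1P[->|js].
    by rewrite ltNge; apply/negP => ?; apply: nEw; left.
  by apply: hE js => Ew; apply: nEw; right.
have [mE PE hE] := Es (enum I); exists (E (enum I)); split => //.
  by rewrite cardE.
by move=> w nE i; apply: hE nE _ _; rewrite mem_enum.
Qed.

(** Used with [A = sqrt cU], [s = sqrt L], [t1 = sqrt tt] and [t2 = sqrt (1 + tt)]. The products of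
    two deviations are of lower order because [s <= 1]. *)
Lemma noise_arith {R : realType} (A m1 m2 t1 t2 s X Y Z : R) :
  0 <= A -> 0 <= m1 -> 0 <= m2 -> 0 <= t1 -> t1 <= t2 -> 1 <= t2 -> 0 <= s -> s <= 1 ->
  X <= m1 * A * s -> Y <= m1 * A * s * (m1 * t1 * s) -> Z <= A * t1 * (m2 * s) ->
  X + Y + Z <= A * (m1 + (m2 + m1 ^+ 2)) * (t2 * s).
Proof.
move=> A0 m10 m20 t10 t12 t21 s0 s1 hX hY hZ.
have b1 : m1 * A * s <= A * m1 * (t2 * s).
  have h0 : 0 <= m1 * A * s by rewrite !mulr_ge0.
  by have h := ler_wpM2l h0 t21; clear - h; lra.
have b2 : A * t1 * (m2 * s) <= A * m2 * (t2 * s).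
  have h0 : 0 <= A * m2 * s by rewrite !mulr_ge0.
  by have h := ler_wpM2l h0 t12; clear - h; lra.
have b3 : m1 * A * s * (m1 * t1 * s) <= A * m1 ^+ 2 * (t2 * s).
  have h0 : 0 <= A * m1 ^+ 2 * s by rewrite !mulr_ge0 ?sqr_ge0.
  have h' : t1 * s <= t2 * 1 by apply: ler_pM.
  by have h := ler_wpM2l h0 h'; clear - h; lra.
by clear - hX hY hZ b1 b2 b3; lra.
Qed.

Lemma diag_arith {R : realType} (a s u k m : R) :
  a - s < u -> u <= k * (m * 1) -> s <= k -> 0 <= s -> a - 2^-1 * s <= k * (1 + m).
Proof. by move=> *; lra. Qed.

Lemma curvature_arith {R : realType} (S z sg a N V b l kL d : R) :
  - a * N <= S + z - 2^-1 * sg -> z <= V * l * N -> a * N <= b * l * N ->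
  kL * d <= sg -> kL / 2 * d - (b + V) * l * N <= S.
Proof. by move=> *; lra. Qed.

Section GoodEvents.
Context {R : realType} {p n : nat} {d d'} {T : measurableType d} {T' : measurableType d'}.
Variables (P : probability T R) (P' : probability T' R) (nu cL cU M tt : R).
Variables (y : T' -> 'cV[R]_p) (x : 'I_n -> T -> 'cV[R]_p).
Variables (mu alpha : 'cV[R]_p) (Sigma Sh : 'M[R]_p).
Hypothesis n_gt0 : (0 < n)%N.
Hypothesis p_gt1 : (1 < p)%N.
Hypothesis nu_gt0 : 0 < nu.
Hypothesis cL_gt0 : 0 < cL.
Hypothesis cU_gt0 : 0 < cU.
Hypothesis M_gt0 : 0 < M.
Hypothesis tt_gt0 : 0 < tt.
Hypothesis Sh_sqrt : is_sqrtmx Sigma Sh.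
Hypothesis y_iso : isotropic_subgaussian P' nu y.
Hypothesis x_iid : iid_copies P x P' (fun w => Sh *m y w + mu).
Hypothesis Sigma_sym : symmx Sigma.
Hypothesis Sigma_coercive : forall v, cL * dotv v v <= quadf Sigma v.
Hypothesis Sigma_diag : forall j, Sigma j j <= cU.
Hypothesis Sigma_alpha : Sigma *m alpha = mu.
Hypothesis alpha_le : quadf Sigma alpha <= tt.

Let c := sqmgf_rate nu.
Let Kl : R := mgf_lin_const nu.
Let Kq : R := mgf_quad_const nu.
Let l : R := ln p%:R.
Let L : R := log_ratio p n.

Let nR0 : 0 < n%:R :> R. Proof. by rewrite ltr0n. Qed.
Let l0 : 0 < l. Proof. by rewrite ln_gt0// ltr1n. Qed.
Let L0 : 0 < L. Proof. by rewrite divr_gt0. Qed.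
Let nL : n%:R * L = l. Proof. by rewrite /L /log_ratio mulrC divfK// gt_eqF. Qed.
Let pE : p%:R = expR l. Proof. by rewrite lnK// posrE ltr0n ltnW. Qed.
Let c0 : 0 < c. Proof. exact: sqmgf_rate_gt0. Qed.
Let sqrtL2 : Num.sqrt L ^+ 2 = L. Proof. by rewrite sqr_sqrtr// ltW. Qed.

Let axis (j : 'I_p) : 'cV[R]_p := (Num.sqrt cU)^-1 *: delta_mx j 0.
Let sgn (b : bool) (u : 'cV[R]_p) : 'cV[R]_p := (-1) ^+ b *: u.

Let quadf_sgn b u : quadf Sigma (sgn b u) = quadf Sigma u.
Proof. by rewrite quadf_scale sqrr_sign mul1r. Qed.

Let scU : 0 < Num.sqrt cU. Proof. by rewrite sqrtr_gt0. Qed.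
Let stt : 0 < Num.sqrt tt. Proof. by rewrite sqrtr_gt0. Qed.

Let axis_le j : quadf Sigma (axis j) <= 1.
Proof.
rewrite quadf_scale quadf_delta exprVn sqr_sqrtr ?(ltW cU_gt0)//.
by rewrite ler_pdivrMl// mulr1.
Qed.

Let alpha1 := (Num.sqrt tt)^-1 *: alpha.

Let alpha1_le : quadf Sigma alpha1 <= 1.
Proof.
rewrite quadf_scale exprVn sqr_sqrtr ?(ltW tt_gt0)//.
by rewrite ler_pdivrMl// mulr1.
Qed.

Let sample w := x^~ w.
Let dm w := sample_mean (sample w) - mu.

Let avg_linE u w : avg x (linear_stat mu u) w = dotv u (dm w).
Proof. by rewrite /dm (dotv_sample_mean _ _ n_gt0). Qed.

Let avg_prodE u u' w : avg x (product_stat mu Sigma u u') w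
  = dotv u (sample_cov (sample w) *m u') + dotv u (dm w) * dotv u' (dm w)
    - dotv u (Sigma *m u').
Proof.
rewrite /avg /product_stat (dotv_sample_cov _ mu n_gt0) -/(dm w) subrK.
by rewrite sumrB sumr_const card_ord -mulr_natl; field; rewrite gt_eqF.
Qed.

Let norm_lt_of_sgn (z t : R) : (forall b : bool, (-1) ^+ b * z < t) -> `|z| <= t.
Proof.
move=> h; have := h true; have := h false; rewrite expr1 expr0 => h1 h2.
by rewrite ler_norml; apply/andP; split; lra.
Qed.

(** At level [mean_dev_const * sqrt L], the Chernoff parameter [a = sqrt L] gives the exponent
    [- (M + 1) ln p]; the added [1] pays for the union over coordinates. *)
Definition mean_dev_const : R := Kl + (M + 1).

Let lin_event (I : finType) (u : I -> 'cV[R]_p) : (forall i, quadf Sigma (u i) <= 1) ->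
  exists E : set T, [/\ measurable E, (P E <= (2 * #|I|%:R * expR (- ((M + 1) * l)))%:E)%E &
    forall w, ~ E w -> forall i, `|dotv (u i) (dm w)| <= mean_dev_const * Num.sqrt L].
Proof.
move=> u1.
have [||E [mE PE hE]] := @finite_union_bound _ T R P (bool * I)%type
  (fun i => avg x (linear_stat mu (sgn i.1 (u i.2))))
  (fun=> mean_dev_const * Num.sqrt L) (expR (- ((M + 1) * l))).
- move=> i; apply: (measurable_avg x_iid); exact: measurable_linear_stat.
- move=> i; have ui : quadf Sigma (sgn i.1 (u i.2)) <= 1 by rewrite quadf_sgn.
  apply: le_trans (tail_linear_stat n_gt0 nu_gt0 Sh_sqrt y_iso x_iid _ ui (sqrtr_ge0 L)) _.
  rewrite lee_fin ler_expR -[_ * Num.sqrt L * Num.sqrt L]mulrA -expr2 sqrtL2 -mulrBl mulrCA nL -/Kl.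
  by rewrite /mean_dev_const; lra.
exists E; split => //.
  by apply: le_trans PE _; rewrite lee_fin card_prod card_bool natrM.
move=> w nE i; apply: norm_lt_of_sgn => b.
by have := hE w nE (b, i); rewrite /= avg_linE dotvZl.
Qed.

Let dotv_axis j v : dotv (axis j) v = (Num.sqrt cU)^-1 * v j 0.
Proof. by rewrite dotvZl dotv_delta. Qed.

Lemma mean_event : exists E : set T,
  [/\ measurable E, (P E <= (2 * p%:R * expR (- ((M + 1) * l)))%:E)%E &
    forall w, ~ E w -> forall j, `|dm w j 0| <= mean_dev_const * Num.sqrt cU * Num.sqrt L].
Proof.
have [E [mE PE hE]] := lin_event axis_le; exists E; split => //.
  by rewrite card_ord in PE.
move=> w nE j; have := hE w nE j.
rewrite dotv_axis normrM gtr0_norm ?invr_gt0// ler_pdivrMl//.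
by move=> /le_trans; apply; rewrite le_eqVlt; apply/orP; left; apply/eqP; ring.
Qed.

Definition prod_dev_const : R := Kq + (M + 1).

Let prod_event (I : finType) (u u' : I -> 'cV[R]_p) : L <= (c / 2) ^+ 2 ->
  (forall i, quadf Sigma (u i) <= 1) -> (forall i, quadf Sigma (u' i) <= 1) ->
  exists E : set T, [/\ measurable E, (P E <= (#|I|%:R * expR (- ((M + 1) * l)))%:E)%E &
    forall w, ~ E w -> forall i,
      avg x (product_stat mu Sigma (u i) (u' i)) w < prod_dev_const * Num.sqrt L].
Proof.
move=> Lc u1 u1'.
have sLc : Num.sqrt L <= c / 2.
  by rewrite -[leRHS]ger0_norm ?divr_ge0 ?(ltW c0)// -sqrtr_sqr ler_wsqrtr.
apply: finite_union_bound.
- move=> i; apply: (measurable_avg x_iid); exact: measurable_product_stat.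
- move=> i.
  apply: le_trans (tail_product_stat n_gt0 nu_gt0 Sh_sqrt y_iso x_iid _ (u1 i) (u1' i) (sqrtr_ge0 L) sLc) _.
  rewrite lee_fin ler_expR -[_ * Num.sqrt L * Num.sqrt L]mulrA -expr2 sqrtL2 -mulrBl mulrCA nL -/Kq.
  by rewrite /prod_dev_const; lra.
Qed.

Let Kq0 : 0 < Kq.
Proof.
have B1 := @sqmgf_bound_ge1 R.
have B0 : 0 < @sqmgf_bound R by apply: lt_le_trans B1.
apply: divr_gt0; last exact: exprn_gt0.
by apply: mulr_gt0 => //; apply: mulr_gt0 => //; exact: expR_gt0.
Qed.

(** A Chernoff parameter for products at deviation [1/2]: the first bound makes it admissible, the
    second gives [Kq a^2 - a / 2 <= - a / 4]. *)
Definition sparse_rate : R := Num.min (c / 2) (4 * Kq)^-1.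
Let a3 := sparse_rate.

Let a3_gt0 : 0 < a3.
Proof. by rewrite lt_min divr_gt0//= invr_gt0 mulr_gt0. Qed.

Let a3_quad : Kq * a3 ^+ 2 <= a3 / 4.
Proof.
have : a3 <= (4 * Kq)^-1 by rewrite ge_min lexx orbT.
have Kq4 : 0 < 4 * Kq by rewrite mulr_gt0.
rewrite -[leRHS]mul1r ler_pdivlMr// => h.
by have := ler_wpM2l (ltW a3_gt0) h; rewrite expr2; lra.
Qed.

(** The four bounds ensure, in order: [sqrt L <= 1]; [sqrt L] is an admissible parameter for
    products; the sparsity level is at least two; the exponent left after the union bound is at
    least [M ln p]. *)
Definition small_ratio : R :=
  Num.min (Num.min 1 ((c / 2) ^+ 2)) (Num.min (a3 / 64) (a3 / (8 * M))).

Lemma small_ratio_gt0 : 0 < small_ratio.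
Proof. by rewrite !lt_min ltr01 exprn_gt0 ?divr_gt0//= mulr_gt0. Qed.

(** Only the lower tail of the empirical form matters; it is the upper tail of the product statistic
    with one factor negated. The term [(v . dm)^2] undoes the centring at the sample mean. *)
Let sparse_event : L <= small_ratio -> exists s : nat, exists E : set T,
  [/\ (2 <= s)%N, (s%:R - 1)^-1 <= 32 / a3 * L, measurable E,
     (P E <= (expR (- (M * l)))%:E)%E &
    forall w, ~ E w -> forall q : seq (bool * 'I_p), size q = s ->
      let v := \sum_(e <- q) signed_basis e in
      quadf Sigma v / 2 <= quadf (sample_cov (sample w)) v + dotv v (dm w) ^+ 2].
Proof.
rewrite !le_min => /andP[_ /andP[La LM]].
(* [(2 p)^s] vectors, each failing with probability [expR (- n a3 / 4)] *)
pose z := a3 / (16 * L).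
have z4 : 4 <= z.
  have L16 : 0 < 16 * L by rewrite mulr_gt0.
  by rewrite ler_pdivlMr//; have := La; rewrite ler_pdivlMr//; lra.
pose s := Num.truncn z.
have /andP[sz zs] : s%:R <= z < s.+1%:R by apply: truncn_itv; lra.
rewrite -natr1 in zs.
have s2 : (2 <= s)%N by rewrite -(ler_nat R); lra.
exists s.
(* Steps may cancel and make the sum zero; then the inverse is [0] by convention, so [u] is still
   admissible. *)
pose u (q : s.-tuple (bool * 'I_p)) : 'cV[R]_p :=
  (Num.sqrt (quadf Sigma (\sum_(e <- q) signed_basis e)))^-1 *: \sum_(e <- q) signed_basis e.
have Sigma_ge0 v : 0 <= quadf Sigma v.
  by apply: le_trans (Sigma_coercive v); rewrite mulr_ge0 ?dotv_ge0// ltW.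
have u1 q : quadf Sigma (u q) <= 1.
  rewrite quadf_scale exprVn sqr_sqrtr//.
  set A := quadf Sigma _; have [->|h] := eqVneq A 0; first by rewrite mulr0.
  by rewrite mulVf.
have u1' q : quadf Sigma (sgn true (u q)) <= 1 by rewrite quadf_sgn.
have a3c : a3 <= c / 2 by rewrite ge_min lexx.
have [||E [mE PE hE]] := @finite_union_bound _ T R P (s.-tuple (bool * 'I_p))
  (fun q => avg x (product_stat mu Sigma (u q) (sgn true (u q))))
  (fun=> 2^-1) (expR (- (n%:R * (a3 / 4)))).
- move=> i; apply: (measurable_avg x_iid); exact: measurable_product_stat.
- move=> q.
  apply: le_trans (tail_product_stat n_gt0 nu_gt0 Sh_sqrt y_iso x_iid _ (u1 q) (u1' q) (ltW a3_gt0) a3c) _.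
  rewrite lee_fin ler_expR -[leRHS]mulrN ler_wpM2l ?(ltW nR0)// -/Kq.
  by have := a3_quad; lra.
exists E; split => //.
- have h1 : a3 / (32 * L) <= s%:R - 1.
    have -> : a3 / (32 * L) = z / 2 by rewrite /z; field; rewrite gt_eqF.
    by lra.
  have h2 : 0 < a3 / (32 * L) by rewrite divr_gt0// mulr_gt0.
  have -> : 32 / a3 * L = (a3 / (32 * L))^-1 by field; rewrite !gt_eqF.
  by rewrite lef_pV2 ?posrE//; apply: lt_le_trans h1.
- apply: le_trans PE _; rewrite lee_fin card_tuple card_prod card_bool card_ord natrX natrM.
  have p2 : (2 : R) <= p%:R by rewrite (ler_nat R 2).
  (* [2 p <= p^2], since [p >= 2]. *)
  apply: (@le_trans _ _ (expR (2 * l) ^+ s * expR (- (n%:R * (a3 / 4))))).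
    rewrite ler_wpM2r ?expR_ge0// lerXn2r ?nnegrE ?mulr_ge0 ?expR_ge0//.
    have -> : 2 * l = l + l by ring.
    by rewrite expRD -pE ler_wpM2r.
  rewrite -expRM_natl -expRD ler_expR.
  have h1 : s%:R * (2 * l) <= z * (2 * l) by rewrite ler_wpM2r// mulr_ge0// ltW.
  have h2 : z * (2 * l) = n%:R * a3 / 8.
    by rewrite /z -nL; field; rewrite gt_eqF.
  have h3 : M * l <= n%:R * a3 / 8.
    have M8 : 0 < 8 * M by rewrite mulr_gt0.
    have := LM; rewrite ler_pdivlMr// => h.
    by have := ler_wpM2l (ltW nR0) h; rewrite -nL; lra.
  by lra.
move=> w nE q qs /=; set v := \sum_(e <- q) _.
have [->|v0] := eqVneq (quadf Sigma v) 0.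
  rewrite mul0r addr_ge0 ?sqr_ge0//; exact: quadf_sample_cov_ge0.
have vgt : 0 < quadf Sigma v by rewrite lt_neqAle eq_sym v0 Sigma_ge0.
have qs' : size q == s by apply/eqP.
have := hE w nE (Tuple qs'); rewrite avg_prodE /u /sgn /= -/v expr1 !scaleN1r mulmxN dotvNr.
rewrite mulmxN dotvNr dotvNl -!scalemxAr !dotvZl !dotvZr -!quadfE.
set k := (Num.sqrt (quadf Sigma v))^-1.
have k2 : k * k = (quadf Sigma v)^-1 by rewrite -invfM -expr2 sqr_sqrtr// ltW.
set X := quadf (sample_cov _) v; set Z := dotv v (dm w).
have -> : - (k * (k * X)) + k * Z * - (k * Z) - - (k * (k * quadf Sigma v))
   = (k * k) * (quadf Sigma v) - (k * k) * (X + Z ^+ 2) by ring.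
rewrite k2 mulVf ?gt_eqF// => h.
have : 2^-1 <= (quadf Sigma v)^-1 * (X + Z ^+ 2) by lra.
by rewrite ler_pdivlMl// mulrC.
Qed.

Definition noise_const : R :=
  Num.sqrt cU * (mean_dev_const + (prod_dev_const + mean_dev_const ^+ 2)).
(** First summand: sampling loss, the diagonal bound [cU (1 + prod_dev_const)] over [s - 1]. Second:
    the cost of removing the rank-one term. *)
Definition curvature_const : R :=
  cU * (1 + prod_dev_const) * (32 / a3) + mean_dev_const ^+ 2 * cU.

Let Kl0 : 0 <= Kl.
Proof.
have B1 := @sqmgf_bound_ge1 R; have B0 : 0 <= @sqmgf_bound R by apply: le_trans B1.
have cc := ltW c0.
rewrite /Kl /mgf_lin_const -/c !addr_ge0//.
- by rewrite divr_ge0 ?sqr_ge0// !mulr_ge0// expR_ge0.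
- by rewrite divr_ge0 ?sqr_ge0// mulr_ge0.
- by rewrite invr_ge0 mulr_ge0.
Qed.

Lemma mean_dev_const_ge0 : 0 <= mean_dev_const.
Proof. by apply: addr_ge0; [exact: Kl0|apply: addr_ge0 => //; exact: ltW]. Qed.

Lemma prod_dev_const_ge0 : 0 <= prod_dev_const.
Proof. by apply: addr_ge0; [exact: ltW|apply: addr_ge0 => //; exact: ltW]. Qed.

Lemma curvature_const_ge0 : 0 <= curvature_const.
Proof.
have h1 := prod_dev_const_ge0; have h2 := ltW cU_gt0; have h3 := ltW a3_gt0.
apply: addr_ge0; last by rewrite mulr_ge0 ?sqr_ge0.
apply: mulr_ge0; last by apply: divr_ge0.
by apply: mulr_ge0 => //; apply: addr_ge0.
Qed.

(** Five events: coordinates of the mean, the mean along [alpha], coordinates of [sample_cov alpha],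
    the diagonal, sparse sums. Their probabilities add up to at most [6 + 2 / p] times [p^(-M)]. *)
Lemma lasso_event : L <= small_ratio -> exists E : set T,
  [/\ measurable E, (P E <= (8 * expR (- (M * l)))%:E)%E &
    forall w, ~ E w ->
     (forall j, `|(sample_mean (sample w) - sample_cov (sample w) *m alpha) j 0|
        <= noise_const * Num.sqrt ((1 + tt) * L)) /\
     (forall v, cL / 2 * dotv v v - curvature_const * L * lnorm 1 v ^+ 2
        <= quadf (sample_cov (sample w)) v)].
Proof.
move=> Ls; have := Ls; rewrite !le_min => /andP[/andP[L1 Lc] _].
have [E1 [mE1 PE1 hE1]] := mean_event.
have [E2 [mE2 PE2 hE2]] := lin_event (fun _ : unit => alpha1_le).
have sgnaxis i : quadf Sigma (sgn i.1 (axis i.2)) <= 1 by rewrite quadf_sgn.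
have [E3 [mE3 PE3 hE3]] := @prod_event (bool * 'I_p)%type
  (fun i => sgn i.1 (axis i.2)) (fun=> alpha1) Lc sgnaxis (fun=> alpha1_le).
have [E4 [mE4 PE4 hE4]] := prod_event Lc axis_le axis_le.
have [s [E5 [s2 sinv mE5 PE5 hE5]]] := sparse_event Ls.
exists (E1 `|` (E2 `|` (E3 `|` (E4 `|` E5)))).
have m45 := measurableU _ _ mE4 mE5; have m345 := measurableU _ _ mE3 m45.
have m2345 := measurableU _ _ mE2 m345.
split; first exact: measurableU.
  apply: le_trans (measureU2 P mE1 m2345) _.
  apply: le_trans (leeD PE1 (measureU2 P mE2 m345)) _.
  apply: le_trans (leeD2l _ (leeD PE2 (measureU2 P mE3 m45))) _.
  apply: le_trans (leeD2l _ (leeD2l _ (leeD PE3 (measureU2 P mE4 mE5)))) _.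
  apply: le_trans (leeD2l _ (leeD2l _ (leeD2l _ (leeD PE4 PE5)))) _.
  rewrite -!EFinD lee_fin card_unit card_prod card_bool card_ord natrM.
  have -> : expR (- ((M + 1) * l)) = expR (- (M * l)) / p%:R.
    by rewrite pE -expRN -expRD; congr expR; ring.
  set X := expR (- (M * l)); have X0 : 0 <= X by exact: expR_ge0.
  have p2 : (2 : R) <= p%:R by rewrite (ler_nat R 2).
  have pp : 0 < p%:R :> R by lra.
  have -> : 2 * p%:R * (X / p%:R) + (2 * 1%:R * (X / p%:R) + (2 * p%:R * (X / p%:R)
      + (p%:R * (X / p%:R) + X))) = 6 * X + 2 * X / p%:R by field; rewrite gt_eqF.
  have : 2 * X / p%:R <= 2 * X by rewrite ler_pdivrMr//; nra.
  by lra.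
move=> w nE.
have {}nE : [/\ ~ E1 w, ~ E2 w, ~ E3 w, ~ E4 w & ~ E5 w].
  by split=> h; apply: nE; [left|right; left|do 2 right; left|do 3 right; left|do 4 right].
case: nE => /hE1 g1 /hE2 g2 /hE3 g3 /hE4 g4 /hE5 g5.
have sL1 : Num.sqrt L <= 1 by rewrite -[leRHS]sqrtr1 ler_wsqrtr.
have sL0 := sqrtr_ge0 L.
set m1 := mean_dev_const in g1 g2 *; set m2 := prod_dev_const in g3 g4 *.
have m10 : 0 <= m1 := mean_dev_const_ge0; have m20 : 0 <= m2 := prod_dev_const_ge0.
have ga : `|dotv alpha (dm w)| <= m1 * Num.sqrt tt * Num.sqrt L.
  have := g2 Datatypes.tt; rewrite dotvZl normrM gtr0_norm ?invr_gt0// ler_pdivrMl//.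
  by move=> /le_trans; apply; rewrite le_eqVlt; apply/orP; left; apply/eqP; ring.
have gd j : `|dm w j 0| <= m1 * Num.sqrt cU * Num.sqrt L by exact: g1.
split.
  move=> j; set S := sample_cov _.
  have prodj : `|(S *m alpha) j 0 + dm w j 0 * dotv alpha (dm w) - mu j 0|
      <= Num.sqrt cU * Num.sqrt tt * (m2 * Num.sqrt L).
    have := @norm_lt_of_sgn ((Num.sqrt cU)^-1 * (Num.sqrt tt)^-1 *
      ((S *m alpha) j 0 + dm w j 0 * dotv alpha (dm w) - mu j 0)) (m2 * Num.sqrt L).
    rewrite normrM gtr0_norm ?mulr_gt0 ?invr_gt0// -invfM.
    rewrite ler_pdivrMl ?mulr_gt0//; apply => b.
    have := g3 (b, j); rewrite avg_prodE /sgn /= -!scalemxAr !dotvZl !dotvZr !dotv_delta.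
    rewrite Sigma_alpha invfM -/S => h.
    apply: le_lt_trans h; rewrite le_eqVlt; apply/orP; left; apply/eqP.
    by ring.
  (* [mu = Sigma alpha] cancels, which leaves the deviation of the mean, a product of two
     deviations, and a centred product statistic. *)
  have -> : (sample_mean (sample w) - S *m alpha) j 0
     = dm w j 0 + dm w j 0 * dotv alpha (dm w)
       - ((S *m alpha) j 0 + dm w j 0 * dotv alpha (dm w) - mu j 0).
    rewrite /dm [LHS]mxE [(- (S *m alpha)) j 0]mxE.
    have -> : (sample_mean (sample w) - mu) j 0 = sample_mean (sample w) j 0 - mu j 0.
      by rewrite mxE [(- mu) j 0]mxE.
    by ring.
  apply: le_trans (ler_normB _ _) _.
  apply: le_trans (lerD (ler_normD _ _) prodj) _.
  rewrite normrM [Num.sqrt ((1 + tt) * L)]sqrtrM; last by rewrite addr_ge0// ltW.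
  have prodd := ler_pM (normr_ge0 _) (normr_ge0 _) (gd j) ga.
  set A := Num.sqrt cU in gd prodd *; set t1 := Num.sqrt tt in prodd *.
  set sL := Num.sqrt L in sL1 sL0 gd prodd *; set t2 := Num.sqrt (1 + tt).
  have t12 : t1 <= t2 by rewrite ler_wsqrtr// lerDr.
  have t21 : 1 <= t2 by rewrite -[leLHS]sqrtr1 ler_wsqrtr// lerDl ltW.
  exact: (noise_arith (ltW scU) m10 m20 (ltW stt) t12 t21 sL0 sL1 (gd j) prodd (lexx _)).
move=> v; pose S := sample_cov (sample w).
(* Adding the rank-one term gives the uncentred form, to which the events apply. It is removed at
   the end through [|v . dm| <= |dm|_max |v|_1], another multiple of [L |v|_1^2]. *)
pose Q := S + dm w *m (dm w)^T - 2^-1 *: Sigma.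
have QE u : quadf Q u = quadf S u + dotv u (dm w) ^+ 2 - 2^-1 * quadf Sigma u.
  rewrite !quadfE /Q mulmxBl mulmxDl dotvBr dotvDr -[2^-1 *: Sigma *m u]scalemxAl.
  rewrite [dotv u (2^-1 *: _)]dotvZr -[dm w *m _ *m u]mulmxA.
  rewrite [(dm w)^T *m u]mx11_scalar mul_mx_scalar [dotv u (_ *: dm w)]dotvZr.
  by rewrite -/(dotv (dm w) u) [dotv (dm w) u]dotvC expr2.
have Qsym : symmx Q.
  have S_sym : S^T = S := sample_cov_sym (sample w).
  have h : (2^-1 *: Sigma)^T = 2^-1 *: Sigma by rewrite linearZ /= Sigma_sym.
  by rewrite /symmx /Q linearB linearD /= h S_sym trmx_mul trmxK.
have Qdiag j : Q j j <= cU * (1 + m2).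
  rewrite -quadf_delta QE !quadf_delta.
  have := g4 j; rewrite avg_prodE -!scalemxAr !dotvZl !dotvZr -!quadfE -/S !quadf_delta.
  set k := (Num.sqrt cU)^-1.
  have k2 : k * k = cU^-1 by rewrite -invfM -expr2 sqr_sqrtr// ltW.
  set z := dotv _ (dm w).
  have -> : k * (k * S j j) + k * z * (k * z) - k * (k * Sigma j j)
     = k * k * (S j j + z ^+ 2 - Sigma j j) by ring.
  rewrite k2 ltr_pdivrMl// => h.
  have h1 : m2 * Num.sqrt L <= m2 * 1 by apply: ler_wpM2l.
  have h2 := ler_wpM2l (ltW cU_gt0) h1.
  have h3 := Sigma_diag j.
  have h4 : 0 <= Sigma j j.
    rewrite -quadf_delta; apply: le_trans (Sigma_coercive _).
    by rewrite mulr_ge0 ?dotv_ge0// ltW.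
  exact: (diag_arith h h2 h3 h4).
have Qsparse (l' : seq (bool * 'I_p)) : size l' = s ->
    0 <= quadf Q (\sum_(e <- l') signed_basis e).
  by move=> /g5 /= h; rewrite QE subr_ge0 mulrC.
have := quadf_ge_of_sparse Qsym Qdiag v s2 Qsparse; rewrite QE -/S => main.
have vd : `|dotv v (dm w)| <= m1 * Num.sqrt cU * Num.sqrt L * lnorm 1 v.
  rewrite dotvE lnorm1E mulr_sumr; apply: le_trans (ler_norm_sum _ _ _) _.
  by apply: ler_sum => j _; rewrite normrM mulrC; apply: ler_wpM2r.
have vd2 : dotv v (dm w) ^+ 2 <= m1 ^+ 2 * cU * L * lnorm 1 v ^+ 2.
  have := ler_pM (normr_ge0 _) (normr_ge0 _) vd vd.
  rewrite -expr2 real_normK ?num_real// => /le_trans; apply.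
  rewrite -[X in _ <= _ * X * _ * _](sqr_sqrtr (ltW cU_gt0)) -[X in _ <= _ * X * _]sqrtL2.
  by rewrite le_eqVlt; apply/orP; left; apply/eqP; ring.
have c1 : cU * (1 + m2) / (s%:R - 1) * lnorm 1 v ^+ 2
    <= cU * (1 + m2) * (32 / a3) * L * lnorm 1 v ^+ 2.
  apply: ler_wpM2r; first exact: sqr_ge0.
  rewrite -[_ * (32 / a3) * L]mulrA.
  by apply: ler_wpM2l => //; apply: mulr_ge0; [exact: ltW|exact: addr_ge0].
have c2 := Sigma_coercive v.
rewrite /curvature_const -/m1 -/m2 -/S.
exact: (curvature_arith main vd2 c1 c2).
Qed.

End GoodEvents.

(** * Risk bounds *)

Section IntegralBounds.
Context {d} {T : measurableType d} {R : realType} (P : probability T R).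

Definition mean_le (f : T -> R) (b : R) : Prop :=
  [/\ measurable_fun [set: T] f, forall w, 0 <= f w & (\int[P]_w (f w)%:E <= b%:E)%E].

Lemma mean_leD f g a b : mean_le f a -> mean_le g b ->
  mean_le (fun w => f w + g w) (a + b).
Proof.
move=> [mf f0 fa] [mg g0 gb]; split.
- exact: measurable_funD.
- by move=> w; rewrite addr_ge0.
under eq_integral do rewrite EFinD.
rewrite ge0_integralD//.
- by rewrite EFinD; exact: leeD.
- by move=> w _; rewrite lee_fin.
- exact/measurable_EFinP.
- by move=> w _; rewrite lee_fin.
- exact/measurable_EFinP.
Qed.

Lemma mean_leZ f k a : 0 <= k -> mean_le f a -> mean_le (fun w => k * f w) (k * a).
Proof.
move=> k0 [mf f0 fa]; split.
- exact: measurable_funM.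
- by move=> w; rewrite mulr_ge0.
under eq_integral do rewrite EFinM.
rewrite ge0_integralZl//.
- by rewrite EFinM; apply: lee_wpmul2l; rewrite ?lee_fin.
- exact/measurable_EFinP.
- by move=> w _; rewrite lee_fin.
Qed.

Lemma mean_le_cst k : 0 <= k -> mean_le (fun=> k) k.
Proof.
by move=> k0; split => //; rewrite integral_cst//= probability_setT mule1.
Qed.

Lemma mean_le_indic A b : measurable A -> (P A <= b%:E)%E -> mean_le \1_A b.
Proof.
move=> mA PA; split; [exact: measurable_indic|by []|].
by rewrite integral_indic// setIT.
Qed.

Lemma mean_le_sum (I : Type) (s : seq I) (f : I -> T -> R) (b : I -> R) :
  (forall i, mean_le (f i) (b i)) ->
  mean_le (fun w => \sum_(i <- s) f i w) (\sum_(i <- s) b i).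
Proof.
move=> h; elim: s => [|i s IH].
  by rewrite big_nil; under [X in mean_le X]eq_fun do rewrite big_nil; exact: mean_le_cst.
rewrite big_cons; under [X in mean_le X]eq_fun do rewrite big_cons.
exact: mean_leD.
Qed.

Lemma mean_le_integral (f g : T -> R) (b : R) : measurable_fun [set: T] f -> (forall w, 0 <= f w) ->
  (forall w, f w <= g w) -> mean_le g b -> (\int[P]_w (f w)%:E <= b%:E)%E.
Proof.
move=> mf f0 fg [mg g0 gb]; apply: le_trans gb; exact: ge0_le_integral_EFin.
Qed.

End IntegralBounds.

Section MeasurableVectors.
Context {d} {T : measurableType d} {R : realType} {p : nat}.

Definition coordwise_measurable (f : T -> 'cV[R]_p) : Prop :=
  forall j, measurable_fun [set: T] (fun w => f w j 0).

Lemma random_vector_coordwise f : random_vector f -> coordwise_measurable f.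
Proof.
move=> mf j; under eq_fun do rewrite -dotv_delta.
exact: measurable_random_dotv.
Qed.

Lemma coordwise_cst u : coordwise_measurable (fun=> u).
Proof. by move=> j; exact: measurable_cst. Qed.

Lemma coordwiseB f g : coordwise_measurable f -> coordwise_measurable g ->
  coordwise_measurable (fun w => f w - g w).
Proof.
move=> mf mg j; under eq_fun => w do rewrite mxE [(- g w) j 0]mxE.
exact: measurable_funB.
Qed.

Lemma coordwise_dotv f g : coordwise_measurable f -> coordwise_measurable g ->
  measurable_fun [set: T] (fun w => dotv (f w) (g w)).
Proof.
move=> mf mg; under eq_fun do rewrite dotvE.
by apply: measurable_sum => j; exact: measurable_funM.
Qed.

Context {n : nat}.
Variables (x : 'I_n -> T -> 'cV[R]_p) (a : T -> 'cV[R]_p).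
Hypothesis mx : forall i, coordwise_measurable (x i).
Hypothesis ma : coordwise_measurable a.

Lemma coordwise_sample_mean : coordwise_measurable (fun w => sample_mean (x^~ w)).
Proof.
move=> j; under eq_fun do rewrite mxE summxE.
by apply: measurable_funM => //; apply: measurable_sum => i; exact: mx.
Qed.

Lemma measurable_theta_est : measurable_fun [set: T] (fun w => theta_est (x^~ w) (a w)).
Proof.
rewrite /theta_est; under eq_fun do rewrite quadfE dotv_sample_cov_raw.
apply: measurable_funB.
  by apply: measurable_funM => //; apply: coordwise_dotv => //; exact: coordwise_sample_mean.
apply: measurable_funM => //; apply: measurable_sum => i; apply: measurable_funM;
  by apply: coordwise_dotv => //; apply: coordwiseB => //; exact: coordwise_sample_mean.
Qed.

End MeasurableVectors.

Lemma two_dotv_le {R : realType} {p : nat} (u v : 'cV[R]_p) (s : R) : 0 < s ->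
  2 * `|dotv u v| <= s * dotv u u + s^-1 * dotv v v.
Proof.
move=> s0.
have h (e : R) : e ^+ 2 = 1 -> 2 * (e * dotv u v) <= s * dotv u u + s^-1 * dotv v v.
  move=> e2; have := dotv_ge0 (s *: u - e *: v).
  rewrite !dotvBl !dotvBr !dotvZl !dotvZr [dotv v u]dotvC => h.
  have : 0 <= s^-1 * (s * (s * dotv u u) - s * (e * dotv u v) - (e * (s * dotv u v) - e * (e * dotv v v))).
    by rewrite mulr_ge0// invr_ge0 ltW.
  have -> : s^-1 * (s * (s * dotv u u) - s * (e * dotv u v) - (e * (s * dotv u v) - e * (e * dotv v v)))
     = s * dotv u u - 2 * (e * dotv u v) + s^-1 * (e ^+ 2 * dotv v v) by field; rewrite gt_eqF.
  by rewrite e2 mul1r => h'; rewrite -subr_ge0; apply: le_trans h' _; rewrite le_eqVlt; apply/orP; left; apply/eqP; ring.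
have [z0|z0] := leP 0 (dotv u v).
  by rewrite ger0_norm//; have := h 1 (expr1n _ _); rewrite mul1r.
by rewrite ltr0_norm//; have := h (-1) (sqrr_sign _ 1); rewrite mulN1r.
Qed.

(** With [s = sqrt n], a second moment of order [1 / n] gives a first moment of order [n^(-1/2)]. *)
Lemma abs_le_sq {R : realType} (z s : R) : 0 < s -> 2 * `|z| <= s * z ^+ 2 + s^-1.
Proof.
move=> s0; have h : 0 <= s^-1 * (s * `|z| - 1) ^+ 2 by rewrite mulr_ge0 ?sqr_ge0// invr_ge0 ltW.
have E : s^-1 * (s * `|z| - 1) ^+ 2 = s * z ^+ 2 + s^-1 - 2 * `|z|.
  by rewrite -[z ^+ 2](real_normK (num_real z)); field; rewrite gt_eqF.
by rewrite E subr_ge0 in h.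
Qed.

Lemma risk_arith {R : realType} (C1r st tt ri Cl Cq X1 X3 S3 KD KU Zr : R) :
  0 <= Cl -> 0 <= Cq -> 0 <= KD -> 0 <= KU -> 0 <= st * ri -> 0 <= tt * ri ->
  X1 <= st * Cl * ri + tt * Cl * ri -> X3 <= Zr + KD * st * ri ->
  C1r + (st * ri + tt / 2 * ri) + X1 + tt / 2 * Cq * ri + X3 + KU * Cl * st * ri
    <= C1r + Zr + (2 + 2 * Cl + Cq + KD + KU * Cl) * ((tt + st) * ri).
Proof.
move=> Cl0 Cq0 KD0 KU0 s0 t0 h1 h3.
have k1 := mulr_ge0 Cl0 s0; have k2 := mulr_ge0 Cl0 t0; have k3 := mulr_ge0 Cq0 s0.
have k4 := mulr_ge0 Cq0 t0; have k5 := mulr_ge0 KD0 t0.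
have k6 := mulr_ge0 (mulr_ge0 KU0 Cl0) t0.
by lra.
Qed.

Lemma weights_arith {R : realType} (c z1 z2 r W : R) :
  0 <= z2 * r -> 0 <= (c + z1) * W -> c * r + z1 * r + z2 * W <= (c + z1 + z2) * (r + W).
Proof. by move=> *; lra. Qed.

(** * From bounds off a bad event to expected losses, for both regimes *)

Section RiskOfEvent.
Context {R : realType} {p n : nat} {d d'} {T : measurableType d} {T' : measurableType d'}.
Variables (P : probability T R) (P' : probability T' R).
Variables (nu cL cU K A D C1 tt lam gam rate pd : R).
Variables (y : T' -> 'cV[R]_p) (x : 'I_n -> T -> 'cV[R]_p) (a : T -> 'cV[R]_p).
Variables (mu alpha : 'cV[R]_p) (Sigma Sh : 'M[R]_p) (E : set T).
Hypothesis n_gt0 : (0 < n)%N.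
Hypothesis p_gt0 : (0 < p)%N.
Hypothesis nu_gt0 : 0 < nu.
Hypothesis cL_gt0 : 0 < cL.
Hypothesis cU_gt0 : 0 < cU.
Hypothesis tt_gt0 : 0 < tt.
Hypothesis K_gt0 : 0 < K.
Hypothesis A_ge0 : 0 <= A.
Hypothesis D_ge0 : 0 <= D.
Hypothesis C1_ge0 : 0 <= C1.
Hypothesis rate_ge0 : 0 <= rate.
Hypothesis gam_ge0 : 0 <= gam.
Hypothesis lam_ge0 : 0 <= lam.
Hypothesis gam_le : gam <= K * Num.sqrt tt.
Hypothesis Sh_sqrt : is_sqrtmx Sigma Sh.
Hypothesis y_iso : isotropic_subgaussian P' nu y.
Hypothesis x_iid : iid_copies P x P' (fun w => Sh *m y w + mu).
Hypothesis Sigma_coercive : forall v, cL * dotv v v <= quadf Sigma v.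
Hypothesis Sigma_diag : forall j, Sigma j j <= cU.
Hypothesis Sigma_alpha : Sigma *m alpha = mu.
Hypothesis alpha_le : quadf Sigma alpha <= tt.
Hypothesis mu_le : forall j, mu j 0 ^+ 2 <= cU * tt.
Hypothesis a_rv : random_vector a.
Hypothesis a_min : forall w, lasso_argmin lam gam (x^~ w) (a w).
Hypothesis pd_ge0 : 0 <= pd.
Hypothesis pd_le1 : pd <= 1.
Hypothesis pd_le : tt * pd <= A * rate.
Hypothesis mE : measurable E.
Hypothesis PE : (P E <= (D * (pd / p%:R))%:E)%E.

Let theta := quadf Sigma alpha.
Let g w := theta_est (x^~ w) (a w).
Let g0 w := theta_est (x^~ w) alpha.
Hypothesis off_sq : forall w, ~ E w -> dotv (a w - alpha) (a w - alpha) <= C1 * rate.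
Hypothesis off_val : forall w, ~ E w -> `|g w - theta| <= C1 * rate + `|g0 w - theta|.

Let pR1 : 1 <= p%:R :> R. Proof. by rewrite ler1n. Qed.
Let pR0 : 0 < p%:R :> R. Proof. by rewrite ltr0n. Qed.
Let nR0 : 0 < n%:R :> R. Proof. by rewrite ltr0n. Qed.
Let nR1 : 1 <= n%:R :> R. Proof. by rewrite ler1n. Qed.
Let rn : R := Num.sqrt n%:R.
Let rn0 : 0 < rn. Proof. by rewrite sqrtr_gt0. Qed.
Let rn2 : rn ^+ 2 = n%:R. Proof. by rewrite sqr_sqrtr// ltW. Qed.
Let st : R := Num.sqrt tt.
Let st0 : 0 < st. Proof. by rewrite sqrtr_gt0. Qed.
Let st2 : st ^+ 2 = tt. Proof. by rewrite sqr_sqrtr// ltW. Qed.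

Let Sigma_ge0 v : 0 <= quadf Sigma v.
Proof. by apply: le_trans (Sigma_coercive v); rewrite mulr_ge0 ?dotv_ge0// ltW. Qed.

Let aa w : dotv (a w) (a w) <= K ^+ 2 * tt.
Proof.
have [h _] := a_min w; rewrite -lnorm2_sqr -st2 -exprMn.
by rewrite ler_pXn2r ?nnegrE ?lnorm_ge0 ?mulr_ge0 ?(ltW K_gt0) ?(ltW st0)//; apply: le_trans gam_le.
Qed.

Let alal : dotv alpha alpha <= tt / cL.
Proof. by rewrite ler_pdivlMr// mulrC; apply: le_trans alpha_le. Qed.

Let mcw i : coordwise_measurable (x i).
Proof. by apply: random_vector_coordwise; case: x_iid. Qed.
Let acw : coordwise_measurable a. Proof. exact: random_vector_coordwise. Qed.

Definition risk_const : R := C1 + 2 * (K ^+ 2 + cL^-1) * D * A.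

(** On [E] the squared error is at most a multiple of [tt], and [tt * pd] is at most [A * rate]. *)
Lemma risk_sq :
  (\int[P]_w (dotv (a w - alpha) (a w - alpha))%:E <= (risk_const * rate)%:E)%E.
Proof.
set B := 2 * (K ^+ 2 + cL^-1).
have B0 : 0 <= B by rewrite mulr_ge0// addr_ge0 ?sqr_ge0// invr_ge0 ltW.
have big w : dotv (a w - alpha) (a w - alpha) <= B * tt.
  have h := dotv_ge0 (a w + alpha).
  rewrite dotvDl !dotvDr [dotv alpha (a w)]dotvC in h.
  rewrite dotvBl !dotvBr [dotv alpha (a w)]dotvC.
  have h1 := aa w; have h2 := alal; rewrite /B.
  have -> : 2 * (K ^+ 2 + cL^-1) * tt = 2 * (K ^+ 2 * tt) + 2 * (tt / cL) by ring.
  by move: h h1 h2; move: (dotv (a w) (a w)) (dotv alpha alpha) (dotv (a w) alpha) (K ^+ 2 * tt) (tt / cL) => *; lra.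
have bnd := mean_leD (@mean_le_cst _ T R P (C1 * rate) (mulr_ge0 C1_ge0 rate_ge0))
  (mean_leZ (mulr_ge0 B0 (ltW tt_gt0)) (mean_le_indic mE PE)).
apply: (@le_trans _ _ (C1 * rate + B * tt * (D * (pd / p%:R)))%:E).
  apply: (mean_le_integral _ _ _ bnd).
  - by apply: coordwise_dotv; apply: coordwiseB => //; exact: coordwise_cst.
  - by move=> w; exact: dotv_ge0.
  move=> w; rewrite indicE; case: (boolP (w \in E)) => [|/negP wE] /=.
    by move=> _; rewrite mulr1; apply: le_trans (big w) _; rewrite lerDr mulr_ge0.
  by rewrite mulr0 addr0; apply: off_sq => h; apply: wE; rewrite inE.
rewrite lee_fin /risk_const -/B mulrDl lerD2l.
have -> : B * tt * (D * (pd / p%:R)) = B * D * (tt * pd) / p%:R by ring.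
rewrite ler_pdivrMr//.
have BD : 0 <= B * D by exact: mulr_ge0.
have h := ler_wpM2l BD pd_le.
apply: le_trans h _.
have -> : B * D * (A * rate) = B * D * A * rate * 1 by ring.
by apply: (ler_wpM2l (mulr_ge0 (mulr_ge0 BD A_ge0) rate_ge0)).
Qed.

Let Cl : R := linear_sq_const nu.
Let Cq : R := product_sq_const nu.
Let al1 : 'cV[R]_p := st^-1 *: alpha.
Let al1_le : quadf Sigma al1 <= 1.
Proof. by rewrite quadf_scale exprVn st2 ler_pdivrMl// mulr1. Qed.

Let dm w := sample_mean (x^~ w) - mu.
Let U w := avg x (linear_stat mu al1) w.
Let V w := avg x (product_stat mu Sigma al1 al1) w.

Let UE w : dotv alpha (dm w) = st * U w.
Proof.
rewrite /U /avg /linear_stat -(dotv_sample_mean _ _ n_gt0) dotvZl.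
by rewrite mulrA mulfV ?gt_eqF// mul1r.
Qed.

Let VE w : quadf (sample_cov (x^~ w)) alpha = tt * V w + theta - tt * U w ^+ 2.
Proof.
rewrite quadfE (dotv_sample_cov _ mu n_gt0) -/(dm w) UE /V /avg /product_stat.
rewrite sumrB sumr_const card_ord -mulr_natl.
have -> : \sum_(i < n) dotv al1 (x i w - mu) * dotv al1 (x i w - mu)
    = tt^-1 * \sum_(i < n) dotv alpha (x i w - mu) * dotv alpha (x i w - mu).
  rewrite mulr_sumr; apply: eq_bigr => i _; rewrite !dotvZl -st2.
  by field; rewrite gt_eqF.
have -> : dotv al1 (Sigma *m al1) = tt^-1 * theta.
  by rewrite -quadfE quadf_scale exprVn st2.
by rewrite -st2; field; rewrite !gt_eqF.
Qed.

(** With [U] and [V] the normalised deviations of the mean and of the second moment along [alpha],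
    the error is exactly [2 st U - tt V + tt U^2]. *)
Let g0_le w : `|g0 w - theta| <= st * (rn * U w ^+ 2 + rn^-1)
   + tt / 2 * (rn * V w ^+ 2 + rn^-1) + tt * U w ^+ 2.
Proof.
have thetaE : dotv alpha mu = theta by rewrite -Sigma_alpha /theta quadfE.
have -> : g0 w - theta = 2 * (st * U w) - tt * V w + tt * U w ^+ 2.
  rewrite /g0 /theta_est VE [dotv _ alpha]dotvC.
  have -> : dotv alpha (sample_mean (x^~ w)) = theta + st * U w.
    by rewrite -UE /dm dotvBr thetaE addrC subrK.
  by ring.
have hU := abs_le_sq (U w) rn0; have hV := abs_le_sq (V w) rn0.
have tt0 := ltW tt_gt0; have s0 := ltW st0.
apply: le_trans (ler_normD _ _) _; apply: lerD; last first.
  by rewrite ger0_norm// mulr_ge0// sqr_ge0.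
apply: le_trans (ler_normB _ _) _; apply: lerD.
  rewrite normrM ger0_norm// normrM (ger0_norm s0) mulrCA.
  exact: ler_wpM2l.
rewrite normrM (ger0_norm tt0) -mulrA; apply: ler_wpM2l => //.
by rewrite ler_pdivlMl.
Qed.

(* AM-GM weight making [hh * E |dm|^2] and [P E / hh] both [O(n^(-1/2))] *)
Let hh : R := rn / p%:R.
Let hh0 : 0 < hh. Proof. exact: divr_gt0. Qed.

(** [theta_est] lies between [0] and twice [mean . a], so second moments of the mean suffice.
    Bounding [mu . mu] coordinatewise costs the factor [p], which the [1 / p] in the bound on [P E]
    compensates. *)
Let g_bad w : `|g w - theta| <= p%:R * (cU + K ^+ 2) * tt + tt
   + K * st * (hh * dotv (dm w) (dm w) + hh^-1).
Proof.
have gge := @theta_est_ge0 _ _ _ _ _ _ _ gam_ge0 lam_ge0 (a_min w).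
have gle := theta_est_le (x^~ w) (a w).
have muE : sample_mean (x^~ w) = mu + dm w by rewrite /dm addrC subrK.
rewrite muE dotvDl in gle.
have h1 := two_dotv_le mu (a w) ltr01.
have Ks : 0 < K * st by exact: mulr_gt0.
have h2 := two_dotv_le (dm w) (a w) (mulr_gt0 Ks hh0).
have h3 : (K * st * hh)^-1 * dotv (a w) (a w) <= K * st * hh^-1.
  have -> : K * st * hh^-1 = (K * st * hh)^-1 * (K ^+ 2 * tt).
    by rewrite -st2; field; rewrite !gt_eqF.
  by apply: ler_wpM2l => //; rewrite invr_ge0 ltW// mulr_gt0.
have h4 : dotv mu mu <= p%:R * (cU * tt).
  rewrite dotvE; apply: (@le_trans _ _ (\sum_(j < p) cU * tt)).
    by apply: ler_sum => j _; rewrite -expr2.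
  by rewrite sumr_const card_ord mulr_natl.
have h5 : K ^+ 2 * tt <= p%:R * (K ^+ 2 * tt).
  by rewrite ler_peMl// mulr_ge0 ?sqr_ge0// ltW.
have h6 := aa w.
have t1 := ler_norm (dotv mu (a w)); have t2 := ler_norm (dotv (dm w) (a w)).
apply: le_trans (ler_normB _ _) _; rewrite (ger0_norm gge) ger0_norm ?Sigma_ge0//.
have h7 : theta <= tt := alpha_le.
rewrite invr1 !mul1r in h1.
have -> : p%:R * (cU + K ^+ 2) * tt = p%:R * (cU * tt) + p%:R * (K ^+ 2 * tt) by ring.
have -> : K * st * (hh * dotv (dm w) (dm w) + hh^-1)
  = K * st * hh * dotv (dm w) (dm w) + K * st * hh^-1 by ring.
rewrite -/g in gle *.
move: gle h1 h2 h3 h4 h5 h6 t1 t2 h7.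
move: (g w) theta (dotv mu (a w)) (dotv (dm w) (a w)) `|dotv mu (a w)| `|dotv (dm w) (a w)|.
move: (dotv mu mu) (dotv (a w) (a w)) (K * st * hh * dotv (dm w) (dm w))
  ((K * st * hh)^-1 * dotv (a w) (a w)) (K * st * hh^-1) (p%:R * (cU * tt))
  (p%:R * (K ^+ 2 * tt)) (K ^+ 2 * tt) => *.
lra.
Qed.

Let dm_sq : mean_le P (fun w => dotv (dm w) (dm w)) (p%:R * (cU * (Cl / n%:R))).
Proof.
have scU : 0 < Num.sqrt cU by rewrite sqrtr_gt0.
pose axis (j : 'I_p) : 'cV[R]_p := (Num.sqrt cU)^-1 *: delta_mx j 0.
have ax1 j : quadf Sigma (axis j) <= 1.
  rewrite quadf_scale quadf_delta exprVn sqr_sqrtr ?(ltW cU_gt0)//.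
  by rewrite ler_pdivrMl// mulr1.
have h j : mean_le P (fun w => cU * avg x (linear_stat mu (axis j)) w ^+ 2) (cU * (Cl / n%:R)).
  apply: mean_leZ; first exact: ltW.
  split.
  - by apply: measurable_funX; apply: (measurable_avg x_iid); exact: measurable_linear_stat.
  - by move=> w; exact: sqr_ge0.
  - exact: (second_moment_linear_stat n_gt0 nu_gt0 Sh_sqrt y_iso x_iid).
have := mean_le_sum (index_enum 'I_p) h.
rewrite sumr_const card_ord -[_ *+ p]mulr_natl.
congr mean_le; apply/funext => w.
rewrite dotvE; apply: eq_bigr => j _.
rewrite /avg /linear_stat -(dotv_sample_mean _ _ n_gt0) dotvZl dotv_delta -/(dm w).
by rewrite exprMn exprVn sqr_sqrtr ?(ltW cU_gt0)// mulrA mulfV ?gt_eqF// mul1r expr2.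
Qed.

Definition risk_val_const : R :=
  C1 + (cU + K ^+ 2 + 1) * D * A + (2 + 2 * Cl + Cq + K * D + K * cU * Cl).

Let Cl0 : 0 <= Cl.
Proof. by rewrite divr_ge0 ?sqr_ge0// mulr_ge0// expR_ge0. Qed.
Let Cq0 : 0 <= Cq.
Proof. by rewrite divr_ge0 ?sqr_ge0// mulr_ge0// expR_ge0. Qed.

Lemma risk_val : (\int[P]_w (`|g w - theta|)%:E
    <= (risk_val_const * (rate + (tt + st) / rn))%:E)%E.
Proof.
have tt0 := ltW tt_gt0; have s0 := ltW st0; have r0 := ltW rn0; have K0 := ltW K_gt0.
have h0 := ltW hh0; have cU0 := ltW cU_gt0; have p0 := ltW pR0.
have ri0 : 0 <= rn^-1 by rewrite invr_ge0.
have hi0 : 0 <= hh^-1 by rewrite invr_ge0.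
have mU : mean_le P (fun w => U w ^+ 2) (Cl / n%:R).
  split.
  - by apply: measurable_funX; apply: (measurable_avg x_iid); exact: measurable_linear_stat.
  - by move=> w; exact: sqr_ge0.
  - exact: (second_moment_linear_stat n_gt0 nu_gt0 Sh_sqrt y_iso x_iid).
have mV : mean_le P (fun w => V w ^+ 2) (Cq / n%:R).
  split.
  - by apply: measurable_funX; apply: (measurable_avg x_iid); exact: measurable_product_stat.
  - by move=> w; exact: sqr_ge0.
  - exact: (second_moment_product_stat n_gt0 nu_gt0 Sh_sqrt y_iso x_iid).
(* One function dominates the loss on and off [E]; [c0] to [c4] are its coefficients on [1], [U^2],
   [V^2], the indicator of [E] and [dm . dm]. *)
pose c0 := C1 * rate + (st / rn + tt / 2 / rn).
pose c1 := st * rn + tt.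
pose c2 := tt / 2 * rn.
pose c3 := p%:R * (cU + K ^+ 2) * tt + tt + K * st * hh^-1.
pose c4 := K * st * hh.
have c00 : 0 <= c0 by rewrite !addr_ge0// ?mulr_ge0.
have c10 : 0 <= c1 by rewrite addr_ge0// mulr_ge0.
have c20 : 0 <= c2 by rewrite mulr_ge0// divr_ge0.
have c30 : 0 <= c3 by rewrite !addr_ge0// !mulr_ge0// addr_ge0// sqr_ge0.
have c40 : 0 <= c4 by rewrite !mulr_ge0.
have bnd := mean_leD (mean_leD (mean_leD (mean_leD (@mean_le_cst _ T R P c0 c00)
  (mean_leZ c10 mU)) (mean_leZ c20 mV)) (mean_leZ c30 (mean_le_indic mE PE))) (mean_leZ c40 dm_sq).
apply: (@le_trans _ _ (c0 + c1 * (Cl / n%:R) + c2 * (Cq / n%:R) + c3 * (D * (pd / p%:R))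
   + c4 * (p%:R * (cU * (Cl / n%:R))))%:E).
  apply: (mean_le_integral _ _ _ bnd).
  - apply: measurableT_comp => //; apply: measurable_funB => //.
    exact: measurable_theta_est.
  - by move=> w; exact: normr_ge0.
  move=> w.
  have n1 : 0 <= c1 * U w ^+ 2 by rewrite mulr_ge0 ?sqr_ge0.
  have n2 : 0 <= c2 * V w ^+ 2 by rewrite mulr_ge0 ?sqr_ge0.
  have n4 : 0 <= c4 * dotv (dm w) (dm w) by rewrite mulr_ge0 ?dotv_ge0.
  rewrite indicE; case: (boolP (w \in E)) => [_|/negP wE] /=.
    apply: le_trans (g_bad w) _; rewrite mulr1.
    have -> : p%:R * (cU + K ^+ 2) * tt + tt + K * st * (hh * dotv (dm w) (dm w) + hh^-1)
      = c3 + c4 * dotv (dm w) (dm w) by rewrite /c3 /c4; ring.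
    by rewrite lerD2r lerDr; exact: (addr_ge0 (addr_ge0 c00 n1) n2).
  have nE : ~ E w by move=> h; apply: wE; rewrite inE.
  apply: le_trans (off_val nE) _.
  apply: le_trans (lerD (lexx _) (g0_le w)) _.
  rewrite mulr0 addr0.
  have -> : C1 * rate + (st * (rn * U w ^+ 2 + rn^-1) + tt / 2 * (rn * V w ^+ 2 + rn^-1) + tt * U w ^+ 2)
     = c0 + c1 * U w ^+ 2 + c2 * V w ^+ 2 by rewrite /c0 /c1 /c2; ring.
  by rewrite lerDl.
rewrite lee_fin.
have rn1 : 1 <= rn by rewrite -[leLHS]sqrtr1 ler_wsqrtr.
have ri1 : rn^-1 <= 1 by rewrite invf_le1.
have nE : n%:R^-1 = rn^-1 * rn^-1 by rewrite -invfM -expr2 rn2.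
have b1 : c1 * (Cl / n%:R) <= st * Cl * rn^-1 + tt * Cl * rn^-1.
  have -> : c1 * (Cl / n%:R) = st * Cl * rn^-1 + tt * Cl * rn^-1 * rn^-1.
    by rewrite /c1 nE; field; rewrite gt_eqF.
  by rewrite lerD2l ler_piMr//; exact: mulr_ge0 (mulr_ge0 tt0 Cl0) ri0.
have b2 : c2 * (Cq / n%:R) = tt / 2 * Cq * rn^-1.
  by rewrite /c2 nE; field; rewrite gt_eqF.
have b4 : c4 * (p%:R * (cU * (Cl / n%:R))) = K * cU * Cl * st * rn^-1.
  by rewrite /c4 /hh nE; field; rewrite !gt_eqF.
have b3 : c3 * (D * (pd / p%:R)) <= (cU + K ^+ 2 + 1) * D * A * rate + K * D * st * rn^-1.
  have -> : c3 * (D * (pd / p%:R)) = (cU + K ^+ 2) * D * (tt * pd) + D * (tt * pd) * p%:R^-1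
     + K * D * st * rn^-1 * pd.
    by rewrite /c3 /hh; field; rewrite !gt_eqF.
  have q0 : 0 <= (cU + K ^+ 2) * D by rewrite mulr_ge0// addr_ge0// sqr_ge0.
  have k1 := ler_wpM2l q0 pd_le.
  have k2 : D * (tt * pd) * p%:R^-1 <= D * (A * rate).
    apply: (@le_trans _ _ (D * (tt * pd))); last exact: ler_wpM2l.
    by rewrite ler_piMr ?mulr_ge0// invf_le1.
  have k3 : K * D * st * rn^-1 * pd <= K * D * st * rn^-1.
    by rewrite ler_piMr// !mulr_ge0.
  have -> : (cU + K ^+ 2 + 1) * D * A * rate = (cU + K ^+ 2) * D * (A * rate) + D * (A * rate) by ring.
  by rewrite lerD// lerD.
have w0 : 0 <= (tt + st) / rn by rewrite divr_ge0// addr_ge0.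
have tr0 : 0 <= tt * rn^-1 by rewrite mulr_ge0.
have sr0 : 0 <= st * rn^-1 by rewrite mulr_ge0.
apply: (@le_trans _ _ (C1 * rate + (cU + K ^+ 2 + 1) * D * A * rate
   + (2 + 2 * Cl + Cq + K * D + K * cU * Cl) * ((tt + st) / rn))); last first.
  have z1 : 0 <= (cU + K ^+ 2 + 1) * D * A.
    apply: mulr_ge0 => //; apply: mulr_ge0 => //.
    by rewrite addr_ge0// addr_ge0// sqr_ge0.
  have z2 : 0 <= 2 + 2 * Cl + Cq + K * D + K * cU * Cl.
    have k1 := mulr_ge0 K0 D_ge0; have k2 := mulr_ge0 (mulr_ge0 K0 cU0) Cl0.
    by move: Cl0 Cq0 k1 k2; move: Cl Cq (K * D) (K * cU) => *; lra.
  have h1 := mulr_ge0 z2 rate_ge0; have h2 := mulr_ge0 (addr_ge0 C1_ge0 z1) w0.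
  exact: weights_arith.
rewrite b2 b4; apply: risk_arith b1 b3 => //; exact: mulr_ge0.
Qed.

End RiskOfEvent.

(** * Rates and regimes *)

Section Rates.
Context {R : realType}.
Variables (q t rho L : R).
Hypothesis (q_gt0 : 0 < q) (q_le1 : q <= 1) (t_gt0 : 0 < t) (L_gt0 : 0 < L).

Definition risk_rate : R := (1 + t) `^ (1 - q / 2) * rho * L `^ (1 - q / 2).

Let t1 : 0 < 1 + t. Proof. by rewrite addr_gt0. Qed.
Let e0 : 0 < q / 2. Proof. by rewrite divr_gt0. Qed.
Let e1 : 0 <= 1 - q / 2. Proof. by have := q_le1; lra. Qed.

Lemma threshold_powR : Num.sqrt ((1 + t) * L) `^ (- q) = (1 + t) `^ (- (q / 2)) * L `^ (- (q / 2)).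
Proof.
have tL : 0 <= (1 + t) * L by rewrite mulr_ge0// ltW.
rewrite -powR12_sqrt// -powRrM -powRM ?(ltW t1) ?(ltW L_gt0)//.
by congr (_ `^ _); field.
Qed.

Lemma powR_sub (z : R) : 0 < z -> z `^ (- (q / 2)) * z = z `^ (1 - q / 2).
Proof.
move=> z0; rewrite addrC powRD ?powRr1 ?(ltW z0)//.
by apply/implyP => _; rewrite gt_eqF.
Qed.

Lemma risk_rate_threshold :
  rho * Num.sqrt ((1 + t) * L) `^ (- q) * Num.sqrt ((1 + t) * L) ^+ 2 = risk_rate.
Proof.
rewrite threshold_powR sqr_sqrtr; last by rewrite mulr_ge0// ltW.
by rewrite /risk_rate -!powR_sub//; ring.
Qed.

Lemma sparsity_threshold :
  L * (rho * Num.sqrt ((1 + t) * L) `^ (- q))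
    = rho * (1 + t) `^ (- (q / 2)) * L `^ (1 - q / 2).
Proof. by rewrite threshold_powR -powR_sub//; ring. Qed.

(** The left side is the maximum of [t^(1 - q/2)] and [1]. This turns the assumed lower bound on the
    rate into [t p^(-delta) <= A * risk_rate]. *)
Lemma signal_mul_max_le :
  t * Num.max (t `^ (- (q / 2))) t^-1 <= (1 + t) `^ (1 - q / 2).
Proof.
have t0 := ltW t_gt0.
rewrite maxr_pMr// ge_max; apply/andP; split.
  rewrite mulrC powR_sub//; apply: ge0_ler_powR; rewrite ?nnegrE ?(ltW t1)//.
  by rewrite lerDr.
have one : (1 : R) `^ (1 - q / 2) = 1 by rewrite powR1.
rewrite mulfV ?gt_eqF// -[leLHS]one.
by apply: ge0_ler_powR; rewrite ?nnegrE ?(ltW t1)// lerDl.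
Qed.

Lemma signal_le_rate (pd A : R) : 0 <= A -> 0 <= rho ->
  pd <= A * (rho * L `^ (1 - q / 2) * Num.max (t `^ (- (q / 2))) t^-1) ->
  t * pd <= A * risk_rate.
Proof.
move=> A0 rho0 /(ler_wpM2l (ltW t_gt0)) /le_trans; apply.
have c0 : 0 <= A * (rho * L `^ (1 - q / 2)) by rewrite !mulr_ge0// powR_ge0.
have := ler_wpM2l c0 signal_mul_max_le; rewrite /risk_rate.
by move: (Num.max _ _) ((1 + t) `^ _) (L `^ _) => *; lra.
Qed.

(** [t = t^(1 - q/2) t^(q/2)]: the first factor is below that of the rate, the second is at most
    [cU^(q/2) rho], and the factor in [L] is bounded below. *)
Lemma signal_le_rate_of_ratio (cU c : R) : 0 < cU -> 0 < c -> c <= L ->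
  (t / cU) `^ (q / 2) <= rho ->
  t <= cU `^ (q / 2) * (c `^ (1 - q / 2))^-1 * risk_rate.
Proof.
move=> cU0 c0 cL trho.
have t0 := ltW t_gt0.
have cp : 0 < c `^ (1 - q / 2) by exact: powR_gt0.
have Up : 0 < cU `^ (q / 2) by exact: powR_gt0.
have h1 : t `^ (1 - q / 2) <= (1 + t) `^ (1 - q / 2).
  by apply: ge0_ler_powR; rewrite ?nnegrE ?(ltW t1)// lerDr.
have h2 : c `^ (1 - q / 2) <= L `^ (1 - q / 2).
  by apply: ge0_ler_powR; rewrite ?nnegrE ?(ltW c0) ?(ltW L_gt0).
have h3 : t `^ (q / 2) / cU `^ (q / 2) <= rho.
  have <- : cU^-1 `^ (q / 2) = (cU `^ (q / 2))^-1.
    by rewrite -powR_inv1 ?(ltW cU0)// -powRrM mulN1r powRN.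
  by rewrite -powRM// invr_ge0 ltW.
have tE : t = t `^ (1 - q / 2) * t `^ (q / 2).
  rewrite -powRD ?subrK ?powRr1//.
  by apply/implyP => _; rewrite gt_eqF.
have : t `^ (1 - q / 2) * (t `^ (q / 2) / cU `^ (q / 2)) * c `^ (1 - q / 2) <= risk_rate.
  have k1 : 0 <= t `^ (q / 2) / cU `^ (q / 2) by apply: divr_ge0; exact: powR_ge0.
  rewrite /risk_rate; apply: ler_pM => //; first by apply: mulr_ge0 => //; exact: powR_ge0.
    exact: powR_ge0.
  by apply: ler_pM => //; exact: powR_ge0.
have k0 : 0 <= cU `^ (q / 2) * (c `^ (1 - q / 2))^-1 by rewrite mulr_ge0// ?invr_ge0 ltW.
move=> /(ler_wpM2l k0); apply: le_trans.
rewrite {1}tE le_eqVlt; apply/orP; left; apply/eqP.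
by field; rewrite !gt_eqF.
Qed.

End Rates.

(** Each term of [R_tilde] is matched with one term of [tau_tilde]: [t / cU <= t / cL] with
    [p >= 1], and [(r^(2/q))^(q/2) = r]. *)
Lemma R_tilde_ge {R : realType} (q cL cU r t : R) (p : nat) :
  0 < q -> q <= 1 -> 0 < cL -> cL < cU -> 0 < r -> 0 < t -> (0 < p)%N ->
  (tau_tilde q cU r t / cU) `^ (q / 2) <= R_tilde q cL r t p.
Proof.
move=> q0 q1 cL0 cLU r0 t0 p0.
have cU0 : 0 < cU by apply: lt_trans cLU.
have e0 : 0 <= q / 2 by rewrite divr_ge0// ltW.
have tt0 : 0 <= tau_tilde q cU r t.
  by rewrite le_min (ltW t0) mulr_ge0 ?powR_ge0// ltW.
have ttU : 0 <= tau_tilde q cU r t / cU by rewrite divr_ge0// ltW.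
rewrite /R_tilde le_min; apply/andP; split.
  apply: (@le_trans _ _ (1 * (cL^-1 * t) `^ (q / 2))).
    have cLt0 : 0 <= cL^-1 * t by rewrite mulr_ge0 ?invr_ge0 ?(ltW cL0) ?(ltW t0).
    rewrite mul1r; apply: ge0_ler_powR => //.
    have iU : cU^-1 <= cL^-1 by rewrite lef_pV2 ?posrE// ltW.
    have ttt : tau_tilde q cU r t <= t by rewrite ge_min lexx orbT.
    have iU0 : 0 <= cU^-1 by rewrite invr_ge0 ltW.
    by rewrite mulrC; apply: ler_pM.
  rewrite powRM ?invr_ge0 ?(ltW cL0) ?(ltW t0)// -[cL^-1]powR_inv1 ?(ltW cL0)//.
  rewrite -powRrM mulN1r mulrA; apply: ler_wpM2r; first exact: powR_ge0.
  apply: ler_wpM2r; first exact: powR_ge0.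
  have one : (1 : R) `^ (1 - q / 2) = 1 by rewrite powR1.
  rewrite -[leLHS]one; apply: ge0_ler_powR; rewrite ?nnegrE//; last by rewrite ler1n.
  by lra.
apply: (@le_trans _ _ ((r `^ (2 / q)) `^ (q / 2))).
  apply: ge0_ler_powR; rewrite ?nnegrE ?powR_ge0//.
  by rewrite ler_pdivrMr// mulrC ge_min lexx.
rewrite -powRrM; have -> : 2 / q * (q / 2) = 1 by field; rewrite gt_eqF.
by rewrite powRr1// ltW.
Qed.

(** * Bad events for large and for small [L] *)

Section Regimes.
Context {R : realType} {p n : nat} {d d'} {T : measurableType d} {T' : measurableType d'}.
Variables (P : probability T R) (P' : probability T' R).
Variables (q nu cL cU M K tt rho lam gam K0 : R).
Variables (y : T' -> 'cV[R]_p) (x : 'I_n -> T -> 'cV[R]_p) (a : T -> 'cV[R]_p).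
Variables (mu alpha : 'cV[R]_p) (Sigma Sh : 'M[R]_p).
Hypothesis n_gt0 : (0 < n)%N.
Hypothesis p_gt1 : (1 < p)%N.
Hypothesis q_gt0 : 0 < q.
Hypothesis q_le1 : q <= 1.
Hypothesis nu_gt0 : 0 < nu.
Hypothesis cL_gt0 : 0 < cL.
Hypothesis cU_gt0 : 0 < cU.
Hypothesis M_gt0 : 0 < M.
Hypothesis tt_gt0 : 0 < tt.
Hypothesis rho_gt0 : 0 < rho.
Hypothesis K_gt0 : 0 < K.
Hypothesis gam_ge0 : 0 <= gam.
Hypothesis Sh_sqrt : is_sqrtmx Sigma Sh.
Hypothesis y_iso : isotropic_subgaussian P' nu y.
Hypothesis x_iid : iid_copies P x P' (fun w => Sh *m y w + mu).
Hypothesis Sigma_sym : symmx Sigma.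
Hypothesis Sigma_coercive : forall v, cL * dotv v v <= quadf Sigma v.
Hypothesis Sigma_diag : forall j, Sigma j j <= cU.
Hypothesis Sigma_alpha : Sigma *m alpha = mu.
Hypothesis alpha_le : quadf Sigma alpha <= tt.
Hypothesis alpha_weak : \sum_i `|alpha i 0| `^ q <= rho.
Hypothesis mu_le : forall j, mu j 0 ^+ 2 <= cU * tt.
Hypothesis a_min : forall w, lasso_argmin lam gam (x^~ w) (a w).

Let L : R := log_ratio p n.
Let X : R := Num.sqrt ((1 + tt) * L).
Let c0 : R := small_ratio nu M.
Let rate : R := risk_rate q tt rho L.
Let theta := quadf Sigma alpha.
Let g w := theta_est (x^~ w) (a w).
Let g0 w := theta_est (x^~ w) alpha.

Hypothesis lam_lo : K0 * X <= lam.
Hypothesis lam_hi : lam <= K * X.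

Let L0 : 0 < L.
Proof. by rewrite /L divr_gt0 ?ltr0n// ln_gt0// ltr1n. Qed.
Let t1 : 0 < 1 + tt. Proof. by rewrite addr_gt0. Qed.
Let X0 : 0 < X.
Proof. by rewrite sqrtr_gt0; exact: mulr_gt0. Qed.
Let c0_gt0 : 0 < c0. Proof. exact: small_ratio_gt0. Qed.

Definition large_ratio_const : R :=
  (cL^-1 + 1) * (cU `^ (q / 2) * (c0 `^ (1 - q / 2))^-1).

Let alal : dotv alpha alpha <= cL^-1 * tt.
Proof. by rewrite ler_pdivlMl//; apply: le_trans alpha_le. Qed.

(** [tt c0 <= (1 + tt) L] makes [sqrt tt] a multiple of the penalty scale [X]. Hence both [mu] and
    its estimation error stay below [lam], and the errors become those of the zero estimator. *)
Lemma large_ratio_event : c0 <= L -> (tt / cU) `^ (q / 2) <= rho ->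
  1 + 2 * (mean_dev_const nu M * Num.sqrt cU) + 2 * (Num.sqrt cU / Num.sqrt c0) <= K0 ->
  exists E : set T, [/\ measurable E, (P E <= (2 * expR (- (M * ln p%:R)))%:E)%E,
    forall w, ~ E w -> dotv (a w - alpha) (a w - alpha) <= large_ratio_const * rate &
    forall w, ~ E w -> `|g w - theta| <= large_ratio_const * rate + `|g0 w - theta|].
Proof.
move=> cL0 trho K0big.
have [E [mE PE hE]] := mean_event M n_gt0 p_gt1 nu_gt0 cU_gt0 Sh_sqrt y_iso x_iid Sigma_diag.
have tt_rate := signal_le_rate_of_ratio q_le1 tt_gt0 L0 cU_gt0 c0_gt0 cL0 trho.
rewrite -/rate in tt_rate.
have lcE : large_ratio_const * rate
    = cL^-1 * (cU `^ (q / 2) * (c0 `^ (1 - q / 2))^-1 * rate)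
      + cU `^ (q / 2) * (c0 `^ (1 - q / 2))^-1 * rate.
  by rewrite /large_ratio_const; ring.
have icL : 0 <= cL^-1 by rewrite invr_ge0 ltW.
have m10 := mean_dev_const_ge0 nu_gt0 M_gt0.
have sU0 := sqrtr_ge0 cU.
have sc0 : 0 < Num.sqrt c0 by rewrite sqrtr_gt0.
have X_L : Num.sqrt L <= X by rewrite ler_wsqrtr// ler_peMl ?(ltW L0)// lerDl ltW.
have X_t : Num.sqrt tt <= X / Num.sqrt c0.
  rewrite ler_pdivlMr// -sqrtrM ?(ltW tt_gt0)// ler_wsqrtr//.
  by apply: ler_pM; rewrite ?(ltW tt_gt0) ?(ltW c0_gt0)// lerDr.
have lam0 : 0 < lam.
  apply: lt_le_trans lam_lo; apply: mulr_gt0 => //; apply: lt_le_trans K0big.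
  by rewrite -addrA ltr_pwDl// addr_ge0// mulr_ge0// ?mulr_ge0// divr_ge0// ltW.
have a0 w : ~ E w -> a w = 0.
  move=> nE; apply: (@lasso_eq0 _ _ _ _ _ _ _ gam_ge0 (ltW lam0) (a_min w)
    (mean_dev_const nu M * Num.sqrt cU * Num.sqrt L + Num.sqrt cU * Num.sqrt tt)) => //.
    move=> j; have -> : sample_mean (x^~ w) j 0 = (sample_mean (x^~ w) - mu) j 0 + mu j 0.
      by rewrite [in RHS]mxE [(- mu) j 0]mxE subrK.
    apply: le_trans (ler_normD _ _) _; apply: lerD; first exact: hE.
    rewrite -sqrtrM ?(ltW cU_gt0)// -[leLHS]sqrtr_sqr.
    by rewrite ler_wsqrtr.
  apply: lt_le_trans lam_lo.
  have h1 : mean_dev_const nu M * Num.sqrt cU * Num.sqrt L <= mean_dev_const nu M * Num.sqrt cU * X.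
    by apply: ler_wpM2l => //; exact: mulr_ge0.
  have h2 : Num.sqrt cU * Num.sqrt tt <= Num.sqrt cU / Num.sqrt c0 * X.
    by rewrite -mulrA [_^-1 * X]mulrC; exact: ler_wpM2l.
  have h3 := ler_wpM2r (ltW X0) K0big.
  have h4 : 0 <= mean_dev_const nu M * Num.sqrt cU * X by rewrite mulr_ge0// ?mulr_ge0// ltW.
  have h5 : 0 <= Num.sqrt cU / Num.sqrt c0 * X by rewrite mulr_ge0// ?divr_ge0// ltW.
  move: h1 h2 h3 h4 h5 X0.
  move: (mean_dev_const nu M * Num.sqrt cU) (Num.sqrt cU / Num.sqrt c0) (Num.sqrt L)
    (Num.sqrt cU * Num.sqrt tt) X => *; lra.
exists E; split => //.
- apply: le_trans PE _; rewrite lee_fin.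
  have pE : p%:R = expR (ln p%:R) :> R by rewrite lnK// posrE ltr0n ltnW.
  rewrite {1}pE -mulrA -expRD le_eqVlt; apply/orP; left; apply/eqP.
  by congr (_ * expR _); ring.
- move=> w /a0 ->; rewrite sub0r dotvNl dotvNr opprK lcE.
  apply: le_trans alal _; apply: (@le_trans _ _ (cL^-1 * (cU `^ (q / 2) * (c0 `^ (1 - q / 2))^-1 * rate))).
    exact: ler_wpM2l.
  by rewrite lerDl; apply: le_trans tt_rate; exact: ltW.
move=> w nE; rewrite /g (a0 w nE) /theta_est quadf0 dotv0r mulr0 subrr sub0r normrN.
have th0 : 0 <= theta by apply: le_trans (Sigma_coercive _); rewrite mulr_ge0 ?dotv_ge0// ltW.
have h : 0 <= cU `^ (q / 2) * (c0 `^ (1 - q / 2))^-1 * rate by apply: le_trans tt_rate; exact: ltW.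
rewrite ger0_norm// lcE; apply: le_trans alpha_le _; apply: le_trans tt_rate _.
by rewrite -addrA addrCA lerDl addr_ge0// mulr_ge0.
Qed.

Definition small_ratio_const : R :=
  lasso_sq_const (cL / 2) K + lasso_val_const (cL / 2) K.

Lemma small_ratio_const_ge :
  0 <= lasso_sq_const (cL / 2) K /\ 0 <= lasso_val_const (cL / 2) K.
Proof.
have k0 : 0 <= cL / 2 by rewrite divr_ge0// ltW.
have K1 := ltW K_gt0.
have h : 0 <= lasso_sq_const (cL / 2) K.
  apply: mulr_ge0; first exact: divr_ge0.
  apply: addr_ge0; last exact: divr_ge0.
  apply: addr_ge0; last exact: mulr_ge0.
  by apply: divr_ge0 => //; apply: mulr_ge0 => //; exact: sqr_ge0.
split => //.
rewrite /lasso_val_const; apply: addr_ge0; last exact: mulr_ge0.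
apply: addr_ge0; last exact: mulr_ge0.
by apply: divr_ge0 => //; apply: mulr_ge0 => //; exact: sqr_ge0.
Qed.

(** [K0 >= 2 noise_const] keeps the noise below [lam / 2]; the radius [gam] makes [alpha] a feasible
    comparison point. *)
Lemma small_ratio_event : L <= c0 -> lnorm 2 alpha <= gam ->
  2 * noise_const nu cU M <= K0 ->
  32 * curvature_const nu cU M * (rho * (1 + tt) `^ (- (q / 2)) * L `^ (1 - q / 2))
    <= cL / 2 / 4 -> 0 < K0 ->
  exists E : set T, [/\ measurable E, (P E <= (8 * expR (- (M * ln p%:R)))%:E)%E,
    forall w, ~ E w -> dotv (a w - alpha) (a w - alpha) <= small_ratio_const * rate &
    forall w, ~ E w -> `|g w - theta| <= small_ratio_const * rate + `|g0 w - theta|].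
Proof.
move=> Lc agam K0big small K0pos.
have [E [mE PE hE]] := lasso_event n_gt0 p_gt1 nu_gt0 cL_gt0 cU_gt0 M_gt0 tt_gt0
  Sh_sqrt y_iso x_iid Sigma_sym Sigma_coercive Sigma_diag Sigma_alpha alpha_le Lc.
have lam0 : 0 < lam by apply: lt_le_trans lam_lo; exact: mulr_gt0.
have G0 := curvature_const_ge0 nu_gt0 cU_gt0 M_gt0.
have rate0 : 0 <= rate.
  by rewrite /rate /risk_rate !mulr_ge0 ?powR_ge0// ltW.
have [s1 s2] := small_ratio_const_ge.
have main w : ~ E w -> dotv (a w - alpha) (a w - alpha) <= lasso_sq_const (cL / 2) K * rate /\
    `|g w - g0 w| <= lasso_val_const (cL / 2) K * rate.
  move=> /hE[noise re].
  have kap0 : 0 < cL / 2 by rewrite divr_gt0.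
  have Gam0 : 0 <= curvature_const nu cU M * L by rewrite mulr_ge0// ltW.
  have noise' j : `|(sample_mean (x^~ w) - sample_cov (x^~ w) *m alpha) j 0| <= lam / 2.
    apply: le_trans (noise j) _; rewrite ler_pdivlMr//.
    apply: le_trans lam_lo; rewrite mulrAC.
    by apply: ler_wpM2r; [exact: ltW|rewrite mulrC].
  have small' : 32 * (curvature_const nu cU M * L) * (rho * X `^ (- q)) <= cL / 2 / 4.
    apply: le_trans small; rewrite -sparsity_threshold//.
    by rewrite le_eqVlt; apply/orP; left; apply/eqP; ring.
  have := lasso_rate q_gt0 q_le1 kap0 Gam0 X0 rho_gt0 lam0 lam_hi alpha_weak (a_min w)
    agam noise' re small'.
  by rewrite /= risk_rate_threshold.
exists E; split => //.
- move=> w /main[h _]; apply: le_trans h _.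
  by apply: ler_wpM2r => //; rewrite lerDl.
- move=> w /main[_ h].
  have -> : g w - theta = (g w - g0 w) + (g0 w - theta) by rewrite addrA subrK.
  apply: le_trans (ler_normD _ _) _; rewrite lerD2r; apply: le_trans h _.
  by apply: ler_wpM2r => //; rewrite lerDr.
Qed.

End Regimes.

Theorem theorem4 (R : realType) (q nu cL cU delta : R)
    (q_gt0 : 0 < q) (q_le1 : q <= 1) (nu_gt0 : 0 < nu)
    (cL_gt0 : 0 < cL) (cL_lt_cU : cL < cU) (delta_gt0 : 0 < delta) :
  exists2 K0 : R, 0 < K0 &
  forall (K : R) (p : nat -> nat) (r tau lam gam : nat -> R),
  let tt n := tau_tilde q cU (r n) (tau n) in
  let rt n := R_tilde q cL (r n) (tau n) (p n) in
  let L n := log_ratio (p n) n in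
  K0 <= K ->
  (forall n, (0 < n)%N -> (0 < p n)%N /\ 0 < r n /\ 0 < tau n) ->
  (fun n => rt n * (1 + tt n) `^ (- (q / 2)) * L n `^ (1 - q / 2)) @ \oo --> 0 ->
  (exists2 A : R, 0 < A & forall n, (0 < n)%N ->
     (p n)%:R `^ (- delta)
       <= A * (rt n * L n `^ (1 - q / 2)
               * Num.max (tt n `^ (- (q / 2))) (tt n)^-1)) ->
  (forall n, (0 < n)%N ->
     K0 * Num.sqrt ((1 + tt n) * ln (p n)%:R / n%:R) <= lam n
       <= K * Num.sqrt ((1 + tt n) * ln (p n)%:R / n%:R)) ->
  (forall n, (0 < n)%N ->
     K0 * Num.sqrt (tt n) <= gam n <= K * Num.sqrt (tt n)) ->
  exists2 C : R, 0 < C &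
  forall n, (0 < n)%N ->
  forall (mu : 'cV[R]_(p n)) (Sigma Sigma_half : 'M[R]_(p n)),
  param_space q cL cU (r n) (tau n) mu Sigma ->
  is_sqrtmx Sigma Sigma_half ->
  forall (d d' : measure_display)
    (T : measurableType d) (P : probability T R)
    (T' : measurableType d') (P' : probability T' R)
    (y : T' -> 'cV[R]_(p n)) (x : 'I_n -> T -> 'cV[R]_(p n))
    (alpha_est : T -> 'cV[R]_(p n)),
  isotropic_subgaussian P' nu y ->
  iid_copies P x P' (fun w => Sigma_half *m y w + mu) ->
  random_vector alpha_est ->
  (forall w, lasso_argmin (lam n) (gam n) (x^~ w) (alpha_est w)) ->
  let alpha := invmx Sigma *m mu in
  let theta := quadf (invmx Sigma) mu in
  ('E_P[(fun w => lnorm 2 (alpha_est w - alpha) ^+ 2)%R]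
     <= (C * ((1 + tt n) `^ (1 - q / 2) * rt n * L n `^ (1 - q / 2)))%:E)%E
  /\
  ('E_P[(fun w => `|theta_est (x^~ w) (alpha_est w) - theta|)%R]
     <= (C * ((1 + tt n) `^ (1 - q / 2) * rt n * L n `^ (1 - q / 2)
              + (tt n + Num.sqrt (tt n)) / Num.sqrt n%:R))%:E)%E.
Proof.
(* [p^(-M) = p^(-delta) / p], the extra [1 / p] being the one spent on the bad event. *)
pose M := delta + 1.
have M0 : 0 < M by rewrite addr_gt0.
have cU0 : 0 < cU by apply: lt_trans cL_lt_cU.
pose c0 := small_ratio nu M.
have c00 : 0 < c0 by exact: small_ratio_gt0.
pose b1 := mean_dev_const nu M * Num.sqrt cU.
pose b2 := Num.sqrt cU / Num.sqrt c0.
pose b3 := Num.max (noise_const nu cU M) 0.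
pose b4 := (Num.sqrt cL)^-1.
have b10 : 0 <= b1 by rewrite mulr_ge0// ?sqrtr_ge0//; exact: mean_dev_const_ge0.
have b20 : 0 <= b2 by rewrite divr_ge0// sqrtr_ge0.
have b30 : 0 <= b3 by rewrite le_max lexx orbT.
have b3n : noise_const nu cU M <= b3 by rewrite le_max lexx.
have b40 : 0 <= b4 by rewrite invr_ge0 sqrtr_ge0.
(* [b1] and [b2] make the estimator vanish for large [L], [b3] dominates the noise for small [L],
   and [b4] gives [|alpha|_2 <= gam] through [cL |alpha|_2^2 <= tt]. *)
pose K0 := 1 + 2 * b1 + 2 * b2 + 2 * b3 + b4.
have K0_gt0 : 0 < K0 by rewrite /K0; clearbody b1 b2 b3 b4; lra.
have K0a : 1 + 2 * b1 + 2 * b2 <= K0 by rewrite /K0; clearbody b1 b2 b3 b4; lra.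
have K0b : 2 * noise_const nu cU M <= K0.
  by apply: (@le_trans _ _ (2 * b3)); [exact: ler_wpM2l|rewrite /K0; clearbody b1 b2 b3 b4; lra].
have K0c : b4 <= K0 by rewrite /K0; clearbody b1 b2 b3 b4; lra.
clearbody K0.
exists K0 => // K p r tau lam gam tt rt L K0K pos lim [A A0 pdA] lamB gamB.
have K_gt0 : 0 < K by apply: lt_le_trans K0K.
pose G := curvature_const nu cU M.
have G0 : 0 <= G by exact: curvature_const_ge0.
have tt_gt0 n : (0 < n)%N -> 0 < tt n.
  by move=> /pos[_ [r0 t0]]; rewrite lt_min t0 mulr_gt0// powR_gt0.
have rt_gt0 n : (0 < n)%N -> 0 < rt n.
  by move=> /pos[p0 [r0 t0]]; rewrite lt_min r0 !mulr_gt0// powR_gt0// ltr0n.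
(* For [p = 1] the logarithm is zero, and the lower bound on the rate would read [1 <= 0]. *)
have p_gt1 n : (0 < n)%N -> (1 < p n)%N.
  move=> n0; have [p0 _] := pos n n0; rewrite ltn_neqAle p0 andbT.
  apply/eqP => p1; have := pdA n n0.
  rewrite /L /log_ratio -p1 ln1 mul0r powR0 ?mulr0 ?mul0r ?mulr0.
    by rewrite powR1 ler10.
  by apply: lt0r_neq0; have := q_le1; lra.
have [N hN] : exists N : nat, forall n, (N <= n)%N ->
    32 * G * (rt n * (1 + tt n) `^ (- (q / 2)) * L n `^ (1 - q / 2)) <= cL / 2 / 4.
  have e0 : 0 < cL / 2 / 4 / (32 * G + 1) by rewrite !divr_gt0// ltr_wpDl// mulr_ge0.
  have /cvgr0Pnorm_lt/(_ _ e0)[N _ hN] := lim; exists N => n Nn.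
  have := hN n Nn => /=; set z := rt n * _ * _ => zb.
  have zb2 : z <= cL / 2 / 4 / (32 * G + 1) by apply: le_trans (ler_norm _) (ltW zb).
  have G1 : 0 < 32 * G + 1 by rewrite ltr_wpDl// mulr_ge0.
  rewrite ler_pdivlMr// in zb2.
  have [z0|z0] := leP 0 z; first by move: zb2 z0; clear; clearbody z G; lra.
  apply: (@le_trans _ _ 0); last by rewrite !divr_ge0// ltW.
  by rewrite mulr_ge0_le0// ?mulr_ge0// ltW.
(* The term of index [n < N] makes [D p^(-delta) / p] at least [1], so the whole space is an
   admissible bad event; [10] covers the factors [2] and [8] of the two regimes. *)
pose D := 10 + \sum_(i < N) (p i)%:R * (p i)%:R `^ delta.
have D0 : 0 <= \sum_(i < N) (p i)%:R * (p i)%:R `^ delta :> R.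
  by apply: sumr_ge0 => i _; rewrite mulr_ge0// powR_ge0.
have D_ge0 : 0 <= D by rewrite addr_ge0.
pose Ca := large_ratio_const q nu cL cU M.
pose Cb := small_ratio_const cL K.
have Ca0 : 0 <= Ca.
  by rewrite mulr_ge0 ?addr_ge0 ?invr_ge0 ?(ltW cL_gt0)// mulr_ge0 ?invr_ge0 ?powR_ge0.
have Cb0 : 0 <= Cb by have [h1 h2] := small_ratio_const_ge cL_gt0 K_gt0; exact: addr_ge0.
pose C1 := Ca + Cb.
have C10 : 0 <= C1 by exact: addr_ge0.
pose Cs := risk_const cL K A D C1.
pose Cv := risk_val_const nu cU K A D C1.
exists (`|Cs| + `|Cv| + 1); first by rewrite ltr_wpDl// addr_ge0.
move=> n n0 mu Sigma Sh par Sh_sqrt d d' T P T' P' y x a y_iso x_iid a_rv a_min alpha theta.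
have [p0 [r0 t0]] := pos n n0.
have p1 := p_gt1 n n0; have ttn := tt_gt0 n n0; have rtn := rt_gt0 n n0.
have coer := param_coercive p0 par.
have diag := param_diag par.
have Sal : Sigma *m alpha = mu := param_mulmx par.
have al_le : quadf Sigma alpha <= tt n := param_theta_le p0 q_gt0 q_le1 par.
have weak := param_sum_powR_le p0 q_gt0 q_le1 cL_gt0 par.
have mu_le := param_mu_sq_le p0 q_gt0 q_le1 par.
have thE : theta = quadf Sigma alpha := param_theta par.
have Ssym : symmx Sigma by case: par => -[].
have l0 : 0 < ln (p n)%:R :> R by rewrite ln_gt0// ltr1n.
have Ln : 0 < L n by rewrite divr_gt0// ltr0n.
have [lam_lo lam_hi] : K0 * Num.sqrt ((1 + tt n) * L n) <= lam n /\
    lam n <= K * Num.sqrt ((1 + tt n) * L n).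
  by have /andP[] := lamB n n0; rewrite /L /log_ratio -mulrA.
have /andP[gam_lo gam_hi] := gamB n n0.
have gam_ge0 : 0 <= gam n by apply: le_trans gam_lo; rewrite mulr_ge0 ?sqrtr_ge0// ltW.
have lam_ge0 : 0 <= lam n by apply: le_trans lam_lo; rewrite mulr_ge0 ?sqrtr_ge0// ltW.
have agam : lnorm 2 alpha <= gam n.
  apply: le_trans gam_lo; apply: (@le_trans _ _ (b4 * Num.sqrt (tt n))); last first.
    by apply: ler_wpM2r => //; exact: sqrtr_ge0.
  rewrite ler_pdivlMl ?sqrtr_gt0// lnorm2E -sqrtrM ?(ltW cL_gt0)// ler_wsqrtr//.
  exact: le_trans (coer _) al_le.
pose pd : R := (p n)%:R `^ (- delta).
have pd0 : 0 <= pd by exact: powR_ge0.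
have pR : 0 < (p n)%:R :> R by rewrite ltr0n.
have pdE : pd / (p n)%:R = expR (- (M * ln (p n)%:R)).
  rewrite /pd /powR gt_eqF// -[X in _ / X]lnK ?posrE// -expRN -expRD.
  by congr expR; rewrite /M; ring.
have pd1 : pd <= 1.
  rewrite /pd /powR gt_eqF// -[leRHS]expR0 ler_expR mulNr oppr_le0.
  by apply: mulr_ge0; exact: ltW.
pose rate := risk_rate q (tt n) (rt n) (L n).
have rate0 : 0 <= rate by rewrite !mulr_ge0 ?powR_ge0// ltW.
have pd_le : tt n * pd <= A * rate.
  by apply: (signal_le_rate q_le1 ttn (ltW A0) (ltW rtn)); exact: pdA.
pose g w := theta_est (x^~ w) (a w).
pose g0 w := theta_est (x^~ w) alpha.
have [E [mE PE off1 off2]] : exists E : set T, [/\ measurable E,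
    (P E <= (D * (pd / (p n)%:R))%:E)%E,
    forall w, ~ E w -> dotv (a w - alpha) (a w - alpha) <= C1 * rate &
    forall w, ~ E w -> `|g w - quadf Sigma alpha| <= C1 * rate + `|g0 w - quadf Sigma alpha|].
  have [nN|Nn] := ltnP n N.
    exists setT; split; [exact: measurableT| |by move=> w /(_ I)|by move=> w /(_ I)].
    rewrite probability_setT lee_fin.
    have oneE : 1 = (p n)%:R * (p n)%:R `^ delta * (pd / (p n)%:R) :> R.
      rewrite /pd powRN; field.
      by rewrite !gt_eqF// powR_gt0.
    rewrite [leLHS]oneE; apply: ler_wpM2r; first by rewrite divr_ge0.
    rewrite /D (bigD1 (Ordinal nN))//= addrCA lerDl addr_ge0//.
    by apply: sumr_ge0 => i _; rewrite mulr_ge0// powR_ge0.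
  have mono (C D' : R) (B : set T) : C <= C1 -> D' <= D -> measurable B ->
      (P B <= (D' * expR (- (M * ln (p n)%:R)))%:E)%E ->
      (forall w, ~ B w -> dotv (a w - alpha) (a w - alpha) <= C * rate) ->
      (forall w, ~ B w -> `|g w - quadf Sigma alpha| <= C * rate + `|g0 w - quadf Sigma alpha|) ->
      exists E : set T, [/\ measurable E, (P E <= (D * (pd / (p n)%:R))%:E)%E,
        forall w, ~ E w -> dotv (a w - alpha) (a w - alpha) <= C1 * rate &
        forall w, ~ E w -> `|g w - quadf Sigma alpha| <= C1 * rate + `|g0 w - quadf Sigma alpha|].
    move=> CC1 DD mB PB o1 o2; have CR := ler_wpM2r rate0 CC1.
    exists B; split => //.
    - by apply: le_trans PB _; rewrite pdE lee_fin ler_wpM2r// expR_ge0.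
    - by move=> w /o1 h; exact: le_trans h CR.
    - by move=> w /o2 h; apply: le_trans h _; rewrite lerD2r.
  have [cLn|Lnc] := leP c0 (L n).
    have trho : (tt n / cU) `^ (q / 2) <= rt n by exact: R_tilde_ge.
    have [B [mB PB o1 o2]] := large_ratio_event n0 p1 q_le1 nu_gt0 cL_gt0 cU0 M0 ttn
      gam_ge0 Sh_sqrt y_iso x_iid coer diag al_le mu_le a_min lam_lo cLn trho K0a.
    apply: (mono Ca 2 B) => //; first by rewrite lerDl.
    by rewrite /D; lra.
  have [B [mB PB o1 o2]] := small_ratio_event n0 p1 q_gt0 q_le1 nu_gt0 cL_gt0 cU0 M0 ttn rtn
    K_gt0 Sh_sqrt y_iso x_iid Ssym coer diag Sal al_le weak a_min lam_lo lam_hi (ltW Lnc)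
    agam K0b (hN n Nn) K0_gt0.
  apply: (mono Cb 8 B) => //; first by rewrite lerDr.
  by rewrite /D; lra.
have sq := risk_sq p0 cL_gt0 ttn K_gt0 (ltW A0) D_ge0 C10 rate0 gam_hi coer al_le a_rv a_min
  pd_le mE PE off1.
have vl := risk_val n0 p0 nu_gt0 cL_gt0 cU0 ttn K_gt0 (ltW A0) D_ge0 C10 rate0 gam_ge0
  lam_ge0 gam_hi Sh_sqrt y_iso x_iid coer diag Sal al_le mu_le a_rv a_min pd0 pd1 pd_le mE PE off2.
have Cs1 : Cs <= `|Cs| + `|Cv| + 1.
  by apply: le_trans (ler_norm _) _; rewrite -addrA lerDl addr_ge0.
have Cv1 : Cv <= `|Cs| + `|Cv| + 1.
  by apply: le_trans (ler_norm _) _; rewrite addrAC lerDr addr_ge0.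
rewrite unlock; split.
  under eq_integral do rewrite lnorm2_sqr.
  apply: le_trans sq _; rewrite lee_fin; exact: ler_wpM2r.
rewrite thE; apply: le_trans vl _; rewrite lee_fin.
apply: ler_wpM2r => //; rewrite addr_ge0// divr_ge0 ?sqrtr_ge0// addr_ge0 ?sqrtr_ge0//.
exact: ltW.
Qed.
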